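(* Let $(\mathcal{P},\mathcal{N})$ be a Beurling generalized number system satisfying $N(x)=Ax+O(x^\theta)$ for some $A>0$ and $\theta\in [0,1)$, and: \[ \exists p>1: \forall \varepsilon>0: \sum_{n_{k}\le x}\chi(n_{k},1)^{p} \ll_{\varepsilon}x^{1+\varepsilon}. \] Then for every $\varepsilon>0$ and $\delta>0$ there exists $T_{0}=T_{0}(\varepsilon,\delta)$ such that uniformly for $T\ge T_{0}$, $\alpha \ge (\theta+2)/3 + \delta$: \[ N(\alpha,T) \ll_{\varepsilon,p} T^{\frac{1-\alpha}{2\alpha^{2}-3\alpha+2-\theta}(4\alpha-2\theta)+\varepsilon}. \]
   Context: Generalized integers $n_k$ of the system, $N(x)=\#\{n_k\le x\}$, $\zeta(s)=\sum_k n_k^{-s}$, $\chi(x,\lambda)=\#\{k:|x-n_k|\le\lambda\}$, and $N(\alpha,T)=\#\{\rho=\beta+\mathrm{i}\gamma:\zeta(\rho)=0,\ \beta\ge\alpha,\ |\gamma|\le T\}$. The hypothesis on $\chi(n_k,1)^p$ is called the average Ramanujan condition. *)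

(* Defs.v *)
From HB Require Import structures.
From mathcomp Require Import all_boot all_order all_algebra finmap.
From mathcomp Require Import all_classical all_reals all_analysis.
From mathcomp Require Import complex.

Set Implicit Arguments.
Unset Strict Implicit.
Unset Printing Implicit Defensive.
Import Order.TTheory GRing.Theory Num.Theory numFieldNormedType.Exports.

Local Open Scope classical_set_scope.
Local Open Scope ring_scope.
Local Open Scope complex_scope.

(* [gint] lists, in nondecreasing order and with multiplicity, the products of
   powers of generalized primes: [e] is a bijection from indices k to finitely
   supported exponent vectors. In particular n_0 = 1 is the empty product. *)
Record beurling_system (R : realType) := BeurlingSystem {
  gprime : nat -> R ;
  gprime_gt1 : forall j, 1 < gprime j ;
  gprime_nondecreasing : {homo gprime : i j / (i <= j)%N >-> i <= j} ;
  gprime_cvg : gprime @ \oo --> +oo ;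
  gint : nat -> R ;
  gint_nondecreasing : {homo gint : i j / (i <= j)%N >-> i <= j} ;
  gint_products : exists e : nat -> {fsfun nat -> nat with 0%N},
    bijective e /\
    forall k, gint k = \prod_(j <- finsupp (e k)) gprime j ^+ e k j
}.

Section Beurling.
Context {R : realType}.
Implicit Types (S : beurling_system R) (x lambda theta alpha T : R).

(* The index sets below are finite because gprime > 1 tends to infinity. *)
Definition counting_fun S x : nat := #|` fset_set [set k | gint S k <= x]|.

Definition chi S x lambda : nat :=
  #|` fset_set [set k | `|x - gint S k| <= lambda]|.

(* x^s for x > 0, with the real logarithm of x *)
Definition cpow x (s : R[i]) : R[i] :=
  (x `^ complex.Re s)%:C *
  (cos (complex.Im s * ln x) +i* sin (complex.Im s * ln x)).

(* [R[i]^o] carries the topology of the modulus and the C-linear structure, so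
   that derivability in the direction 1 is complex differentiability. *)
Definition holomorphic_at (f : R[i]^o -> R[i]^o) (s : R[i]^o) : Prop :=
  \forall z \near s, derivable f z 1.

(* Z is sum_k n_k^-s on Re s > 1, continued analytically to the half-plane
   Re s > theta punctured at s = 1. As this domain is connected, all such Z
   agree on it. *)
Definition is_zeta S theta (Z : R[i]^o -> R[i]^o) : Prop :=
  (forall s : R[i]^o, 1 < complex.Re s ->
     series (fun k => cpow (gint S k) (- s) : R[i]^o) @ \oo --> Z s) /\
  (forall s : R[i]^o, theta < complex.Re s -> s != 1 -> holomorphic_at Z s).

(* The default value of [xget] is never used when N(x) = A x + O(x^theta):
   the continuation then exists. *)
Definition zeta S theta : R[i]^o -> R[i]^o := xget (fun=> 0) (is_zeta S theta).

(* The supremum of the m such that (s - rho)^m divides f in the ring of germs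
   of holomorphic functions at rho; it is +oo if f vanishes near rho. *)
Definition zero_order (f : R[i]^o -> R[i]^o) (rho : R[i]^o) : \bar R :=
  ereal_sup [set m%:R%:E | m in [set m : nat |
    exists2 g : R[i]^o -> R[i]^o, holomorphic_at g rho &
      \forall s \near rho, f s = (s - rho) ^+ m * g s]].

(* The point s = 1 is the pole of zeta, where the value of the total function
   [zeta S theta] is meaningless. *)
Definition zeta_zeros S theta alpha T : set R[i]^o :=
  [set rho | [/\ rho != 1, zeta S theta rho = 0,
                 alpha <= complex.Re rho & `|complex.Im rho| <= T]].

(* N(alpha, T), each zero being counted with its multiplicity. It is meant for
   theta < alpha; its value is +oo if there are infinitely many zeros. *)
Definition zeta_zero_count S theta alpha T : \bar R :=
  \esum_(rho in zeta_zeros S theta alpha T) zero_order (zeta S theta) rho.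

End Beurling.

(* Main.v *)
Require Import Defs.
From HB Require Import structures.
From mathcomp Require Import all_boot all_order all_algebra finmap.
From mathcomp Require Import all_classical all_reals all_analysis.
From mathcomp Require Import complex ring lra zify.

Set Implicit Arguments.
Unset Strict Implicit.
Unset Printing Implicit Defensive.
Import Order.TTheory GRing.Theory Num.Theory numFieldNormedType.Exports.
Local Open Scope classical_set_scope.
Local Open Scope ring_scope.

(* Only the case p = 1 of the hypothesis on chi matters, because chi(n_k, 1) is at least 1.
   Abel summation continues (s - 1) zeta(s) to Re s > theta, with an explicit distance to the
   partial sums, and Moebius inversion in the free monoid of generalized integers gives a
   mollifier M_X. For U <= |Im s| <= 2 U one has zeta M_X = 1 + P + o(1), where P is a Dirichlet
   polynomial over X < n <= Y whose coefficients are O(n^eps). Jensen's inequality for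
   1 - (zeta M_X - 1)^2 on discs centred at kappa + i (t0 + j h), with h = U^-eps, bounds the
   number of zeros by a discrete mean square of P on vertical lines, and such a mean square is
   O(sum |a_n|^2 n^(-2 sigma) (n + U) chi(n, 1)): the frequencies log n are 1/n-separated up to
   repetitions counted by chi. With D = 2 alpha^2 - 3 alpha + 2 - theta, the choices
   X = U^((3 alpha - 2 - theta)/D) and Y = U^((2 alpha - theta)/D + lam) balance the two terms.
   A dyadic decomposition in U, and one large disc for the zeros of bounded height, conclude. *)

(** At a zero of zeta the function 1 - (zeta M_X - 1)^2 vanishes, while its modulus is at most 1 +
    |zeta M_X - 1|^2, so P enters through its square. Jensen's inequality is used as |f(c)| (r /
    r')^n <= mean of |f| on the circle: no logarithm occurs, and since the right side is linear in a
    majorant of |f|, it can be summed over the centres inside the mean, where each angle gives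
    sample points on one vertical line. The centre [kappa] is so far to the right that P is small
    there for all X and Y.

    The average condition controls chi only in sum. Hence the mean square keeps the weight chi(n, 1)
    inside the sum over n, where the convergent series of chi(n, 1) n^(-1-eps) absorbs it.

    X and Y solve two conditions on exponents: Y^(2 - 2 alpha) = U X^(1 - 2 alpha), and U Y^(theta -
    alpha) X^(1 - theta) = 1 for the truncation error of zeta M_X. The extra lam makes this error
    o(1); 3 alpha >= 2 + theta says X >= 1. A lower bound (1 - theta) / 2 for D makes the constants
    uniform in alpha. *)

Local Notation Re := complex.Re.
Local Notation Im := complex.Im.
Local Notation "x %:C" := (real_complex _ x) : ring_scope.
Local Notation "x +i* y" := (Complex x y) (at level 40, left associativity) : ring_scope.

(** * Complex differentiation *)

Section Modulus.
Variable R : realType.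
Implicit Types (z w : R[i]) (x : R).

(** The library norm of [R[i]] takes values in [R[i]], whose order is partial; a real-valued modulus
    keeps the estimates in a totally ordered field. *)
Definition cabs z : R := Num.sqrt (Re z ^+ 2 + Im z ^+ 2).

Lemma normE z : `|z| = (cabs z)%:C.
Proof. exact: normc_def. Qed.

Lemma cabs_ge0 z : 0 <= cabs z.
Proof. exact: sqrtr_ge0. Qed.

Lemma sqr_cabs z : cabs z ^+ 2 = Re z ^+ 2 + Im z ^+ 2.
Proof. by rewrite sqr_sqrtr // addr_ge0 ?sqr_ge0. Qed.

Lemma cabsM z w : cabs (z * w) = cabs z * cabs w.
Proof. by apply: complexI; rewrite rmorphM /= -!normE normrM. Qed.

Lemma cabsN z : cabs (- z) = cabs z.
Proof. by apply: complexI; rewrite /= -!normE normrN. Qed.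

Lemma cabsV z : cabs z^-1 = (cabs z)^-1.
Proof. by apply: complexI; rewrite fmorphV /= -!normE normfV. Qed.

Lemma cabsX z n : cabs (z ^+ n) = cabs z ^+ n.
Proof. by apply: complexI; rewrite rmorphXn /= -!normE normrX. Qed.

Lemma cabs0 : cabs 0 = 0.
Proof. by apply: complexI; rewrite /= -normE normr0. Qed.

Lemma cabs1 : cabs 1 = 1.
Proof. by apply: complexI; rewrite /= -normE normr1. Qed.

Lemma cabsD z w : cabs (z + w) <= cabs z + cabs w.
Proof. by rewrite -lecR rmorphD /= -!normE ler_normD. Qed.

Lemma cabsB z w : cabs (z - w) <= cabs z + cabs w.
Proof. by rewrite -[cabs w]cabsN cabsD. Qed.

Lemma cabs_distC z w : cabs (z - w) = cabs (w - z).
Proof. by rewrite -cabsN opprB. Qed.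

Lemma cabs_sub_ge z w : cabs z - cabs w <= cabs (z - w).
Proof. by rewrite lerBlDr -{1}(subrK w z) cabsD. Qed.

Lemma cabs_tri z w u : cabs (z - u) <= cabs (z - w) + cabs (w - u).
Proof. by rewrite (le_trans _ (cabsD _ _)) // addrA subrK. Qed.

Lemma cabs_eq0 z : (cabs z == 0) = (z == 0).
Proof. by rewrite -(inj_eq (@complexI R)) -normE normr_eq0. Qed.

Lemma cabs_gt0 z : (0 < cabs z) = (z != 0).
Proof. by rewrite lt_def cabs_ge0 andbT cabs_eq0. Qed.

Lemma cabs_real x : cabs x%:C = `|x|.
Proof. by rewrite /cabs /= expr0n addr0 sqrtr_sqr. Qed.

Lemma Re_le_cabs z : `|Re z| <= cabs z.
Proof. by rewrite -sqrtr_sqr ler_sqrt ?addr_ge0 ?sqr_ge0 // lerDl sqr_ge0. Qed.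

Lemma Im_le_cabs z : `|Im z| <= cabs z.
Proof. by rewrite -sqrtr_sqr ler_sqrt ?addr_ge0 ?sqr_ge0 // lerDr sqr_ge0. Qed.

Lemma cabs_le_ReIm z : cabs z <= `|Re z| + `|Im z|.
Proof.
rewrite -(@ler_pXn2r _ 2) ?nnegrE ?cabs_ge0 ?addr_ge0 //.
rewrite sqr_cabs sqrrD !real_normK ?num_real // lerD2r lerDl.
by rewrite mulrn_wge0 // mulr_ge0.
Qed.

Lemma cabs_sum (I : Type) (r : seq I) (P : pred I) (F : I -> R[i]) :
  cabs (\sum_(i <- r | P i) F i) <= \sum_(i <- r | P i) cabs (F i).
Proof.
elim/big_ind2 : _ => [|x1 x2 y1 y2 h1 h2|//]; first by rewrite cabs0.
exact: le_trans (cabsD _ _) (lerD h1 h2).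
Qed.

Lemma ReD z w : Re (z + w) = Re z + Re w. Proof. by case: z w => [? ?] []. Qed.
Lemma ImD z w : Im (z + w) = Im z + Im w. Proof. by case: z w => [? ?] []. Qed.
Lemma ReN z : Re (- z) = - Re z. Proof. by case: z. Qed.
Lemma ImN z : Im (- z) = - Im z. Proof. by case: z. Qed.
Lemma ReM z w : Re (z * w) = Re z * Re w - Im z * Im w.
Proof. by case: z w => [? ?] []. Qed.
Lemma ImM z w : Im (z * w) = Re z * Im w + Im z * Re w.
Proof. by case: z w => [? ?] []. Qed.

Lemma complex_eq z w : Re z = Re w -> Im z = Im w -> z = w.
Proof. by case: z w => [? ?] [? ?] /= -> ->. Qed.

Lemma cabs_sqrE z : (cabs z ^+ 2)%:C = z * conjc z.
Proof. by rewrite -sqr_normc normE -rmorphXn. Qed.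

End Modulus.

Section Derivatives.
Variable R : realType.
Implicit Types (f g : R[i] -> R[i]) (F G : R -> R[i]) (z l : R[i]) (t : R).

(** Differentiability by increments: without a quotient, h = 0 needs no exclusion and error terms
    compose directly. [rderiv] is the analogue along the real line. *)
Definition cderiv f z l := forall e : R, 0 < e -> exists2 d : R, 0 < d &
  forall h : R[i], cabs h < d -> cabs (f (z + h) - f z - l * h) <= e * cabs h.

Definition rderiv F t l := forall e : R, 0 < e -> exists2 d : R, 0 < d &
  forall h : R, `|h| < d -> cabs (F (t + h) - F t - l * h%:C) <= e * `|h|.

Definition cdiff f z := exists l, cderiv f z l.

Definition cnear z (P : R[i] -> Prop) :=
  exists2 d : R, 0 < d & forall w, cabs (w - z) < d -> P w.

Lemma cnbhsP (z : R[i]^o) (P : set R[i]^o) : nbhs z P <-> cnear z P.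
Proof.
split=> [/nbhs_ballP[e /= e0 h]|[d d0 h]].
  move: e0; rewrite ltcE /= => /andP[/eqP ei er].
  exists (Re e) => // w wz; apply: h; rewrite -ball_normE /ball_ /=.
  by rewrite distrC normE ltcE /= ei eqxx.
apply/nbhs_ballP; exists d%:C; first by rewrite /= ltcE /= eqxx.
move=> w; rewrite -ball_normE /ball_ /= distrC normE ltcR; exact: h.
Qed.

Lemma is_deriveP (f : R -> R) (t l : R) : is_derive t 1 f l <->
  forall e : R, 0 < e -> exists2 d : R, 0 < d &
  forall h : R, `|h| < d -> `|f (t + h) - f t - l * h| <= e * `|h|.
Proof.
split.
  move=> [dv <-] e e0.
  have /cvgrPdist_le/(_ _ e0) := dv.
  rewrite /dnbhs /within /= => /nbhs_ballP[d /= d0 H].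
  exists d => // h hd.
  have [->|h0] := eqVneq h 0; first by rewrite addr0 mulr0 !subrr normr0 mulr0.
  have := H h; rewrite -ball_normE /ball_ /= sub0r normrN => /(_ hd h0).
  rewrite -/('D_1 f t) => hh; rewrite -ler_pdivrMr ?normr_gt0 //.
  move: hh; congr (_ <= _); rewrite -[LHS]normrN -normfV -normrM; congr Num.norm.
  rewrite opprB /GRing.scale /= mulr1 (addrC h) mulrBl -mulrA mulfV // mulr1.
  by rewrite [_ * h^-1]mulrC.
move=> H.
have cv : (fun h : R => h^-1 *: ((f \o shift t) (h *: (1 : R)) - f t)) @ 0^' --> l.
  apply/cvgrPdist_le => e e0; have [d d0 h] := H _ e0.
  rewrite /dnbhs /within /=; apply/nbhs_ballP; exists d => // x.
  rewrite -ball_normE /ball_ /= sub0r normrN => xd x0.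
  rewrite -(@ler_pM2r _ `|x|) ?normr_gt0 // -normrM.
  have := h _ xd; congr (_ <= _); rewrite -[LHS]normrN; congr Num.norm.
  rewrite /GRing.scale /= mulr1 (addrC x); set a := f _; set b := f _.
  by field.
apply: DeriveDef; first by apply/cvg_ex; exists l.
by apply/cvg_lim.
Qed.

(** Needed at the interface: [is_zeta] and [zero_order] speak of library derivability, the estimates
    of increments. *)
Lemma derivableP1 (f : R[i]^o -> R[i]^o) (z : R[i]^o) : derivable f z 1 <-> cdiff f z.
Proof.
split.
  move=> /cvg_ex[l /= hl]; exists l => e e0.
  have e0' : 0 < e%:C :> R[i] by rewrite ltcR.
  have /cvgrPdist_le/(_ _ e0') := hl.
  rewrite /dnbhs /within /= => /cnbhsP[d d0 H].
  exists d => // h hd.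
  have [->|h0] := eqVneq h 0; first by rewrite addr0 mulr0 !subrr cabs0 mulr0.
  have := H h; rewrite subr0 => /(_ hd h0).
  rewrite normE lecR => hh.
  have -> : f (z + h) - f z - l * h = - h * (l - h^-1 * (f (h * 1 + z) - f z)).
    rewrite mulr1 (addrC h); set a := f _; set b := f _.
    by field.
  by rewrite cabsM cabsN mulrC ler_wpM2r ?cabs_ge0.
move=> [l H]; apply/cvg_ex; exists l.
apply/cvgrPdist_le => e; rewrite ltcE /= => /andP[/eqP ei er].
have [d d0 h] := H _ er.
rewrite /dnbhs /within /=; apply/cnbhsP; exists d => // x.
rewrite subr0 => xd x0.
rewrite normE lecE /= ei eqxx /= -(@ler_pM2r _ (cabs x)) ?cabs_gt0 // -cabsM.
have := h _ xd; congr (_ <= _); rewrite -[LHS]cabsN; congr cabs.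
rewrite /GRing.scale /= mulr1 (addrC x); set a := f _; set b := f _.
by field.
Qed.

Lemma cderiv_ext f g z l : cnear z (fun w => f w = g w) -> cderiv f z l -> cderiv g z l.
Proof.
move=> [d1 d10 h1] H e /H[d d0 h]; exists (Num.min d d1); first by rewrite lt_min d0.
move=> x; rewrite lt_min => /andP[xd xd1]; rewrite -!h1 ?h //.
  by rewrite subrr cabs0.
by rewrite addrC addKr.
Qed.

Lemma cderiv_cst (c : R[i]) z : cderiv (fun=> c) z 0.
Proof. by move=> e e0; exists 1 => // h _; rewrite subrr mul0r subr0 cabs0 mulr_ge0 ?cabs_ge0 ?ltW. Qed.

Lemma cderiv_id z : cderiv id z 1.
Proof.
move=> e e0; exists 1 => // h _.
by rewrite (_ : _ - _ = 0) ?cabs0 ?mulr_ge0 ?cabs_ge0 ?ltW //=; ring.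
Qed.

Lemma cderivD f g z l m : cderiv f z l -> cderiv g z m ->
  cderiv (fun w => f w + g w) z (l + m).
Proof.
move=> hf hg e e0; have e2 : 0 < e / 2 by rewrite divr_gt0.
have [d1 d10 h1] := hf _ e2; have [d2 d20 h2] := hg _ e2.
exists (Num.min d1 d2); first by rewrite lt_min d10.
move=> h; rewrite lt_min => /andP[hd1 hd2].
rewrite (_ : _ - _ = (f (z + h) - f z - l * h) + (g (z + h) - g z - m * h)); last by ring.
rewrite (le_trans (cabsD _ _)) // (le_trans (lerD (h1 _ hd1) (h2 _ hd2))) //.
by rewrite -mulrDl -splitr.
Qed.

Lemma cdiff_bound f z l : cderiv f z l -> exists2 d : R, 0 < d &
  forall h, cabs h < d -> cabs (f (z + h) - f z) <= (cabs l + 1) * cabs h.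
Proof.
move=> /(_ 1 ltr01)[d d0 H]; exists d => // h /H.
rewrite mul1r mulrDl mul1r -cabsM => hh.
by rewrite -{1}(subrK (l * h) (f _ - _)) (le_trans (cabsD _ _)) // addrC lerD2l.
Qed.

Lemma cdiff_cont f z : cdiff f z -> forall e : R, 0 < e ->
  cnear z (fun w => cabs (f w - f z) < e).
Proof.
move=> [l /cdiff_bound[d d0 H]] e e0.
have l0 : 0 < cabs l + 1 by rewrite ltr_wpDl ?cabs_ge0.
exists (Num.min d (e / (cabs l + 1))); first by rewrite lt_min d0 divr_gt0.
move=> w; rewrite lt_min => /andP[wd we].
have := H _ wd; rewrite [z + _]addrC subrK => /le_lt_trans; apply.
by rewrite mulrC -ltr_pdivlMr.
Qed.

Lemma cderivM f g z l m : cderiv f z l -> cderiv g z m ->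
  cderiv (fun w => f w * g w) z (l * g z + f z * m).
Proof.
move=> hf hg e e0.
pose B := cabs (f z) + cabs (g z) + cabs l + 1.
have B0 : 0 < B by rewrite ltr_wpDl ?addr_ge0 ?cabs_ge0.
have e1 : 0 < e / 3 / B by rewrite !divr_gt0.
have [d1 d10 h1] := hf _ e1; have [d2 d20 h2] := hg _ e1.
have [d3 d30 h3] := cdiff_bound hf.
have [d4 d40 h4] := cdiff_cont (ex_intro _ _ hg) e1.
exists (Num.min (Num.min d1 d2) (Num.min d3 d4)); first by rewrite !lt_min d10 d20 d30.
move=> h; rewrite !lt_min => /andP[/andP[hd1 hd2] /andP[hd3 hd4]].
rewrite (_ : _ - _ = (f (z + h) - f z - l * h) * g z + f z * (g (z + h) - g z - m * h)
   + (f (z + h) - f z) * (g (z + h) - g z)); last by ring.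
rewrite (le_trans (cabsD _ _)) //.
have := cabs_ge0 h; have := cabs_ge0 (f z); have := cabs_ge0 (g z); have := cabs_ge0 l.
move=> l0 g0 f0 c0.
have -> : e * cabs h = e/3/B * cabs h * B + e/3/B * cabs h * B + e/3/B * cabs h * B.
  by field; rewrite gt_eqF.
have k0 : 0 <= e / 3 / B * cabs h by rewrite mulr_ge0 // ltW.
apply: lerD; first rewrite (le_trans (cabsD _ _)) // lerD //.
- rewrite cabsM ler_pM ?cabs_ge0 ?h1 //; rewrite /B; lra.
- rewrite cabsM mulrC ler_pM ?cabs_ge0 ?h2 //; rewrite /B; lra.
- have := h4 (z + h); rewrite addrC addKr => /(_ hd4)/ltW hg4.
  rewrite cabsM [leRHS](_ : _ = B * cabs h * (e / 3 / B)); last by ring.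
  rewrite ler_pM ?cabs_ge0 //.
  by rewrite (le_trans (h3 _ hd3)) // ler_wpM2r // /B; lra.
Qed.

Lemma cderivB f g z l m : cderiv f z l -> cderiv g z m ->
  cderiv (fun w => f w - g w) z (l - m).
Proof.
move=> hf hg e e0; have e2 : 0 < e / 2 by rewrite divr_gt0.
have [d1 d10 h1] := hf _ e2; have [d2 d20 h2] := hg _ e2.
exists (Num.min d1 d2); first by rewrite lt_min d10.
move=> h; rewrite lt_min => /andP[hd1 hd2].
rewrite (_ : _ - _ = (f (z + h) - f z - l * h) - (g (z + h) - g z - m * h)); last by ring.
rewrite (le_trans (cabsB _ _)) // (le_trans (lerD (h1 _ hd1) (h2 _ hd2))) //.
by rewrite -mulrDl -splitr.
Qed.

Lemma cderiv_eq f z l m : l = m -> cderiv f z l -> cderiv f z m.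
Proof. by move=> ->. Qed.

Lemma cderivV f z l : f z != 0 -> cderiv f z l ->
  cderiv (fun w => (f w)^-1) z (- l / f z ^+ 2).
Proof.
move=> fz0 hf e e0.
have fz : 0 < cabs (f z) by rewrite cabs_gt0.
have f2 : 0 < cabs (f z) / 2 by rewrite divr_gt0.
pose B := cabs l + 1; have B0 : 0 < B by rewrite ltr_wpDl ?cabs_ge0.
have e1 : 0 < e * cabs (f z) ^+ 2 / 4 by rewrite !divr_gt0 // mulr_gt0 // exprn_gt0.
have e2 : 0 < e * cabs (f z) ^+ 3 / (4 * B) by rewrite divr_gt0 ?mulr_gt0 ?exprn_gt0.
have [d1 d10 h1] := hf _ e1.
have [d3 d30 h3] := cdiff_bound hf.
have [d4 d40 h4] := cdiff_cont (ex_intro _ _ hf) f2.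
have [d5 d50 h5] := cdiff_cont (ex_intro _ _ hf) e2.
exists (Num.min (Num.min d1 d5) (Num.min d3 d4)); first by rewrite !lt_min d10 d50 d30.
move=> h; rewrite !lt_min => /andP[/andP[hd1 hd5] /andP[hd3 hd4]].
have := h4 (z + h); have := h5 (z + h); rewrite [z + h - z]addrC addKr.
move=> /(_ hd5)/ltW H5 /(_ hd4) H4.
have fzh : cabs (f z) / 2 <= cabs (f (z + h)).
  have := cabs_sub_ge (f z) (f z - f (z + h)).
  rewrite subKr; rewrite cabs_distC in H4; lra.
have fzh0 : f (z + h) != 0 by rewrite -cabs_gt0 (lt_le_trans _ fzh).
rewrite (_ : _ - _ = - (f (z + h) - f z - l * h) / (f z * f (z + h))
  + l * h * (f (z + h) - f z) / (f z ^+ 2 * f (z + h))); last by field; rewrite fz0 fzh0.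
rewrite (le_trans (cabsD _ _)) //.
rewrite [leRHS](_ : _ = e / 2 * cabs h + e / 2 * cabs h); last by rewrite -mulrDl -splitr.
have ch := cabs_ge0 h.
rewrite lerD // !cabsM cabsV ler_pdivrMr ?cabs_gt0 ?mulf_neq0 ?expf_neq0 // !cabsM ?cabsX.
  rewrite cabsN (le_trans (h1 _ hd1)) //.
  rewrite [leLHS](_ : _ = (e / 2 * cabs h * cabs (f z)) * (cabs (f z) / 2)); last by field.
  by rewrite [leRHS]mulrA ler_wpM2l // !mulr_ge0 // ?cabs_ge0 // ltW // divr_gt0.
apply: (@le_trans _ _ (B * cabs h * (e * cabs (f z) ^+
 3 / (4 * B)))).
  rewrite ler_pM ?mulr_ge0 ?cabs_ge0 // ler_wpM2r // /B; lra.
rewrite [leLHS](_ : _ = (e / 2 * cabs h) * (cabs (f z) ^+ 2 * (cabs (f z) / 2))); last by field; rewrite gt_eqF.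
by rewrite ler_wpM2l ?mulr_ge0 ?divr_ge0 ?(ltW e0) // ler_wpM2l // exprn_ge0 // ltW.
Qed.

Lemma cderiv_comp f g z l m : cderiv g z m -> cderiv f (g z) l ->
  cderiv (fun w => f (g w)) z (l * m).
Proof.
move=> hg hf e e0.
pose B := cabs m + 1; have B0 : 0 < B by rewrite ltr_wpDl ?cabs_ge0.
pose A := cabs l + 1; have A0 : 0 < A by rewrite ltr_wpDl ?cabs_ge0.
have e1 : 0 < e / 2 / B by rewrite !divr_gt0.
have e2 : 0 < e / 2 / A by rewrite !divr_gt0.
have [d1 d10 h1] := hf _ e1; have [d2 d20 h2] := hg _ e2.
have [d3 d30 h3] := cdiff_bound hg.
exists (Num.min (Num.min d3 d2) (d1 / B)); first by rewrite !lt_min d30 d20 divr_gt0.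
move=> h; rewrite !lt_min => /andP[/andP[hd3 hd2] hd1].
have H3 := h3 _ hd3.
have k1 : cabs (g (z + h) - g z) < d1.
  by rewrite (le_lt_trans H3) // mulrC -ltr_pdivlMr.
have := h1 _ k1; rewrite [g z + _]addrC subrK => H1.
rewrite (_ : _ - _ = f (g (z + h)) - f (g z) - l * (g (z + h) - g z)
   + l * (g (z + h) - g z - m * h)); last by ring.
have ch := cabs_ge0 h; have cl := cabs_ge0 l.
rewrite (le_trans (cabsD _ _)) //.
rewrite [leRHS](_ : _ = e / 2 / B * (B * cabs h) + A * (e / 2 / A * cabs h)); last first.
  by field; rewrite !gt_eqF.
rewrite lerD //.
  by rewrite (le_trans H1) // ler_wpM2l // ltW.
by rewrite cabsM ler_pM ?cabs_ge0 ?h2 // /A; lra.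
Qed.

Lemma cdiff_cst (c z : R[i]) : cdiff (fun=> c) z.
Proof. by exists 0; exact: cderiv_cst. Qed.
Lemma cdiff_id z : cdiff id z.
Proof. by exists 1; exact: cderiv_id. Qed.
Lemma cdiffD f g z : cdiff f z -> cdiff g z -> cdiff (fun w => f w + g w) z.
Proof. by move=> [l hl] [m hm]; exists (l + m); exact: cderivD. Qed.
Lemma cdiffM f g z : cdiff f z -> cdiff g z -> cdiff (fun w => f w * g w) z.
Proof. by move=> [l hl] [m hm]; eexists; exact: cderivM hl hm. Qed.
Lemma cdiffV f z : f z != 0 -> cdiff f z -> cdiff (fun w => (f w)^-1) z.
Proof. by move=> f0 [l hl]; eexists; exact: cderivV f0 hl. Qed.
Lemma cdiff_comp f g z : cdiff g z -> cdiff f (g z) -> cdiff (fun w => f (g w)) z.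
Proof. by move=> [l hl] [m hm]; eexists; exact: cderiv_comp hl hm. Qed.
Lemma cdiffN f z : cdiff f z -> cdiff (fun w => - f w) z.
Proof.
move=> hf; have := cdiffM (cdiff_cst (-1) z) hf.
by congr (cdiff _ z); apply/funext => w; rewrite mulN1r.
Qed.
Lemma cdiffB f g z : cdiff f z -> cdiff g z -> cdiff (fun w => f w - g w) z.
Proof. by move=> hf hg; apply: cdiffD => //; exact: cdiffN. Qed.
Lemma cdiff_div_sub1 f z : z != 1 -> cdiff f z -> cdiff (fun w => f w / (w - 1)) z.
Proof.
move=> z1 hf; apply: cdiffM => //; apply: cdiffV; first by rewrite subr_eq0.
by apply: cdiffB; [exact: cdiff_id|exact: cdiff_cst].
Qed.
Lemma cdiffX f z n : cdiff f z -> cdiff (fun w => f w ^+ n) z.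
Proof.
move=> hf; elim: n => [|n IHn].
  by have := cdiff_cst 1 z; congr (cdiff _ z).
have := cdiffM hf IHn; congr (cdiff _ z); apply/funext => w.
by rewrite exprS.
Qed.
Lemma cdiff_sum (I : Type) (r : seq I) (P : pred I) (f : I -> R[i] -> R[i]) z :
  (forall i, P i -> cdiff (f i) z) -> cdiff (fun w => \sum_(i <- r | P i) f i w) z.
Proof.
move=> H; elim: r => [|i r IHr].
  by have := cdiff_cst 0 z; congr (cdiff _ z); apply/funext => w; rewrite big_nil.
case: (boolP (P i)) => Pi.
  have := cdiffD (H _ Pi) IHr; congr (cdiff _ z); apply/funext => w.
  by rewrite big_cons Pi.
by move: IHr; congr (cdiff _ z); apply/funext => w; rewrite big_cons (negbTE Pi).
Qed.
Lemma cdiff_ext f g z : cnear z (fun w => f w = g w) -> cdiff f z -> cdiff g z.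
Proof. by move=> h [l hl]; exists l; exact: cderiv_ext hl. Qed.

Lemma cnearT z (P : R[i] -> Prop) : (forall w, P w) -> cnear z P.
Proof. by move=> H; exists 1. Qed.

Lemma cnear_point z (P : R[i] -> Prop) : cnear z P -> P z.
Proof. by move=> [d d0 h]; apply: h; rewrite subrr cabs0. Qed.

Lemma cnearI z (P Q : R[i] -> Prop) : cnear z P -> cnear z Q ->
  cnear z (fun w => P w /\ Q w).
Proof.
move=> [d d0 h] [e e0 k]; exists (Num.min d e); first by rewrite lt_min d0.
by move=> w; rewrite lt_min => /andP[wd we]; split; [exact: h|exact: k].
Qed.

Lemma cnearS z (P Q : R[i] -> Prop) : (forall w, P w -> Q w) -> cnear z P -> cnear z Q.
Proof. by move=> PQ [d d0 h]; exists d => // w /h/PQ. Qed.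

Lemma cnear_neq z w : z != w -> cnear z (fun u => u != w).
Proof.
move=> zw; exists (cabs (w - z)); first by rewrite cabs_gt0 subr_eq0 eq_sym.
by move=> u; apply: contraTN => /eqP ->; rewrite ltxx.
Qed.

Lemma cnear_Re_gt z (a : R) : a < Re z -> cnear z (fun w => a < Re w).
Proof.
move=> az; exists (Re z - a); first by rewrite subr_gt0.
move=> w hw; have := le_lt_trans (Re_le_cabs _) hw.
by rewrite ReD ReN ltr_norml => /andP[]; lra.
Qed.

Lemma rderivP F t l : rderiv F t l <->
  is_derive t 1 (fun x => Re (F x)) (Re l) /\ is_derive t 1 (fun x => Im (F x)) (Im l).
Proof.
have E h : F (t + h) - F t - l * h%:C =
   (Re (F (t + h)) - Re (F t) - Re l * h) +i* (Im (F (t + h)) - Im (F t) - Im l * h).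
  by apply: complex_eq; rewrite /= !(ReD, ImD, ReN, ImN, ReM, ImM) /=; ring.
split.
  move=> H; split; apply/is_deriveP => e /H[d d0 h]; exists d => // x /h; rewrite E.
    by apply: le_trans; rewrite (le_trans _ (Re_le_cabs _)).
  by apply: le_trans; rewrite (le_trans _ (Im_le_cabs _)).
move=> [/is_deriveP h1 /is_deriveP h2] e e0.
have e2 : 0 < e / 2 by rewrite divr_gt0.
have [d d0 hd] := h1 _ e2; have [d' d0' hd'] := h2 _ e2.
exists (Num.min d d'); first by rewrite lt_min d0.
move=> x; rewrite lt_min => /andP[xd xd']; rewrite E (le_trans (cabs_le_ReIm _)) //=.
by rewrite (le_trans (lerD (hd _ xd) (hd' _ xd'))) // -mulrDl -splitr.
Qed.

Lemma rderiv_comp f F t l m : rderiv F t m -> cderiv f (F t) l ->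
  rderiv (fun x => f (F x)) t (l * m).
Proof.
move=> hg hf e e0.
pose B := cabs m + 1; have B0 : 0 < B by rewrite ltr_wpDl ?cabs_ge0.
pose A := cabs l + 1; have A0 : 0 < A by rewrite ltr_wpDl ?cabs_ge0.
have e1 : 0 < e / 2 / B by rewrite !divr_gt0.
have e2 : 0 < e / 2 / A by rewrite !divr_gt0.
have [d1 d10 h1] := hf _ e1; have [d2 d20 h2] := hg _ e2.
have [d3 d30 h3] := hg _ ltr01.
exists (Num.min (Num.min d3 d2) (d1 / B)); first by rewrite !lt_min d30 d20 divr_gt0.
move=> h; rewrite !lt_min => /andP[/andP[hd3 hd2] hd1].
have H3 : cabs (F (t + h) - F t) <= B * `|h|.
  rewrite -(subrK (m * h%:C) (_ - _)) (le_trans (cabsD _ _)) // cabsM cabs_real.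
  by rewrite addrC mulrDl lerD2l h3.
have k1 : cabs (F (t + h) - F t) < d1.
  by rewrite (le_lt_trans H3) // mulrC -ltr_pdivlMr.
have := h1 _ k1; rewrite [F t + _]addrC subrK => H1.
rewrite (_ : _ - _ = f (F (t + h)) - f (F t) - l * (F (t + h) - F t)
   + l * (F (t + h) - F t - m * h%:C)); last by ring.
have cl := cabs_ge0 l.
rewrite (le_trans (cabsD _ _)) //.
rewrite [leRHS](_ : _ = e / 2 / B * (B * `|h|) + A * (e / 2 / A * `|h|)); last first.
  by field; rewrite !gt_eqF.
rewrite lerD //.
  by rewrite (le_trans H1) // ler_wpM2l // ltW.
by rewrite cabsM ler_pM ?cabs_ge0 ?h2 // /A; lra.
Qed.

Lemma rderiv_line (a b : R[i]) t : rderiv (fun x => a + b * x%:C) t b.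
Proof.
move=> e e0; exists 1 => // h _.
by rewrite rmorphD (_ : _ - _ = 0) ?cabs0 ?mulr_ge0 ?(ltW e0) //=; ring.
Qed.

Lemma rderivD F G t l m : rderiv F t l -> rderiv G t m ->
  rderiv (fun x => F x + G x) t (l + m).
Proof.
move=> /rderivP[f1 f2] /rderivP[g1 g2]; apply/rderivP; split.
  have := is_deriveD f1 g1; rewrite -ReD; congr (is_derive _ _ _ _).
  by apply/funext => x; rewrite [RHS]ReD.
have := is_deriveD f2 g2; rewrite -ImD; congr (is_derive _ _ _ _).
by apply/funext => x; rewrite [RHS]ImD.
Qed.

Lemma rderivM F G t l m : rderiv F t l -> rderiv G t m ->
  rderiv (fun x => F x * G x) t (l * G t + F t * m).
Proof.
move=> /rderivP[f1 f2] /rderivP[g1 g2]; apply/rderivP; split.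
  have := is_deriveB (is_deriveM f1 g1) (is_deriveM f2 g2).
  rewrite /GRing.scale /= ReD !ReM; set a := (X in is_derive _ _ _ X).
  set b := (X in _ -> is_derive _ _ _ X); rewrite (_ : a = b); last by rewrite /a /b; ring.
  by congr (is_derive _ _ _ _); apply/funext => x; rewrite [RHS]ReM.
have := is_deriveD (is_deriveM f1 g2) (is_deriveM f2 g1).
rewrite /GRing.scale /= ImD !ImM; set a := (X in is_derive _ _ _ X).
set b := (X in _ -> is_derive _ _ _ X); rewrite (_ : a = b); last by rewrite /a /b; ring.
by congr (is_derive _ _ _ _); apply/funext => x; rewrite [RHS]ImM.
Qed.

Lemma rderiv_cst (c : R[i]) t : rderiv (fun=> c) t 0.
Proof. by move=> e e0; exists 1 => // h _; rewrite subrr mul0r subr0 cabs0 mulr_ge0 ?(ltW e0). Qed.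

Lemma rderiv_ext F G t l : F =1 G -> rderiv F t l -> rderiv G t l.
Proof. by move=> /funext ->. Qed.

Lemma rderiv_eq F t l m : l = m -> rderiv F t l -> rderiv F t m.
Proof. by move=> ->. Qed.

(* Rotating [F b - F a] onto the real axis reduces the complex mean value
   inequality to the real mean value theorem. *)
Lemma mvt_ineq F (f : R -> R[i]) (psi dpsi : R -> R) (a b : R) : a <= b ->
  (forall t, a <= t <= b -> rderiv F t (f t)) ->
  (forall t, a <= t <= b -> is_derive t 1 psi (dpsi t)) ->
  (forall t, a < t < b -> cabs (f t) <= dpsi t) ->
  cabs (F b - F a) <= psi b - psi a.
Proof.
move=> ab hF hpsi hb.
have [->|D0] := eqVneq (F b - F a) 0.
  rewrite cabs0.
  have [ba|nab] := eqVneq a b; first by rewrite ba subrr.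
  have lab : a < b by rewrite lt_neqAle nab.
  have [||c /itvP cab ->] := @MVT _ psi dpsi _ _ lab.
  - by move=> x /itvP xab; apply: hpsi; rewrite !ltW ?xab.
  - apply: derivable_within_continuous => x /itvP xab.
    by have [] := hpsi x; rewrite ?xab.
  by rewrite mulr_ge0 ?subr_ge0 // (le_trans (cabs_ge0 (f c))) // hb ?cab.
pose u := conjc (F b - F a) / (cabs (F b - F a))%:C.
have D1 : cabs (F b - F a) != 0 by rewrite cabs_eq0.
have cu : cabs u = 1.
  rewrite cabsM cabsV cabs_real ger0_norm ?cabs_ge0 // (_ : cabs (conjc _) = cabs (F b - F a)) ?divff //.
  by apply: complexI; rewrite -!normE normcJ.
have uD : u * (F b - F a) = (cabs (F b - F a))%:C.
  rewrite /u mulrAC [_ * (F b - F a)]mulrC -cabs_sqrE expr2 rmorphM /= mulfK //.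
  by rewrite (inj_eq (@complexI R) _ 0).
pose phi x := psi x - Re (u * F x).
have hphi t : a <= t <= b -> is_derive t 1 phi (dpsi t - Re (u * f t)).
  move=> tab; apply: is_deriveB; first exact: hpsi.
  have hu : cderiv (fun w => u * w) (F t) u.
    by have := cderivM (cderiv_cst u (F t)) (cderiv_id (F t)); rewrite mul0r add0r mulr1.
  by have /rderivP[] := rderiv_comp (hF t tab) hu.
suff : phi a <= phi b.
  rewrite /phi; have := congr1 (@complex.Re R) uD; rewrite mulrBr ReD ReN /=; lra.
have [->//|nab] := eqVneq a b.
have lab : a < b by rewrite lt_neqAle nab.
rewrite -subr_ge0.
have [||c /itvP cab ->] := @MVT _ phi (fun t => dpsi t - Re (u * f t)) _ _ lab.
- by move=> x /itvP xab; apply: hphi; rewrite !ltW ?xab.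
- apply: derivable_within_continuous => x /itvP xab.
  by have [] := hphi x; rewrite ?xab.
rewrite mulr_ge0 ?subr_ge0 // (le_trans (ler_norm _)) // (le_trans (Re_le_cabs _)) //.
by rewrite cabsM cu mul1r hb ?cab.
Qed.

Lemma mvt_const F (f : R -> R[i]) (M a b : R) : a <= b ->
  (forall t, a <= t <= b -> rderiv F t (f t)) ->
  (forall t, a < t < b -> cabs (f t) <= M) ->
  cabs (F b - F a) <= M * (b - a).
Proof.
move=> ab hF hM; rewrite mulrBr.
apply: (@mvt_ineq F f (fun t => M * t) (fun=> M)) => // t _.
apply/is_deriveP => e e0; exists 1 => // h _.
by rewrite (_ : _ - _ = 0) ?normr0 ?mulr_ge0 ?(ltW e0) //; ring.
Qed.

End Derivatives.

(** * The exponential and Goursat's theorem *)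

Section Exponential.
Variable R : realType.
Implicit Types (z w : R[i]).

Definition cexp z : R[i] := (expR (Re z))%:C * (cos (Im z) +i* sin (Im z)).

Lemma cexpE z : cexp z = (expR (Re z) * cos (Im z)) +i* (expR (Re z) * sin (Im z)).
Proof. by apply: complex_eq; rewrite /cexp ?ReM ?ImM /=; ring. Qed.

Lemma cexpD z w : cexp (z + w) = cexp z * cexp w.
Proof.
by apply: complex_eq; rewrite !cexpE ?ReM ?ImM /= ReD ImD expRD ?cosD ?sinD; ring.
Qed.

Lemma cexp0 : cexp 0 = 1.
Proof. by rewrite /cexp /= expR0 cos0 sin0 mul1r. Qed.

Lemma cabs_cexp z : cabs (cexp z) = expR (Re z).
Proof.
rewrite cabsM cabs_real ger0_norm ?expR_ge0 // (_ : cabs _ = 1) ?mulr1 //.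
by rewrite /cabs /= cos2Dsin2 sqrtr1.
Qed.

Lemma cexp_neq0 z : cexp z != 0.
Proof. by rewrite -cabs_gt0 cabs_cexp expR_gt0. Qed.

Lemma cexp2pi z : cexp (z + (0 +i* (pi *+ 2))) = cexp z.
Proof. by rewrite cexpD [X in _ * X]/cexp /= expR0 cos2pi sin2pi mul1r mulr1. Qed.

Lemma cexp_real (x : R) : cexp x%:C = (expR x)%:C.
Proof. by rewrite /cexp /= cos0 sin0 mulr1. Qed.

Lemma cexpN z : cexp (- z) = (cexp z)^-1.
Proof.
by apply: (mulfI (cexp_neq0 z)); rewrite -cexpD subrr cexp0 mulfV // cexp_neq0.
Qed.

(** The one computation with real and imaginary parts; [cexpD] carries it to every point. *)
Lemma cderiv_cexp0 : cderiv cexp 0 1.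
Proof.
move=> e e0; have e4 : 0 < Num.min 1 (e / 16) by rewrite lt_min ltr01 divr_gt0.
have /is_deriveP/(_ _ e4)[d1 d10 h1] := is_derive_expR (0 : R).
have /is_deriveP/(_ _ e4)[d2 d20 h2] := is_derive_cos (0 : R).
have /is_deriveP/(_ _ e4)[d3 d30 h3] := is_derive_sin (0 : R).
exists (Num.min (Num.min d1 d2) (Num.min d3 (Num.min 1 (e / 16)))).
  by rewrite !lt_min d10 d20 d30 ltr01 divr_gt0.
move=> h; rewrite !lt_min => /andP[/andP[hd1 hd2] /andP[hd3 /andP[hl he]]].
have ra := Re_le_cabs h; have ib := Im_le_cabs h.
have := h1 _ (le_lt_trans ra hd1); have := h2 _ (le_lt_trans ib hd2).
have := h3 _ (le_lt_trans ib hd3).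
rewrite !add0r expR0 cos0 sin0 oppr0 mul0r !subr0 ?addr0 !mul1r cexp0.
set a := Re h in ra *; set b := Im h in ib *; set E := expR a => H3 H2 H1.
set m := Num.min 1 (e / 16) in e4 H1 H2 H3.
have m1 : m <= 1 by rewrite ge_min lexx.
have m8 : m <= e / 16 by rewrite ge_min lexx orbT.
have Eb : `|E - 1| <= 2 * `|a|.
  rewrite -(subrK a (E - 1)) (le_trans (ler_normD _ _)) // mulrDl mul1r lerD2r.
  by rewrite (le_trans H1) // ler_piMl.
have a0 := normr_ge0 a; have b0 := normr_ge0 b.
have E3 : `|E| <= 3.
  by rewrite -(subrK 1 E) (le_trans (ler_normD _ _)) // normr1; lra.
have -> : cexp h - 1 - h = ((E - 1 - a) + E * (cos b - 1)) +i* (E * (sin b - b) + (E - 1) * b).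
  by apply: complex_eq; rewrite cexpE !(ReD, ReN, ImD, ImN) /= -/a -/b -/E; ring.
rewrite (le_trans (cabs_le_ReIm _)) //=.
have k1 : m * `|a| <= e / 16 * cabs h by rewrite ler_pM ?(ltW e4).
have k2 : m * `|b| <= e / 16 * cabs h by rewrite ler_pM ?(ltW e4).
have k3 : `|E * (cos b - 1)| <= 3 * (e / 16 * cabs h).
  by rewrite normrM ler_pM // (le_trans H2).
have k4 : `|E * (sin b - b)| <= 3 * (e / 16 * cabs h).
  by rewrite normrM ler_pM // (le_trans H3).
have k5 : `|(E - 1) * b| <= 2 * (e / 16 * cabs h).
  rewrite normrM mulrA ler_pM // (le_trans Eb) // ler_wpM2l // ltW //.
  exact: le_lt_trans ra he.
have := ler_normD (E - 1 - a) (E * (cos b - 1)).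
have := ler_normD (E * (sin b - b)) ((E - 1) * b).
have -> : e * cabs h = 16 * (e / 16 * cabs h) by field.
have := mulr_ge0 (ltW (divr_gt0 e0 (ltr0n _ 16))) (cabs_ge0 h).
move: k1 k3 k4 k5 H1; set kk := e / 16 * cabs h; lra.
Qed.

Lemma cderiv_cexp z : cderiv cexp z (cexp z).
Proof.
move=> e e0; have cz : 0 < cabs (cexp z) by rewrite cabs_gt0 cexp_neq0.
have [d d0 H] := @cderiv_cexp0 (e / cabs (cexp z)) (divr_gt0 e0 cz).
exists d => // h hd; have := H h hd; rewrite add0r cexp0 mul1r => hh.
rewrite cexpD (_ : _ - _ = cexp z * (cexp h - 1 - h)); last by ring.
by rewrite cabsM mulrC -ler_pdivlMr // mulrAC.
Qed.

Lemma cdiff_cexp z : cdiff cexp z.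
Proof. by exists (cexp z); exact: cderiv_cexp. Qed.

End Exponential.

#[global] Opaque cexp.

(** * Primitives of continuous complex functions on a segment *)

Section Primitives.
Variable R : realType.

Lemma primitive_ex (f : R -> R) (a : R) : continuous f ->
  exists F : R -> R, forall t, a < t -> is_derive t 1 F (f t).
Proof.
move=> cf; exists (fun x => (\int[lebesgue_measure]_(t in [set` `[a, x]]) f t)%R).
move=> t at_; have tt1 : t < t + 1 by rewrite ltrDl.
have itg : lebesgue_measure.-integrable `[a, t + 1] (EFin \o f).
  apply: continuous_compact_integrable; first exact: segment_compact.
  exact: continuous_subspaceT.
have [d1 d2] := @continuous_FTC1_closed R f a t (t + 1) tt1 itg at_ (cf t).
by rewrite derive1E in d2; exact: DeriveDef d1 d2.
Qed.

(** Precomposing with this 1-Lipschitz retraction extends a function continuous on [a, b] to the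
    whole line, as [primitive_ex] requires. *)
Definition clamp (a b x : R) : R := Num.max a (Num.min x b).

Lemma clamp_itv (a b x : R) : a <= b -> a <= clamp a b x <= b.
Proof. by move=> ab; rewrite /clamp le_max lexx /= ge_max ab /= ge_min lexx orbT. Qed.

Lemma clamp_id (a b x : R) : a <= x <= b -> clamp a b x = x.
Proof. by move=> /andP[ax xb]; rewrite /clamp (min_idPl xb) (max_idPr ax). Qed.

Lemma clamp_lip (a b x y : R) : `|clamp a b x - clamp a b y| <= `|x - y|.
Proof.
rewrite /clamp /Num.max /Num.min.
by do ![case: ifP]; move=> *; rewrite ler_norml; have := ler_norm (x - y);
  have := ler_norm (y - x); rewrite (distrC y); lra.
Qed.

Lemma cprimitive_ex (f : R -> R[i]) (a b : R) : a <= b ->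
  (forall t, a <= t <= b -> forall e : R, 0 < e -> exists2 d : R, 0 < d &
     forall x, a <= x <= b -> `|x - t| < d -> cabs (f x - f t) < e) ->
  exists F : R -> R[i], forall t, a <= t <= b -> rderiv F t (f t).
Proof.
move=> ab cf; pose g x := f (clamp a b x).
have cg t e : 0 < e -> exists2 d : R, 0 < d & forall x, `|x - t| < d -> cabs (g x - g t) < e.
  move=> /(cf _ (clamp_itv t ab))[d d0 h]; exists d => // x xt.
  by apply: h; rewrite ?clamp_itv // (le_lt_trans (clamp_lip _ _ _ _)).
have cr : continuous (fun x => Re (g x)).
  move=> t; apply/cvgrPdist_lt => e /(cg t)[d d0 h].
  apply/nbhs_normP; exists d => // x; rewrite /= distrC => /h.
  by rewrite cabs_distC; apply: le_lt_trans; rewrite -ReN -ReD Re_le_cabs.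
have ci : continuous (fun x => Im (g x)).
  move=> t; apply/cvgrPdist_lt => e /(cg t)[d d0 h].
  apply/nbhs_normP; exists d => // x; rewrite /= distrC => /h.
  by rewrite cabs_distC; apply: le_lt_trans; rewrite -ImN -ImD Im_le_cabs.
(* [primitive_ex] differentiates only strictly to the right of its base point; starting at a - 1
   includes t = a. *)
have [F1 h1] := primitive_ex (a - 1) cr; have [F2 h2] := primitive_ex (a - 1) ci.
exists (fun x => F1 x +i* F2 x) => t tab; have at1 : a - 1 < t.
  by case/andP: tab => + _; apply: lt_le_trans; rewrite ltrBlDr ltrDl.
have gt : g t = f t by rewrite /g clamp_id.
by apply/rderivP; rewrite -gt; split; [exact: h1|exact: h2].
Qed.

End Primitives.

(** * Goursat's theorem on a rectangle *)

Section Goursat.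
Variable R : realType.
Local Notation ii := (0 +i* (1 : R)).
Variables (H : R[i] -> R[i]) (P V : R -> R -> R[i]) (a0 b0 c0 d0 : R).
Hypothesis H_diff : forall u v, a0 <= u <= b0 -> c0 <= v <= d0 -> cdiff H (u +i* v).
Hypothesis P_prim : forall u v, a0 <= u <= b0 -> c0 <= v <= d0 ->
  rderiv (P v) u (H (u +i* v)).
Hypothesis V_prim : forall u v, a0 <= u <= b0 -> c0 <= v <= d0 ->
  rderiv (V u) v (H (u +i* v)).

(** The integral of H around the boundary of [a, b] x [c, d], expressed by primitives along
    horizontal and vertical lines, so that additivity under subdivision is a ring identity. *)
Let J (q : R * R * R * R) : R[i] := let: (a, b, c, d) := q in
  (P c b - P c a) - (P d b - P d a) + ii * ((V b d - V b c) - (V a d - V a c)).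

Let good (q : R * R * R * R) := let: (a, b, c, d) := q in
  [/\ a0 <= a, a <= b, b <= b0, c0 <= c & (c <= d) && (d <= d0)].

Let size (q : R * R * R * R) : R := let: (a, b, c, d) := q in (b - a) + (d - c).

(** Bisection keeps a quarter that carries at least a quarter of |J|; if the first three fail, the
    triangle inequality leaves the fourth. *)
Let step (q : R * R * R * R) := let: (a, b, c, d) := q in
  let m := (a + b) / 2 in let n := (c + d) / 2 in
  if cabs (J q) / 4 <= cabs (J (a, m, c, n)) then (a, m, c, n) else
  if cabs (J q) / 4 <= cabs (J (m, b, c, n)) then (m, b, c, n) else
  if cabs (J q) / 4 <= cabs (J (a, m, n, d)) then (a, m, n, d) else (m, b, n, d).

Let sub (q' q : R * R * R * R) := let: (a, b, c, d) := q in let: (a', b', c', d') := q' in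
  [/\ a <= a', b' <= b, c <= c' & d' <= d].

Let stepP q : good q -> [/\ good (step q), cabs (J q) / 4 <= cabs (J (step q)),
  size (step q) = size q / 2 & sub (step q) q].
Proof.
case: q => [[[a b] c] d] [h1 h2 h3 h4 /andP[h5 h6]]; rewrite /step.
set m := (a + b) / 2; set n := (c + d) / 2.
have mE : m = (a + b) / 2 by []; have nE : n = (c + d) / 2 by [].
have JE : J (a, b, c, d) = J (a, m, c, n) + J (m, b, c, n) + J (a, m, n, d) + J (m, b, n, d).
  by rewrite /J; ring.
case: ifPn => [k|k1]; first by rewrite /good /size /sub k; split=> //; try split; lra.
case: ifPn => [k|k2]; first by rewrite /good /size /sub k; split=> //; try split; lra.
case: ifPn => [k|k3]; first by rewrite /good /size /sub k; split=> //; try split; lra.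
have k : cabs (J (a, b, c, d)) / 4 <= cabs (J (m, b, n, d)).
  have := cabsD (J (a, m, c, n) + J (m, b, c, n) + J (a, m, n, d)) (J (m, b, n, d)).
  have := cabsD (J (a, m, c, n) + J (m, b, c, n)) (J (a, m, n, d)).
  have := cabsD (J (a, m, c, n)) (J (m, b, c, n)).
  by move: k1 k2 k3; rewrite -!ltNge -JE; lra.
by rewrite /good /size /sub k; split=> //; try split; lra.
Qed.

Let J_small q l (u0 v0 e : R) : good q -> let: (a, b, c, d) := q in
  a <= u0 <= b -> c <= v0 <= d ->
  (forall u v, a <= u <= b -> c <= v <= d ->
    cabs (H (u +i* v) - H (u0 +i* v0) - l * (u +i* v - u0 +i* v0)) <= e) ->
  cabs (J q) <= e * (2 * size q).
Proof.
case: q => [[[a b] c] d] [h1 h2 h3 h4 /andP[h5 h6]] u0ab v0cd bd.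
pose w0 := u0 +i* v0.
pose Q w := (H w0 - l * w0) * w + l / 2%:R * (w * w).
have dQ w : cderiv Q w (H w0 + l * (w - w0)).
  have := cderivD (cderivM (cderiv_cst (H w0 - l * w0) w) (cderiv_id w))
    (cderivM (cderiv_cst (l / 2%:R) w) (cderivM (cderiv_id w) (cderiv_id w))).
  by apply: cderiv_eq; rewrite /=; field.
have subline (F : R -> R[i]) (x k : R[i]) t f : rderiv F t f ->
    rderiv (fun s => F s - Q (x + k * s%:C)) t (f - k * (H w0 + l * (x + k * t%:C - w0))).
  move=> /rderivP[f1 f2].
  have /rderivP[g1 g2] := rderiv_comp (rderiv_line x k t) (dQ (x + k * t%:C)).
  apply/rderivP; split.
    rewrite (_ : (fun x0 : R => _) = (fun s => Re (F s) - Re (Q (x + k * s%:C)))); last first.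
      by apply/funext => s; rewrite ReD ReN.
    by rewrite ReD ReN [k * _]mulrC; exact: is_deriveB.
  rewrite (_ : (fun x0 : R => _) = (fun s => Im (F s) - Im (Q (x + k * s%:C)))); last first.
    by apply/funext => s; rewrite ImD ImN.
  by rewrite ImD ImN [k * _]mulrC; exact: is_deriveB.
have hor v : c <= v <= d -> cabs ((P v b - Q (b +i* v)) - (P v a - Q (a +i* v))) <= e * (b - a).
  move=> vcd.
  have E s : s +i* v = ii * v%:C + 1 * s%:C :> R[i].
    by apply: complex_eq; rewrite !(ReD, ImD, ReM, ImM) /=; ring.
  rewrite !E; apply: (@mvt_const _ (fun s => P v s - Q (ii * v%:C + 1 * s%:C))
    (fun s => H (s +i* v) - 1 * (H w0 + l * (ii * v%:C + 1 * s%:C - w0)))) => //.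
    by move=> t /andP[ta tb]; apply: subline; apply: P_prim; lra.
  move=> t /andP[ta tb]; rewrite -E mul1r opprD addrA; apply: bd; lra.
have ver u : a <= u <= b ->
    cabs ((ii * V u d - Q (u +i* d)) - (ii * V u c - Q (u +i* c))) <= e * (d - c).
  move=> uab.
  have E s : u +i* s = u%:C + ii * s%:C :> R[i].
    by apply: complex_eq; rewrite !(ReD, ImD, ReM, ImM) /=; ring.
  rewrite !E; apply: (@mvt_const _ (fun s => ii * V u s - Q (u%:C + ii * s%:C))
    (fun s => ii * H (u +i* s) - ii * (H w0 + l * (u%:C + ii * s%:C - w0)))) => //.
    move=> t /andP[tc td]; apply: subline.
    have := cderivM (cderiv_cst ii (V u t)) (cderiv_id (V u t)).
    rewrite mul0r add0r mulr1 => /(rderiv_comp (V_prim _ _))/=; apply; lra.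
  move=> t /andP[ta tb]; rewrite -E -mulrBr cabsM (_ : cabs ii = 1); last first.
    by rewrite /cabs /= expr0n expr1n add0r sqrtr1.
  by rewrite mul1r opprD addrA; apply: bd; lra.
have -> : J (a, b, c, d) = ((P c b - Q (b +i* c)) - (P c a - Q (a +i* c)))
   - ((P d b - Q (b +i* d)) - (P d a - Q (a +i* d)))
   + ((ii * V b d - Q (b +i* d)) - (ii * V b c - Q (b +i* c)))
   - ((ii * V a d - Q (a +i* d)) - (ii * V a c - Q (a +i* c))).
  by rewrite /J; ring.
have cc : c <= c <= d by rewrite lexx. have dd : c <= d <= d by rewrite lexx andbT.
have aa : a <= a <= b by rewrite lexx. have bb : a <= b <= b by rewrite lexx andbT.
have := hor _ cc; have := hor _ dd; have := ver _ aa; have := ver _ bb.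
set x1 := (_ - _ in X in X -> _); set x2 := (_ - _ in X in _ -> X -> _).
set x3 := (_ - _ in X in _ -> _ -> X -> _); set x4 := (_ - _ in X in _ -> _ -> _ -> X -> _).
have := cabsB (x4 - x3 + x1) x2; have := cabsD (x4 - x3) x1; have := cabsB x4 x3.
rewrite /size; lra.
Qed.

Lemma goursat : a0 <= b0 -> c0 <= d0 ->
  (P c0 b0 - P c0 a0) - (P d0 b0 - P d0 a0) + ii * ((V b0 d0 - V b0 c0) - (V a0 d0 - V a0 c0)) = 0.
Proof.
move=> ab cd; pose q0 := (a0, b0, c0, d0); pose q n := iter n step q0.
have gq n : good (q n).
  elim: n => [|n /stepP[]//]; by rewrite /= !lexx ab cd.
have Jq n : cabs (J q0) / 4 ^+ n <= cabs (J (q n)).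
  elim: n => [|n IHn]; first by rewrite expr0 divr1.
  have [_ h _ _] := stepP (gq n); apply: le_trans h.
  by rewrite exprS invfM mulrA mulrAC ler_pM2r ?invr_gt0.
have sq n : size (q n) = size q0 / 2 ^+ n.
  elim: n => [|n IHn]; first by rewrite expr0 divr1.
  have [_ _ h _] := stepP (gq n); rewrite [q n.+1]/(step (q n)) h IHn.
  by rewrite exprS invfM mulrA mulrAC.
have subq m n : sub (q (n + m)%N) (q n).
  elim: m => [|m IHm].
    by rewrite addn0; case: (q n) => [[[a b] c] d]; split.
  have [_ _ _] := stepP (gq (n + m)%N); rewrite addnS [q (n + m).+1]/(step (q (n + m)%N)).
  have tr x y z : sub y x -> sub z y -> sub z x.
    move: x y z => [[[? ?] ?] ?] [[[? ?] ?] ?] [[[? ?] ?] ?] [? ? ? ?] [? ? ? ?].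
    by split; lra.
  exact: tr.
pose A n := (q n).1.1.1; pose B n := (q n).1.1.2; pose C n := (q n).1.2; pose D n := (q n).2.
have qE n : q n = (A n, B n, C n, D n) by rewrite /A /B /C /D; case: (q n) => [[[]]].
have AB m n : A m <= B n /\ C m <= D n.
  have := subq (maxn m n - m)%N m; have := subq (maxn m n - n)%N n.
  rewrite !subnKC ?leq_maxl ?leq_maxr //; have := gq (maxn m n).
  by rewrite !qE => -[? ? ? ? /andP[? ?]] [? ? ? ?] [? ? ? ?]; split; lra.
have lim (X Y : nat -> R) : (forall m n, X m <= Y n) -> exists x, forall n, X n <= x <= Y n.
  move=> XY; exists (sup (range X)) => n; apply/andP; split.
    by apply: ub_le_sup; [exists (Y 0%N) => _ [m _ <-]|exists n].
  by apply: ge_sup; [exists (X 0%N); exists 0%N|move=> _ [m _ <-]].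
have [u0 hu] := lim A B (fun m n => (AB m n).1).
have [v0 hv] := lim C D (fun m n => (AB m n).2).
have u0ab : a0 <= u0 <= b0 by exact: (hu 0%N).
have v0cd : c0 <= v0 <= d0 by exact: (hv 0%N).
have [l hl] := H_diff u0ab v0cd.
apply/eqP; rewrite -cabs_eq0 -[X in cabs X]/(J q0); apply: contraT => J0.
have Jp : 0 < cabs (J q0) by rewrite lt_def J0 cabs_ge0.
have s0 : 0 <= size q0 by rewrite /size /q0; lra.
(* After n bisections |J q0| / 4^n <= 2 e size(q0)^2 / 4^n; this [e] makes 2 e size(q0)^2 smaller
   than |J q0|. *)
pose e := cabs (J q0) / (2 * size q0 ^+ 2 + 1).
have S0 : 0 < 2 * size q0 ^+ 2 + 1 by have := sqr_ge0 (size q0); lra.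
have e0 : 0 < e by rewrite divr_gt0.
have [del del0 hdel] := hl _ e0.
have [n hn] : exists n, size q0 / 2 ^+ n < del.
  exists (Num.bound (size q0 / del)).
  have := archi_boundP (divr_ge0 s0 (ltW del0)); set n := Num.bound _ => hn.
  rewrite ltr_pdivrMr ?exprn_gt0 // mulrC -ltr_pdivrMr // (lt_trans hn) //.
  by rewrite -natrX ltr_nat ltn_expl.
have := @J_small (q n) l u0 v0 (e * size (q n)) (gq n).
have gqn := gq n; have szn := sq n; move: gqn szn; rewrite (qE n) => gqn szn.
move=> /(_ (hu n) (hv n)).
have dist u v : A n <= u <= B n -> C n <= v <= D n ->
    cabs (u +i* v - u0 +i* v0) <= size (A n, B n, C n, D n).
  move=> uu vv; rewrite (le_trans (cabs_le_ReIm _)) // !(ReD, ImD, ReN, ImN) /=.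
  have := hu n; have := hv n => hv' hu'.
  by apply: lerD; rewrite ler_norml; lra.
have hh u v : A n <= u <= B n -> C n <= v <= D n ->
    cabs (H (u +i* v) - H (u0 +i* v0) - l * (u +i* v - u0 +i* v0)) <=
    e * size (A n, B n, C n, D n).
  move=> uu vv; have dd := dist _ _ uu vv.
  have := hdel (u +i* v - u0 +i* v0); rewrite [u0 +i* v0 + _]addrC subrK.
  rewrite (le_lt_trans dd) ?szn // => /(_ isT)/le_trans; apply.
  by rewrite ler_wpM2l ?(ltW e0) // -szn.
move=> /(_ hh) Jsm; have := Jq n; rewrite (qE n) => /le_trans/(_ Jsm).
rewrite szn ler_pdivrMr ?exprn_gt0 //.
have -> : e * (size q0 / 2 ^+ n) * (2 * (size q0 / 2 ^+ n)) * 4 ^+ n = e * (2 * size q0 ^+ 2).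
  rewrite (_ : 4 = 2 ^+ 2) -?exprM; last by ring.
  have k : 2 ^+ n != 0 :> R by rewrite expf_neq0.
  by rewrite mulnC exprM; field.
rewrite /e mulrAC ler_pdivlMr // mulrDr mulr1; lra.
Qed.

End Goursat.

(** * Circle means and Jensen's inequality *)

Section CircleMeans.
Variable R : realType.
Implicit Types (K f g : R[i] -> R[i]) (c z : R[i]).
Local Notation tau := (@pi R *+ 2).

Definition circ c (r phi : R) : R[i] := c + r%:C * cexp (0 +i* phi).

Lemma tau_gt0 : 0 < tau.
Proof. by rewrite pmulrn_lgt0 // pi_gt0. Qed.

Lemma circE c (r phi : R) : 0 < r -> circ c r phi = c + cexp (ln r +i* phi).
Proof.
move=> r0; rewrite (_ : ln r +i* phi = (ln r)%:C + (0 +i* phi)); last first.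
  by apply: complex_eq; rewrite !(ReD, ImD) /= ?addr0 ?add0r.
by rewrite cexpD cexp_real lnK // posrE.
Qed.

Lemma cabs_circ c (r phi : R) : 0 < r -> cabs (circ c r phi - c) = r.
Proof.
by move=> r0; rewrite circE // addrC addKr cabs_cexp /= lnK // posrE.
Qed.

Lemma cdiff_line_cont (H : R[i] -> R[i]) (x k : R[i]) (t : R) : cdiff H (x + k * t%:C) ->
  forall e : R, 0 < e -> exists2 d : R, 0 < d &
    forall s, `|s - t| < d -> cabs (H (x + k * s%:C) - H (x + k * t%:C)) < e.
Proof.
move=> /cdiff_cont hc e /hc[d d0 h].
have k1 : 0 < cabs k + 1 by rewrite ltr_wpDl ?cabs_ge0.
exists (d / (cabs k + 1)); first by rewrite divr_gt0.
move=> s; rewrite ltr_pdivlMr // => st; apply: h.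
rewrite (_ : _ - _ = k * (s - t)%:C); last by rewrite rmorphB /=; ring.
by rewrite cabsM cabs_real mulrC (le_lt_trans _ st) // ler_wpM2l // lerDl.
Qed.

Lemma circ_prim_ex K c r : 0 < r -> (forall z, cabs (z - c) = r -> cdiff K z) ->
  exists G : R -> R[i], forall phi, 0 <= phi <= tau -> rderiv G phi (K (circ c r phi)).
Proof.
move=> r0 hK.
apply: (@cprimitive_ex R (fun phi => K (circ c r phi)) 0 tau (ltW tau_gt0)) => t _ e e0.
have dH : cdiff (fun w => K (c + cexp w)) ((ln r)%:C + (0 +i* 1) * t%:C).
  apply: cdiff_comp; first by apply: cdiffD; [exact: cdiff_cst|exact: cdiff_cexp].
  by apply: hK; rewrite addrC addKr cabs_cexp ReD ReM /= mul0r mulr0 subrr addr0 lnK // posrE.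
have [d d0 h] := cdiff_line_cont dH e0; exists d => // s _ /h.
have E u : ln r +i* u = (ln r)%:C + (0 +i* 1) * u%:C.
  by apply: complex_eq; rewrite !(ReD, ImD, ReM, ImM) /=; ring.
by rewrite -!E -!circE.
Qed.

(* The logarithmic coordinate [z = c + exp w] unrolls the annulus into a
   rectangle whose horizontal sides cancel by periodicity. *)
Lemma circle_mean K c r (L : R[i]) (G : R -> R[i]) : 0 < r ->
  (forall z, 0 < cabs (z - c) <= r -> cdiff K z) ->
  (forall e : R, 0 < e -> exists2 d : R, 0 < d &
     forall z, 0 < cabs (z - c) < d -> cabs (K z - L) <= e) ->
  (forall phi, 0 <= phi <= tau -> rderiv G phi (K (circ c r phi))) ->
  G tau - G 0 = tau%:C * L.
Proof.
move=> r0 hK hL hG; have t0 := tau_gt0.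
suff H e : 0 < e -> cabs (G tau - G 0 - tau%:C * L) <= e * tau.
  apply/eqP; rewrite -subr_eq0 -cabs_eq0 eq_le cabs_ge0 andbT.
  apply/ler_addgt0Pr => e e0; rewrite add0r.
  by have := H _ (divr_gt0 e0 t0); rewrite divfK // gt_eqF.
move=> /hL[d d0 hd].
(* On the inner circle of radius [r1] the values of [K] are within e of [L]. *)
pose r1 := Num.min r (d / 2).
have r10 : 0 < r1 by rewrite lt_min r0 divr_gt0.
have r1r : r1 <= r by rewrite ge_min lexx.
have r1d : r1 < d by rewrite gt_min; apply/orP; right; lra.
pose a := ln r1; pose b := ln r.
have ab : a <= b by rewrite ler_ln ?posrE.
pose H w := K (c + cexp w).
have dH u v : u <= b -> cdiff H (u +i* v).
  move=> ub; apply: cdiff_comp; first by apply: cdiffD; [exact: cdiff_cst|exact: cdiff_cexp].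
  apply: hK; rewrite addrC addKr cabs_cexp /= expR_gt0 /=.
  by rewrite -(lnK (_ : r \in Num.pos)) ?posrE // ler_expR.
have [P hP] : exists P : R -> R -> R[i], forall v, forall u, a <= u <= b ->
    rderiv (P v) u (H (u +i* v)).
  suff /choice[P hP] : forall v, exists Pv : R -> R[i], forall u, a <= u <= b ->
      rderiv Pv u (H (u +i* v)) by exists P.
  move=> v; apply: cprimitive_ex => // t /andP[_ tb] e' e'0.
  have E u : u +i* v = (0 +i* v) + 1 * u%:C :> R[i].
    by apply: complex_eq; rewrite !(ReD, ImD, ReM, ImM) /=; ring.
  have := dH t v tb; rewrite E => /cdiff_line_cont/(_ _ e'0)[dd dd0 h].
  by exists dd => // x _ /h; rewrite -!E.
have [V hV] : exists V : R -> R -> R[i], forall u, a <= u <= b -> forall v, 0 <= v <= tau ->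
    rderiv (V u) v (H (u +i* v)).
  have : forall u, exists Vu : R -> R[i], a <= u <= b -> forall v, 0 <= v <= tau ->
    rderiv Vu v (H (u +i* v)).
    move=> u; case: (boolP (a <= u <= b)) => [/andP[_ ub]|_]; last by exists (fun=> 0).
    have [|Vu hVu] := @cprimitive_ex R (fun v => H (u +i* v)) 0 tau (ltW t0); last by exists Vu.
    move=> t _ e' e'0.
    have E v : u +i* v = u%:C + (0 +i* 1) * v%:C :> R[i].
      by apply: complex_eq; rewrite !(ReD, ImD, ReM, ImM) /=; ring.
    have := dH u t ub; rewrite E => /cdiff_line_cont/(_ _ e'0)[dd dd0 h].
    by exists dd => // x _ /h; rewrite -!E.
  by move=> /choice[V hV]; exists V.
have := @goursat R H P V a b 0 tau (fun u v uab _ => dH u v (proj2 (andP uab)))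
  (fun u v uab _ => hP v u uab) (fun u v uab => hV u uab v) ab (ltW t0).
have per u : H (u +i* tau) = H (u +i* 0).
  rewrite /H (_ : u +i* tau = u +i* 0 + 0 +i* tau) ?cexp2pi //.
  by apply: complex_eq; rewrite !(ReD, ImD) /= ?addr0 ?add0r.
have uniqp (F1 F2 : R -> R[i]) h x y : x <= y -> (forall t, x <= t <= y -> rderiv F1 t (h t)) ->
    (forall t, x <= t <= y -> rderiv F2 t (h t)) -> F1 y - F1 x = F2 y - F2 x.
  move=> xy h1 h2; apply/eqP; rewrite -subr_eq0 -cabs_eq0 eq_le cabs_ge0 andbT.
  rewrite (_ : _ - _ = (F1 y - F2 y) - (F1 x - F2 x)); last by ring.
  rewrite -[leRHS](mul0r (y - x)).
  apply: (@mvt_const R (fun t => F1 t - F2 t) (fun=> 0)) => //; last by move=> *; rewrite cabs0.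
  move=> t txy; have /rderivP[p1 p2] := h1 t txy; have /rderivP[q1 q2] := h2 t txy.
  apply/rderivP; split.
    have := is_deriveB p1 q1; rewrite subrr; congr (is_derive _ _ _ _).
    by apply/funext => s; rewrite ReD ReN.
  have := is_deriveB p2 q2; rewrite subrr; congr (is_derive _ _ _ _).
  by apply/funext => s; rewrite ImD ImN.
rewrite (uniqp (P tau) (P 0) (fun u => H (u +i* 0)) a b) //; last 2 first.
- by move=> t tab; rewrite -per; exact: hP.
- by move=> t /hP; exact.
have aab : a <= a <= b by rewrite lexx. have bab : a <= b <= b by rewrite lexx andbT.
(* Goursat's identity now says that the angular integrals over the circles of radii [r] and [r1]
   agree. *)
rewrite subrr add0r => /eqP; rewrite mulf_eq0 eq_complex /= oner_eq0 andbF /= subr_eq0 => /eqP VE.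
have -> : G tau - G 0 = V a tau - V a 0.
  rewrite -VE; apply: (uniqp _ _ (fun phi => K (circ c r phi))) => //; first exact: ltW.
  by move=> t /(hV b bab); rewrite /H -circE.
rewrite (_ : _ - _ = (V a tau - tau%:C * L) - (V a 0 - 0%:C * L)); last first.
  by rewrite mul0r; ring.
rewrite -[X in e * X]subr0.
apply: (@mvt_const R (fun t => V a t - t%:C * L) (fun t => H (a +i* t) - L)); first exact: ltW.
  move=> t /(hV a aab)/rderivP[p1 p2].
  have /rderivP[q1 q2] := rderiv_line 0 L t.
  apply/rderivP; split.
    have := is_deriveB p1 q1; rewrite ReD ReN; congr (is_derive _ _ _ _).
    by apply/funext => s; rewrite [RHS]ReD ReN [_ * L]mulrC -(add0r (L * _)).
  have := is_deriveB p2 q2; rewrite ImD ImN; congr (is_derive _ _ _ _).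
  by apply/funext => s; rewrite [RHS]ImD ImN [_ * L]mulrC -(add0r (L * _)).
move=> t _; apply: hd; rewrite -circE // cabs_circ // r10 r1d //.
Qed.

Lemma circle_mean_le K c r (L : R[i]) (psi B : R -> R) : 0 < r ->
  (forall z, 0 < cabs (z - c) <= r -> cdiff K z) ->
  (forall e : R, 0 < e -> exists2 d : R, 0 < d &
     forall z, 0 < cabs (z - c) < d -> cabs (K z - L) <= e) ->
  (forall phi, 0 <= phi <= tau -> is_derive phi 1 psi (B phi)) ->
  (forall phi, 0 <= phi <= tau -> cabs (K (circ c r phi)) <= B phi) ->
  cabs L * tau <= psi tau - psi 0.
Proof.
move=> r0 hK hL hpsi hB.
have [|G hG] := @circ_prim_ex K c r r0.
  by move=> z zr; apply: hK; rewrite zr r0 lexx.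
have := circle_mean r0 hK hL hG => GE.
have t0 := tau_gt0.
have <- : cabs (G tau - G 0) = cabs L * tau by rewrite GE cabsM cabs_real gtr0_norm // mulrC.
apply: (mvt_ineq (ltW t0) hG hpsi) => t /andP[t1 t2]; apply: hB.
by rewrite !ltW.
Qed.

Lemma circle_mean_bound K c r (L : R[i]) (M : R) : 0 < r ->
  (forall z, 0 < cabs (z - c) <= r -> cdiff K z) ->
  (forall e : R, 0 < e -> exists2 d : R, 0 < d &
     forall z, 0 < cabs (z - c) < d -> cabs (K z - L) <= e) ->
  (forall z, cabs (z - c) = r -> cabs (K z) <= M) -> cabs L <= M.
Proof.
move=> r0 hK hL hM; have t0 := tau_gt0; rewrite -(ler_pM2r t0).
rewrite [leRHS](_ : _ = M * tau - M * 0); last by rewrite mulr0 subr0.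
apply: (@circle_mean_le K c r L (fun t => M * t) (fun=> M)) => //; last first.
  by move=> t _; apply: hM; rewrite cabs_circ.
move=> t _; apply/is_deriveP => e e0; exists 1 => // h _.
by rewrite (_ : _ - _ = 0) ?normr0 ?mulr_ge0 ?(ltW e0) //; ring.
Qed.

(** The circle mean of (f z - f c) / (z - c), whose limit at c is the derivative: this is why circle
    means allow a puncture at the centre. The 2 comes from |f z - f c| <= 2 M. *)
Lemma cauchy_estimate f c r (l : R[i]) (M : R) : 0 < r ->
  (forall z, cabs (z - c) <= r -> cdiff f z) ->
  (forall z, cabs (z - c) <= r -> cabs (f z) <= M) ->
  cderiv f c l -> cabs l <= 2 * M / r.
Proof.
move=> r0 hf hM hl.
apply: (@circle_mean_bound (fun z => (f z - f c) / (z - c)) c r) => //.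
- move=> z /andP[z0 zr]; apply: cdiffM.
    by apply: cdiffB; [exact: hf|exact: cdiff_cst].
  apply: cdiffV; first by rewrite -cabs_gt0.
  by apply: cdiffB; [exact: cdiff_id|exact: cdiff_cst].
- move=> e /hl[d d0 h]; exists d => // z /andP[z0 zd].
  rewrite -(ler_pM2r z0) -cabsM mulrBl divfK -?cabs_gt0 //.
  by have := h _ zd; rewrite [c + _]addrC subrK.
- move=> z zr; rewrite cabsM cabsV zr ler_pM2r ?invr_gt0 //.
  rewrite (le_trans (cabsB _ _)) // mulrDl mul1r lerD // hM ?zr //.
  by rewrite subrr cabs0 ltW.
Qed.

Lemma real_between (X Y : nat -> R) : (forall m n, X m <= Y n) ->
  exists x, forall n, X n <= x <= Y n.
Proof.
move=> XY; exists (sup (range X)) => n; apply/andP; split.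
  by apply: ub_le_sup; [exists (Y 0%N) => _ [m _ <-]|exists n].
by apply: ge_sup; [exists (X 0%N); exists 0%N|move=> _ [m _ <-]].
Qed.

(** Completeness with an explicit rate: the intervals of radius eta_n about Re l_n meet pairwise, so
    they share a point, and likewise for Im. Adding the two coordinates costs the 2. *)
Lemma complex_cauchy_lim (l : nat -> R[i]) (eta : nat -> R) :
  (forall m n, cabs (l m - l n) <= eta m + eta n) ->
  exists L, forall n, cabs (l n - L) <= 2 * eta n.
Proof.
move=> h.
have [x hx] : exists x, forall n, Re (l n) - eta n <= x <= Re (l n) + eta n.
  apply: real_between => m n; have := le_trans (Re_le_cabs _) (h m n).
  by rewrite ReD ReN ler_norml => /andP[]; lra.
have [y hy] : exists y, forall n, Im (l n) - eta n <= y <= Im (l n) + eta n.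
  apply: real_between => m n; have := le_trans (Im_le_cabs _) (h m n).
  by rewrite ImD ImN ler_norml => /andP[]; lra.
exists (x +i* y) => n; rewrite (le_trans (cabs_le_ReIm _)) // ReD ImD ReN ImN /=.
have := hx n; have := hy n => hy' hx'; rewrite mulrDl mul1r lerD // ler_norml; lra.
Qed.

(** By Cauchy's estimate on half-radius discs the derivatives are uniformly Cauchy. The mean value
    inequality bounds the increments of F m - F n, and letting m vary bounds those of f - F n. *)
Lemma weierstrass (F : nat -> R[i] -> R[i]) f c r (eps : nat -> R) : 0 < r ->
  (forall n z, cabs (z - c) <= r -> cdiff (F n) z) ->
  (forall n z, cabs (z - c) <= r -> cabs (F n z - f z) <= eps n) ->
  (forall e : R, 0 < e -> exists n, eps n <= e) -> cdiff f c.
Proof.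
move=> r0 dF hF heps.
have eps0 n : 0 <= eps n.
  by apply: le_trans (hF n c _); rewrite ?cabs_ge0 // subrr cabs0 ltW.
have hFF m n z : cabs (z - c) <= r -> cabs (F m z - F n z) <= eps m + eps n.
  move=> zr; apply: le_trans (cabs_tri _ (f z) _) _.
  by rewrite lerD ?hF // cabs_distC hF.
have [dd hdd] : exists dd : nat -> R[i] -> R[i], forall n z, cabs (z - c) <= r ->
    cderiv (F n) z (dd n z).
  have : forall n, exists g : R[i] -> R[i], forall z, cabs (z - c) <= r -> cderiv (F n) z (g z).
    move=> n; suff /choice[g hg] : forall z, exists l, cabs (z - c) <= r -> cderiv (F n) z l.
      by exists g.
    move=> z; case: (boolP (cabs (z - c) <= r)) => [/(dF n)[l hl]|_].
      by exists l.
    by exists 0.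
  by move=> /choice[dd hdd]; exists dd.
have ddE m n z : cabs (z - c) <= r / 2 -> cabs (dd m z - dd n z) <= 4 / r * eps m + 4 / r * eps n.
  move=> zr2.
  have zr w : cabs (w - z) <= r / 2 -> cabs (w - c) <= r.
    by move=> wz; apply: le_trans (cabs_tri _ z _) _; lra.
  rewrite [leRHS](_ : _ = 2 * (eps m + eps n) / (r / 2)); last by field; rewrite gt_eqF.
  apply: (@cauchy_estimate (fun w => F m w - F n w) z) => //; first by rewrite divr_gt0.
  - by move=> w /zr wr; apply: cdiffB; apply: dF.
  - by move=> w /zr wr; apply: hFF.
  - have zc : cabs (z - c) <= r by apply: zr; rewrite subrr cabs0 divr_ge0 // ltW.
    exact: cderivB (hdd m z zc) (hdd n z zc).
have r40 : 0 <= 4 / r by rewrite divr_ge0 // ltW.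
have cr : cabs (c - c) <= r / 2 by rewrite subrr cabs0 divr_ge0 // ltW.
have [L hL] := complex_cauchy_lim (fun m n => ddE m n c cr).
have seg m n h : cabs h <= r / 2 ->
    cabs ((F m (c + h) - F n (c + h)) - (F m c - F n c)) <=
    (4 / r * eps m + 4 / r * eps n) * cabs h.
  move=> hr.
  have := @mvt_const R (fun t => F m (c + h * t%:C) - F n (c + h * t%:C))
    (fun t => (dd m (c + h * t%:C) - dd n (c + h * t%:C)) * h)
    ((4 / r * eps m + 4 / r * eps n) * cabs h) 0 1 ler01.
  rewrite mulr0 mulr1 addr0 subr0 mulr1; apply.
    move=> t /andP[t0 t1].
    have tr : cabs (c + h * t%:C - c) <= r.
      rewrite addrC addKr cabsM cabs_real ger0_norm //.
      apply: le_trans (_ : cabs h * 1 <= _); first by rewrite ler_wpM2l ?cabs_ge0.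
      lra.
    exact: (rderiv_comp (rderiv_line c h t) (cderivB (hdd m _ tr) (hdd n _ tr))).
  move=> t /andP[t0 t1]; rewrite cabsM ler_wpM2r ?cabs_ge0 // ddE //.
  rewrite addrC addKr cabsM cabs_real gtr0_norm // (le_trans _ hr) //.
  by rewrite ler_piMr ?cabs_ge0 // ltW.
have segf n h : cabs h <= r / 2 ->
    cabs ((f (c + h) - F n (c + h)) - (f c - F n c)) <= 4 / r * eps n * cabs h.
  move=> hr; apply/ler_addgt0Pr => e e0.
  have k0 : 0 < 2 + 4 / r * cabs h by rewrite ltr_wpDr // mulr_ge0 ?cabs_ge0.
  have [m hm] := heps _ (divr_gt0 e0 k0).
  rewrite (_ : _ - _ = ((F m (c + h) - F n (c + h)) - (F m c - F n c))
      - (F m (c + h) - f (c + h)) + (F m c - f c)); last by ring.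
  have h1 := seg m n h hr.
  have chr : cabs (c + h - c) <= r by rewrite addrC addKr; lra.
  have h2 := hF m _ chr; have h3 := hF m c (_ : _ <= r); rewrite subrr cabs0 (ltW r0) in h3.
  have {}h3 := h3 isT.
  have := cabsD (F m (c + h) - F n (c + h) - (F m c - F n c) - (F m (c + h) - f (c + h))) (F m c - f c).
  have := cabsB (F m (c + h) - F n (c + h) - (F m c - F n c)) (F m (c + h) - f (c + h)).
  move: hm; rewrite ler_pdivlMr // mulrDr mulrDl in h1 *; lra.
exists L => e e0.
(* 12 = 4 + 8: a factor 4 / r from the increments of f - F n, and 8 / r from |dd n c - L|. *)
have e1 : 0 < e / 2 / (12 / r) by rewrite !divr_gt0.
have [n hn] := heps _ e1; have e2 : 0 < e / 2 by rewrite divr_gt0.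
have cr1 : cabs (c - c) <= r by rewrite subrr cabs0 ltW.
have [d d0 hd] := hdd n c cr1 _ e2.
exists (Num.min d (r / 2)); first by rewrite lt_min d0 divr_gt0.
move=> h; rewrite lt_min => /andP[hd1 /ltW hr].
rewrite (_ : _ - _ = (F n (c + h) - F n c - dd n c * h) +
  ((f (c + h) - F n (c + h)) - (f c - F n c)) + (dd n c - L) * h); last by ring.
have h1 := hd _ hd1; have h2 := segf n h hr.
have h3 : cabs ((dd n c - L) * h) <= 2 * (4 / r * eps n) * cabs h.
  by rewrite cabsM ler_wpM2r ?cabs_ge0.
have h4 : 12 / r * eps n * cabs h <= e / 2 * cabs h.
  rewrite ler_wpM2r ?cabs_ge0 // mulrC -ler_pdivlMr // divr_gt0 //.
have := cabsD (F n (c + h) - F n c - dd n c * h + ((f (c + h) - F n (c + h)) - (f c - F n c)))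
   ((dd n c - L) * h).
have := cabsD (F n (c + h) - F n c - dd n c * h) ((f (c + h) - F n (c + h)) - (f c - F n c)).
have : 12 / r * eps n * cabs h = 4 / r * eps n * cabs h + 2 * (4 / r * eps n) * cabs h.
  by field; rewrite gt_eqF.
lra.
Qed.

(* Each zero is divided out and replaced by the reflected factor
   (r^2 - conj(rho - c)(z - c)) / r, which has the modulus of z - rho on the
   circle of radius r. *)
Lemma jensen f c (r r' : R) (s : seq R[i]) (m : R[i] -> nat) (psi B : R -> R) :
  0 < r' -> r' < r ->
  (forall z, cabs (z - c) <= r -> cdiff f z) -> uniq s ->
  (forall rho, rho \in s -> cabs (rho - c) <= r' /\
     exists2 g, cdiff g rho & cnear rho (fun z => f z = (z - rho) ^+ m rho * g z)) ->
  (forall phi, 0 <= phi <= tau -> is_derive phi 1 psi (B phi)) ->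
  (forall phi, 0 <= phi <= tau -> cabs (f (circ c r phi)) <= B phi) ->
  cabs (f c) * (r / r') ^+ (\sum_(rho <- s) m rho)%N * tau <= psi tau - psi 0.
Proof.
move=> r'0 r'r hf us hz hpsi hB.
have r0 : 0 < r := lt_trans r'0 r'r.
elim: s f hf us hz hB => [|rho s IHs] f hf.
  move=> _ _ hB; rewrite big_nil expr0 mulr1; apply: (@circle_mean_le f c r) => //.
    by move=> z /andP[_ zr]; exact: hf.
  have hc : cdiff f c by apply: hf; rewrite subrr cabs0 ltW.
  by move=> e /(cdiff_cont hc)[d d0 h]; exists d => // z /andP[_ /h/ltW].
move=> /= /andP[rhos us] hz hB.
have [rr [g dg hg]] := hz rho (mem_head _ _).
have psi0 : 0 <= psi tau - psi 0.
  apply: le_trans (circle_mean_le (L := 0) (K := fun=> 0) (c := c) r0 _ _ hpsi _).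
  - by rewrite mulr_ge0 ?cabs_ge0 // ltW // tau_gt0.
  - by move=> z _; exact: cdiff_cst.
  - by move=> e e0; exists 1 => // z _; rewrite subrr cabs0 ltW.
  - by move=> t /hB; rewrite cabs0; exact: le_trans (cabs_ge0 _).
pose k := m rho.
pose bl z := ((r ^+ 2)%:C - conjc (rho - c) * (z - c)) / r%:C.
(* The value [g rho] fills the removable singularity, so the quotient stays differentiable on the
   whole disc. *)
pose f1 z := (if z == rho then g rho else f z / (z - rho) ^+ k) * bl z ^+ k.
have dbl z : cdiff (fun w => bl w ^+ k) z.
  apply: cdiffX; apply: cdiffM; last exact: cdiff_cst.
  apply: cdiffB; first exact: cdiff_cst.
  apply: cdiffM; first exact: cdiff_cst.
  by apply: cdiffB; [exact: cdiff_id|exact: cdiff_cst].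
have dq z : z != rho -> cdiff (fun w => ((w - rho) ^+ k)^-1) z.
  move=> zr; apply: cdiffV; first by rewrite expf_neq0 // subr_eq0.
  by apply: cdiffX; apply: cdiffB; [exact: cdiff_id|exact: cdiff_cst].
have df1 z : cabs (z - c) <= r -> cdiff f1 z.
  move=> zr; apply: cdiffM; last exact: dbl.
  have [->|zrho] := eqVneq z rho.
    apply: cdiff_ext dg; apply: cnearS hg => w hw.
    case: eqP => [->//|/eqP wr]; rewrite hw mulrC mulKf //.
    by rewrite expf_neq0 // subr_eq0.
  apply: (@cdiff_ext _ (fun w => f w * ((w - rho) ^+ k)^-1)).
    by apply: cnearS (cnear_neq zrho) => w /negbTE ->.
  by apply: cdiffM; [exact: hf|exact: dq].
have hz1 rho' : rho' \in s -> cabs (rho' - c) <= r' /\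
     exists2 g, cdiff g rho' & cnear rho' (fun z => f1 z = (z - rho') ^+ m rho' * g z).
  move=> rs; have [r1 [g1 dg1 hg1]] := hz rho' (mem_behead (s := rho :: s) rs).
  have nr : rho' != rho by apply: contraNneq rhos => <-.
  split=> //; exists (fun z => g1 z * ((z - rho) ^+ k)^-1 * bl z ^+ k).
    by apply: cdiffM => //; apply: cdiffM => //; exact: dq.
  apply: cnearS (cnearI (cnear_neq nr) hg1) => w [/negbTE wr hw].
  by rewrite /f1 wr hw !mulrA.
have conjabs z : cabs (conjc z) = cabs z by apply: complexI; rewrite -!normE normcJ.
have hB1 t : 0 <= t <= tau -> cabs (f1 (circ c r t)) <= B t.
  move=> /hB; apply: le_trans; set z := circ c r t.
  have zc : cabs (z - c) = r by rewrite cabs_circ.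
  have zrho : z != rho by apply: contraTneq rr => <-; rewrite zc -ltNge.
  have zr0 : 0 < cabs (z - rho) by rewrite cabs_gt0 subr_eq0.
  have blz : cabs (bl z) = cabs (z - rho).
    rewrite /bl (_ : (r ^+ 2)%:C = (z - c) * conjc (z - c)); last by rewrite -cabs_sqrE zc.
    rewrite [conjc (rho - c) * _]mulrC -mulrBr -rmorphB /= (_ : z - c - (rho - c) = z - rho); last by ring.
    by rewrite cabsM cabsM cabsV zc conjabs cabs_real gtr0_norm // mulrAC divff ?mul1r ?gt_eqF.
  rewrite /f1 (negbTE zrho) !cabsM cabsV !cabsX blz divfK // expf_neq0 // gt_eqF //.
have := IHs f1 df1 us hz1 hB1; apply: le_trans.
rewrite big_cons -/k; set N := (\sum_(_ <- _) _)%N.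
have rr0 : 0 <= (r / r') ^+ N by rewrite exprn_ge0 // ltW // divr_gt0.
rewrite ler_pM2r ?tau_gt0 // exprD mulrA ler_wpM2r //.
(* For rho = c the gain r / |rho - c| makes no sense, but then f c = 0 unless the multiplicity is
   0. *)
have [cr|rc] := eqVneq rho c.
  have [k0|k0] := posnP k.
    rewrite /f1 k0 !expr0 !mulr1.
    by rewrite -cr eqxx; have := cnear_point hg; rewrite -/k k0 expr0 mul1r => ->.
  suff -> : f c = 0 by rewrite cabs0 mul0r cabs_ge0.
  by have := cnear_point hg; rewrite -/k cr subrr expr0n (gtn_eqF k0) mul0r.
(* Off the centre each unit of multiplicity gains |bl c| / |c - rho| = r / |c - rho| >= r / r'. *)
have blc : cabs (bl c) = r.
  by rewrite /bl subrr mulr0 subr0 -fmorphV -rmorphM /= cabs_real expr2 mulfK ?gtr0_norm // gt_eqF.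
have rc0 : 0 < cabs (c - rho) by rewrite cabs_gt0 subr_eq0 eq_sym.
rewrite /f1 eq_sym (negbTE rc) !cabsM cabsV !cabsX blc -mulrA ler_wpM2l ?cabs_ge0 //.
rewrite [leRHS]mulrC -expr_div_n lerXn2r ?nnegrE ?divr_ge0 ?(ltW r0) ?(ltW r'0) ?cabs_ge0 //.
by rewrite ler_wpM2l ?(ltW r0) // lef_pV2 ?posrE // cabs_distC.
Qed.

Lemma circ_bounded f c r : 0 < r -> (forall z, cabs (z - c) <= r -> cdiff f z) ->
  exists psi : R -> R, forall phi, 0 <= phi <= tau -> is_derive phi 1 psi (cabs (f (circ c r phi))).
Proof.
move=> r0 hf.
have [||F hF] := @cprimitive_ex R (fun t => (cabs (f (circ c r t)))%:C) 0 tau.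
- exact: ltW tau_gt0.
- move=> t _ e e0.
  have dH : cdiff (fun w => f (c + cexp w)) ((ln r)%:C + (0 +i* 1) * t%:C).
    apply: cdiff_comp; first by apply: cdiffD; [exact: cdiff_cst|exact: cdiff_cexp].
    by apply: hf; rewrite addrC addKr cabs_cexp ReD ReM /= mul0r mulr0 subrr addr0 lnK // posrE.
  have [d d0 h] := cdiff_line_cont dH e0; exists d => // x _ /h.
  have E u : ln r +i* u = (ln r)%:C + (0 +i* 1) * u%:C.
    by apply: complex_eq; rewrite !(ReD, ImD, ReM, ImM) /=; ring.
  rewrite -!E -!circE // -rmorphB /= cabs_real; apply: le_lt_trans.
  have := cabs_sub_ge (f (circ c r x)) (f (circ c r t)).
  have := cabs_sub_ge (f (circ c r t)) (f (circ c r x)).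
  by rewrite (cabs_distC (f (circ c r t))) ler_norml; lra.
by exists (fun t => Re (F t)) => t /hF/rderivP[].
Qed.

Lemma bernoulli (x : R) m : 1 <= x -> 1 + m%:R * (x - 1) <= x ^+ m.
Proof.
move=> x1; elim: m => [|k IH]; first by rewrite mul0r addr0 expr0.
rewrite exprS -natr1; have : x * (1 + k%:R * (x - 1)) <= x * x ^+ k by rewrite ler_wpM2l //; lra.
have : 0 <= k%:R * (x - 1) ^+ 2 by rewrite mulr_ge0 ?sqr_ge0.
nra.
Qed.

Lemma pow_unbounded (x a M : R) : 1 < x -> 0 < a -> exists n, M < a * x ^+ n.
Proof.
move=> x1 a0; pose y := `|M| / a / (x - 1).
have y0 : 0 <= y by rewrite !divr_ge0 // ?subr_ge0 ltW.
have := archi_boundP y0; set n := Num.bound _ => hn; exists n.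
have bern := bernoulli n (ltW x1).
rewrite (le_lt_trans (ler_norm _)) // mulrC -ltr_pdivrMr // (lt_le_trans _ bern) //.
have : y * (x - 1) < n%:R * (x - 1) by rewrite ltr_pM2r // subr_gt0.
rewrite /y divfK; last by rewrite gt_eqF // subr_gt0.
by move/lt_trans; apply; rewrite ltrDr.
Qed.

(** A vanishing germ is divisible by (z - rho)^n for every n, so Jensen's inequality bounds |f c| (r
    / |rho - c|)^n for all n, which forces f c = 0. *)
Lemma zero_propagates f c (r : R) rho :
  (forall z, cabs (z - c) <= r -> cdiff f z) -> cabs (rho - c) < r ->
  cnear rho (fun z => f z = 0) -> f c = 0.
Proof.
move=> hf rr hz.
have [rc|rc] := eqVneq rho c; first by rewrite -rc; exact: cnear_point hz.
have r'0 : 0 < cabs (rho - c) by rewrite cabs_gt0 subr_eq0.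
have r0 := lt_trans r'0 rr.
have [psi hpsi] := circ_bounded r0 hf.
apply/eqP; apply: contraT; rewrite -cabs_gt0 => f0.
have q1 : 1 < r / cabs (rho - c) by rewrite ltr_pdivlMr // mul1r.
have [n hn] := pow_unbounded (psi tau - psi 0) q1 (mulr_gt0 f0 tau_gt0).
have := @jensen f c r (cabs (rho - c)) [:: rho] (fun=> n) psi _ r'0 rr hf isT _ hpsi
   (fun phi _ => lexx _).
rewrite big_cons big_nil addn0 mulrAC => jj; move: hn; rewrite ltNge jj //.
move=> z; rewrite inE => /eqP ->; split=> //; exists (fun=> 0); first exact: cdiff_cst.
by apply: cnearS hz => w ->; rewrite mulr0.
Qed.

End CircleMeans.

(** * Complex powers and continuation by Abel summation *)

Section ComplexPowers.
Variable R : realType.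
Implicit Types (x y a : R) (s : R[i]).

(* x^s, meaningful only for x > 0 *)
Definition cpw x s : R[i] := cexp (s * (ln x)%:C).

Lemma cabs_cpw x s : 0 < x -> cabs (cpw x s) = x `^ Re s.
Proof.
move=> x0; rewrite cabs_cexp ReM /= mulr0 subr0 /powR gt_eqF //.
Qed.

Lemma cpwM x y s : 0 < x -> 0 < y -> cpw (x * y) s = cpw x s * cpw y s.
Proof. by move=> x0 y0; rewrite /cpw lnM ?posrE // rmorphD /= mulrDr cexpD. Qed.

Lemma cpwD x s t : cpw x (s + t) = cpw x s * cpw x t.
Proof. by rewrite /cpw mulrDl cexpD. Qed.

Lemma cpwN x s : cpw x (- s) = (cpw x s)^-1.
Proof. by rewrite /cpw mulNr cexpN. Qed.

Lemma cpw1 x : 0 < x -> cpw x 1 = x%:C.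
Proof. by move=> x0; rewrite /cpw mul1r cexp_real lnK // posrE. Qed.

Lemma cpw1l s : cpw 1 s = 1.
Proof. by rewrite /cpw ln1 mulr0 cexp0. Qed.

Lemma cpw_real x a : 0 < x -> cpw x a%:C = (x `^ a)%:C.
Proof. by move=> x0; rewrite /cpw -rmorphM cexp_real /powR gt_eqF. Qed.

Lemma cdiff_cpw x s : cdiff (cpw x) s.
Proof.
apply: (@cdiff_comp _ (@cexp R) (fun s => s * (ln x)%:C)); last exact: cdiff_cexp.
by apply: cdiffM; [exact: cdiff_id|exact: cdiff_cst].
Qed.

Lemma rderiv_cpw x s : 0 < x -> rderiv (fun t => cpw t s) x (s * cpw x (s - 1)).
Proof.
move=> x0; have /is_deriveP dl := is_derive1_ln x0.
have h : rderiv (fun t => s * (ln t)%:C) x (s * (x^-1)%:C).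
  move=> e e0; have s1 : 0 < cabs s + 1 by rewrite ltr_wpDl ?cabs_ge0.
  have [d d0 hd] := dl _ (divr_gt0 e0 s1); exists d => // t /hd td.
  rewrite (_ : _ - _ = s * (ln (x + t) - ln x - x^-1 * t)%:C); last first.
    by rewrite !(rmorphB, rmorphM) /=; ring.
  rewrite cabsM cabs_real.
  apply: le_trans (_ : (cabs s + 1) * (e / (cabs s + 1) * `|t|) <= _).
    by rewrite ler_pM ?cabs_ge0 // lerDl.
  by rewrite mulrA mulrC [X in `|t| * X]mulrC divfK ?gt_eqF // mulrC.
have := rderiv_comp h (cderiv_cexp (s * (ln x)%:C)).
rewrite -/(cpw x s); congr (rderiv _ _ _).
by rewrite cpwD cpwN cpw1 // fmorphV /=; ring.
Qed.

Lemma powR_small a (e : R) : 0 < a -> 0 < e ->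
  exists2 M : R, 1 <= M & forall x, M <= x -> x `^ (- a) <= e.
Proof.
move=> a0 e0; exists (Num.max 1 (e^-1 `^ a^-1)); first by rewrite le_max lexx.
move=> x; rewrite ge_max => /andP[x1 xe]; have x0 := lt_le_trans ltr01 x1.
rewrite powRN invf_ple ?posrE ?powR_gt0 //.
rewrite -[leLHS]powRr1 ?invr_ge0 ?(ltW e0) // -(mulVf (lt0r_neq0 a0)) powRrM.
by rewrite ge0_ler_powR ?nnegrE ?powR_ge0 // ?(ltW a0) ?(ltW x0).
Qed.

Lemma powR_ge1 x a : 1 <= x -> 0 <= a -> 1 <= x `^ a.
Proof. by move=> x1 a0; rewrite -(powRr0 x) ler_powR. Qed.

Lemma powR_le_anti x y a : 0 < x -> x <= y -> a <= 0 -> y `^ a <= x `^ a.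
Proof.
move=> x0 xy a0; rewrite -[a]opprK !(powRN _ (- a)) lef_pV2 ?posrE ?powR_gt0 ?(lt_le_trans x0) //.
by rewrite ge0_ler_powR ?oppr_ge0 ?nnegrE // ltW // (lt_le_trans x0).
Qed.

Lemma powRDp x (r s : R) : 0 < x -> x `^ (r + s) = x `^ r * x `^ s.
Proof. by move=> x0; rewrite powRD // (gt_eqF x0) implybT. Qed.

End ComplexPowers.

Section Continuation.
Variables (R : realType) (n : nat -> R) (N : R -> nat) (A theta K : R).
Hypothesis n_ge1 : forall k, 1 <= n k.
Hypothesis NP : forall k x, (n k <= x) = (k < N x)%N.
Hypothesis theta_ge0 : 0 <= theta.
Hypothesis N_asymp : forall x, 1 <= x -> `|(N x)%:R - A * x| <= K * x `^ theta.
Implicit Types (x y : R) (s : R[i]).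

Let n_gt0 k : 0 < n k. Proof. exact: lt_le_trans (n_ge1 k). Qed.

Let K_ge0 : 0 <= K.
Proof. by have := le_trans (normr_ge0 _) (N_asymp (lexx 1)); rewrite powR1 mulr1. Qed.

Definition partial_zeta (m : nat) s : R[i] := \sum_(j < m) cpw (n j) (- s).

(* (s - 1) times the partial sum of zeta up to index m, corrected by the main
   terms of Abel summation; for m = N x its derivative in x is O(x^(theta - s - 1)) *)
Definition zeta_approx (m : nat) x s : R[i] :=
  (s - 1) * partial_zeta m s + A%:C * cpw x (1 - s)
  - (s - 1) * (m%:R - A * x)%:C * cpw x (- s).

Let N_mono x y : x <= y -> (N x <= N y)%N.
Proof.
move=> xy; rewrite leqNgt; apply/negP => h; have := NP (N y) x; rewrite h => nx.
by have := NP (N y) y; rewrite ltnn (le_trans nx xy).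
Qed.

Let n_mono i j : (i <= j)%N -> n i <= n j.
Proof. by move=> ij; rewrite NP (leq_ltn_trans ij) // -NP. Qed.

(** The integral over t >= x of |s| |s - 1| K t^(theta - Re s - 1). *)
Let bnd s x : R := cabs s * cabs (s - 1) * K / (Re s - theta) * x `^ (theta - Re s).

(** While N t = m the derivative in t is s (s - 1) (N t - A t) t^(-s - 1), of modulus at most the
    derivative of - [bnd]. *)
Lemma zeta_approx_step (m : nat) s x y : theta < Re s -> 1 <= x -> x <= y ->
  (forall t, x < t < y -> N t = m) ->
  cabs (zeta_approx m y s - zeta_approx m x s) <= bnd s x - bnd s y.
Proof.
move=> ts x1 xy hm; have x0 := lt_le_trans ltr01 x1.
pose a := theta - Re s; have a0 : a < 0 by rewrite subr_lt0.
pose c := cabs s * cabs (s - 1) * K.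
have c0 : 0 <= c by rewrite !mulr_ge0 ?cabs_ge0.
pose psi (t : R) : R := - (c / (Re s - theta)) * Re (cpw t a%:C).
have psiE t : 0 < t -> psi t = - bnd s t.
  by move=> t0; rewrite /psi /bnd cpw_real //= -/a /c; ring.
rewrite [leRHS](_ : _ = psi y - psi x); last first.
  by rewrite !psiE ?opprK 1?addrC // (lt_le_trans x0).
have h1 t : x <= t <= y -> rderiv (fun t => zeta_approx m t s) t
    ((s - 1) * s * (m%:R - A * t)%:C * cpw t (- s - 1)).
  move=> /andP[xt ty]; have t0 := lt_le_trans x0 xt.
  have h1 := rderivM (rderiv_cst A%:C t) (rderiv_cpw (1 - s) t0).
  have h3 := rderivM (rderiv_cst (- (s - 1)) t) (rderiv_line (m%:R)%:C (- A%:C) t).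
  have h4 := rderivM h3 (rderiv_cpw (- s) t0).
  have h5 := rderivD (rderiv_cst ((s - 1) * partial_zeta m s) t) (rderivD h1 h4).
  apply: rderiv_ext (rderiv_eq _ h5).
    move=> u; rewrite /zeta_approx !(rmorphB, rmorphM) /=; ring.
  rewrite (_ : 1 - s - 1 = - s); last by ring.
  rewrite (_ : cpw t (- s) = t%:C * cpw t (- s - 1)); last first.
    by rewrite -(cpw1 t0) -cpwD; congr cpw; ring.
  rewrite !(rmorphB, rmorphM) /=; ring.
have h2 t : x <= t <= y -> is_derive t 1 psi (c * Re (cpw t (a%:C - 1))).
  move=> /andP[xt ty]; have t0 := lt_le_trans x0 xt.
  have /rderivP[h _] := rderiv_cpw a%:C t0.
  have := is_deriveZ (- (c / (Re s - theta))) h.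
  congr (is_derive _ _ _ _); rewrite /GRing.scale /= ReM /= mul0r subr0.
  by rewrite /a; field; rewrite subr_eq0 gt_eqF.
apply: (mvt_ineq xy h1 h2) => t /andP[xt ty]; have t0 := lt_trans x0 xt.
rewrite (cabsM _ (cpw _ _)) cabs_cpw // !cabsM cabs_real ReD !ReN /=.
have -> : Re (cpw t (a%:C - 1)) = t `^ theta * t `^ (- Re s - 1).
  have -> : a%:C - 1 = (a - 1)%:C by apply: complex_eq; rewrite !(ReD, ImD, ReN, ImN) /= ?subr0.
  by rewrite cpw_real // -powRDp //=; congr (_ `^ _); rewrite /a; ring.
have Nt : N t = m by apply: hm; rewrite xt.
rewrite -Nt.
have := N_asymp (ltW (le_lt_trans x1 xt)); set d := `|_|; set u := t `^ theta.
set v := t `^ _ => du; have v0 : 0 <= v by exact: powR_ge0.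
rewrite [leRHS](_ : _ = cabs (s - 1) * cabs s * (K * u) * v); last by rewrite /c; ring.
by rewrite ler_wpM2r // ler_wpM2l // mulr_ge0 ?cabs_ge0.
Qed.

(** No jump occurs at a generalized integer x: each new term (s - 1) x^(-s) of the sum is cancelled
    by the unit increase of m in the correction. *)
Lemma zeta_approx_tie (m m' : nat) x s : 0 < x -> (m <= m')%N ->
  (forall j, (m <= j < m')%N -> n j = x) -> zeta_approx m' x s = zeta_approx m x s.
Proof.
move=> x0 mm; elim: m' mm => [|m' IH].
  by rewrite leqn0 => /eqP ->.
rewrite leq_eqVlt => /orP[/eqP <- //|mm'] hj.
rewrite -IH //; last by move=> j /andP[h1 h2]; apply: hj; rewrite h1 ltnW.
rewrite /zeta_approx /partial_zeta big_ord_recr /= (hj m'); last by rewrite -ltnS mm' leqnn.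
by rewrite -natr1 !(rmorphB, rmorphD) /= rmorph1; ring.
Qed.

(** Induction on the number of indices counted between x and y; the bounds telescope. *)
Lemma zeta_approx_cauchy s x y : theta < Re s -> 1 <= x -> x <= y ->
  cabs (zeta_approx (N y) y s - zeta_approx (N x) x s) <= bnd s x - bnd s y.
Proof.
move=> ts; move: {2}(N y - N x)%N (leqnn (N y - N x)) => d.
elim: d x => [|d IH] x hd x1 xy.
  have E : N y = N x by have := N_mono xy; lia.
  rewrite E; apply: zeta_approx_step => // t /andP[xt ty].
  by apply/eqP; rewrite eqn_leq -{1}E !N_mono // ltW.
have [E|E] := leqP (N y) (N x).
  have {}E : N y = N x by have := N_mono xy; lia.
  rewrite E; apply: zeta_approx_step => // t /andP[xt ty].
  by apply/eqP; rewrite eqn_leq -{1}E !N_mono // ltW.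
(* The first generalized integer beyond x: N is constant on [x, z). *)
pose z := n (N x).
have zy : z <= y by rewrite NP.
have xz : x < z by rewrite ltNge NP ltnn.
have z1 := le_trans x1 (ltW xz).
have Nz : (N x < N z)%N by rewrite -NP.
have h1 := IH z _ z1 zy.
have h2 : cabs (zeta_approx (N x) z s - zeta_approx (N x) x s) <= bnd s x - bnd s z.
  apply: zeta_approx_step => //; first exact: ltW.
  move=> t /andP[xt tz]; have := N_mono (ltW xt).
  by move: tz; rewrite ltNge NP; lia.
have E2 : zeta_approx (N z) z s = zeta_approx (N x) z s.
  apply: zeta_approx_tie; [exact: n_gt0|exact: ltnW|move=> j /andP[j1 j2]].
  by apply/eqP; rewrite eq_le NP j2 /= n_mono.
rewrite -E2 in h2.
apply: le_trans (cabs_tri _ (zeta_approx (N z) z s) _) _.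
have hd' : (N y - N z <= d)%N by lia.
by have := h1 hd'; lra.
Qed.

(** [W] is (s - 1) zeta(s), the limit of [zeta_approx] along integers; the factor s - 1 removes the
    pole. The explicit error serves again later, at x = Y / n_d, for the mollified function. *)
Lemma zeta_cont_ex : exists W : R[i] -> R[i], forall s, theta < Re s ->
  cdiff W s /\ forall x, 1 <= x -> cabs (W s - (s - 1) * partial_zeta (N x) s - A%:C * cpw x (1 - s))
    <= cabs (s - 1) * ((cabs s / (Re s - theta) + 1) * K * x `^ (theta - Re s)).
Proof.
pose E s x := zeta_approx (N x) x s.
have bnd0 s x : theta < Re s -> 0 <= bnd s x.
  by move=> ts; rewrite !mulr_ge0 ?cabs_ge0 ?powR_ge0 // invr_ge0 subr_ge0 ltW.
have nat1 k : 1 <= k.+1%:R :> R by rewrite ler1n.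
have : forall s, exists w, theta < Re s -> forall k : nat, cabs (E s k.+1%:R - w) <= 2 * bnd s k.+1%:R.
  move=> s; case: (boolP (theta < Re s)) => [ts|_]; last by exists 0.
  have h m k : cabs (E s m.+1%:R - E s k.+1%:R) <= bnd s m.+1%:R + bnd s k.+1%:R.
    have b1 := bnd0 s m.+1%:R ts; have b2 := bnd0 s k.+1%:R ts.
    have [mk|/ltnW km] := leqP m k.
      have := @zeta_approx_cauchy s m.+1%:R k.+1%:R ts (nat1 _) _; rewrite ler_nat ltnS mk.
      by move=> /(_ isT); rewrite cabs_distC -!/(E _ _); lra.
    have := @zeta_approx_cauchy s k.+1%:R m.+1%:R ts (nat1 _) _; rewrite ler_nat ltnS km.
    by move=> /(_ isT); rewrite -!/(E _ _); lra.
  by have [w hw] := complex_cauchy_lim h; exists w.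
move=> /choice[W hW]; exists W.
have small (a c e : R) : 0 < a -> 0 <= c -> 0 < e ->
    exists k0 : nat, forall k, (k0 <= k)%N -> c * k.+1%:R `^ (- a) <= e.
  move=> a0 c0 e0; have c1 : 0 < c + 1 by lra.
  have [M M1 hM] := powR_small a0 (divr_gt0 e0 c1).
  exists (Num.bound M) => k /= hk.
  have := hM k.+1%:R; set u := _ `^ _ => hu; have {}hu : u <= e / (c + 1).
    apply: hu; apply: le_trans (ltW (archi_boundP (le_trans ler01 M1))) _.
    by rewrite ler_nat ltnW.
  have u0 : 0 <= u by exact: powR_ge0.
  move: hu; rewrite ler_pdivlMr // mulrDr mulr1 mulrC; lra.
have lim s x : theta < Re s -> 1 <= x -> cabs (W s - E s x) <= bnd s x.
  move=> ts x1; apply/ler_addgt0Pr => e e0.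
  have a0 : 0 < Re s - theta by rewrite subr_gt0.
  pose c := 2 * (cabs s * cabs (s - 1) * K / (Re s - theta)).
  have c0 : 0 <= c by rewrite !mulr_ge0 ?cabs_ge0 // invr_ge0 ltW.
  have [k0 hk0] := small _ _ _ a0 c0 e0.
  pose k := maxn k0 (Num.bound x).
  have xk : x <= k.+1%:R.
    apply: le_trans (ltW (archi_boundP (le_trans ler01 x1))) _.
    by rewrite ler_nat ltnW // ltnS leq_maxr.
  have h1 := zeta_approx_cauchy ts x1 xk.
  have h2 := hW s ts k; rewrite cabs_distC in h2.
  have h3 := hk0 k (leq_maxl _ _).
  have h4 : 2 * bnd s k.+1%:R = c * k.+1%:R `^ (- (Re s - theta)).
    by rewrite /bnd /c opprB; ring.
  apply: le_trans (cabs_tri _ (E s k.+1%:R) _) _.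
  have := bnd0 s k.+1%:R ts; rewrite -!/(E _ _) in h1; lra.
move=> s ts; split; last first.
  move=> x x1; have x0 := lt_le_trans ltr01 x1.
  rewrite (_ : _ - _ = (W s - E s x) - (s - 1) * ((N x)%:R - A * x)%:C * cpw x (- s)); last first.
    by rewrite /E /zeta_approx; ring.
  apply: le_trans (cabsB _ _) _.
  have h1 := lim s x ts x1; have h2 := N_asymp x1.
  rewrite (cabsM _ (cpw _ _)) cabs_cpw // !cabsM cabs_real ReN.
  rewrite [leRHS](_ : _ = bnd s x + cabs (s - 1) * (K * x `^ theta) * x `^ (- Re s)); last first.
    rewrite /bnd powRDp //; ring.
  by rewrite lerD // ler_wpM2r ?powR_ge0 // ler_wpM2l ?cabs_ge0.
(* Half the distance to the line Re = theta, so that the tail bound is uniform on the disc. *)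
pose r := (Re s - theta) / 2; have r0 : 0 < r by rewrite divr_gt0 // subr_gt0.
have Rez z : cabs (z - s) <= r -> theta + r <= Re z.
  move=> zr; have := le_trans (Re_le_cabs _) zr; rewrite ReD ReN ler_norml => /andP[].
  rewrite /r; lra.
pose c := (cabs s + r) * (cabs s + r + 1) * K / r.
have c0 : 0 <= c by rewrite !mulr_ge0 ?addr_ge0 ?cabs_ge0 ?invr_ge0 ?(ltW r0).
apply: (@weierstrass _ (fun k z => E z k.+1%:R) W s r (fun k => c * k.+1%:R `^ (- r)) r0).
- move=> k z _; rewrite /E /zeta_approx /partial_zeta.
  have d1 : cdiff (fun z => z - 1 : R[i]) z by apply: cdiffB; [exact: cdiff_id|exact: cdiff_cst].
  have d2 x : cdiff (fun z => cpw x (- z)) z.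
    by apply: (@cdiff_comp _ (cpw x)); [apply: cdiffN; exact: cdiff_id|exact: cdiff_cpw].
  apply: cdiffB; first apply: cdiffD.
  + by apply: cdiffM => //; apply: cdiff_sum => i _; exact: d2.
  + apply: cdiffM; first exact: cdiff_cst.
    apply: (@cdiff_comp _ (cpw _) (fun z => 1 - z)); last exact: cdiff_cpw.
    by apply: cdiffB; [exact: cdiff_cst|exact: cdiff_id].
  + apply: cdiffM; last exact: d2.
    by apply: cdiffM => //; exact: cdiff_cst.
- move=> k z zr; have tz := Rez z zr; have ts' : theta < Re z by lra.
  rewrite cabs_distC; apply: le_trans (lim z k.+1%:R ts' (nat1 _)) _.
  have zs : cabs z <= cabs s + r by have := cabs_sub_ge z s; lra.
  have zs1 : cabs (z - 1) <= cabs s + r + 1 by have := cabsB z 1; rewrite cabs1; lra.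
  rewrite /bnd /c ler_pM ?powR_ge0 //.
  + by rewrite !mulr_ge0 ?cabs_ge0 // invr_ge0 subr_ge0 ltW.
  + rewrite ler_pM ?mulr_ge0 ?cabs_ge0 ?invr_ge0 ?subr_ge0 ?(ltW ts') //.
      by rewrite ler_wpM2r // ler_pM ?cabs_ge0.
    by rewrite lef_pV2 ?posrE // ?subr_gt0 //; lra.
  + by rewrite ler_powR //; lra.
- by move=> e e0; have [k0 hk0] := small _ _ _ r0 c0 e0; exists k0; apply: hk0.
Qed.

End Continuation.

(** * Moebius inversion for generalized integers *)

Section FreeMonoid.
Variables (R : realType) (p n : nat -> R) (N : R -> nat) (ev : nat -> nat -> nat).
Hypothesis p_gt1 : forall j, 1 < p j.
Hypothesis p_infty : forall M : R, exists J, forall j, (J <= j)%N -> M <= p j.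
Hypothesis NP : forall k x, (n k <= x) = (k < N x)%N.
Hypothesis ev_supp : forall k, exists J, forall j, (J <= j)%N -> ev k j = 0%N.
Hypothesis ev_ex : forall (v : nat -> nat) J, (forall j, (J <= j)%N -> v j = 0%N) ->
  exists k, forall j, ev k j = v j.
Hypothesis ev_inj : forall k l, (forall j, ev k j = ev l j) -> k = l.
Hypothesis nE : forall k J, (forall j, (J <= j)%N -> ev k j = 0%N) ->
  n k = \prod_(j < J) p j ^+ ev k j.

Let p_gt0 j : 0 < p j. Proof. exact: lt_trans (p_gt1 j). Qed.

Lemma gint_ge1 k : 1 <= n k.
Proof.
have [J hJ] := ev_supp k; rewrite (nE hJ).
elim/big_ind : _ => // [x y x1 y1|j _]; last by rewrite exprn_ege1 // ltW.
by rewrite -[1]mulr1 ler_pM.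
Qed.

Let n_gt0 k : 0 < n k. Proof. exact: lt_le_trans (gint_ge1 k). Qed.

Let n_mono i j : (i <= j)%N -> n i <= n j.
Proof. by move=> ij; rewrite NP (leq_ltn_trans ij) // -NP. Qed.

Lemma gint_gt1_ev k j : (0 < ev k j)%N -> 1 < n k.
Proof.
move=> kj; have [J hJ] := ev_supp k; rewrite (nE hJ).
have jJ : (j < J)%N by rewrite ltnNge; apply: contraTN kj => /hJ ->.
rewrite (bigD1 (Ordinal jJ)) //=.
apply: lt_le_trans (_ : p j ^+ ev k j <= _); first by rewrite exprn_egt1 // -lt0n.
rewrite ler_peMr ?exprn_ge0 ?(ltW (p_gt0 _)) //.
elim/big_ind : _ => // [x y x1 y1|i _]; last by rewrite exprn_ege1 // ltW.
by rewrite -[1]mulr1 ler_pM.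
Qed.

(** The empty product has value 1 and the values are sorted, so n_0 <= 1, whereas a positive
    exponent forces a value above 1. *)
Lemma ev0 j : ev 0 j = 0%N.
Proof.
have [k0 hk0] := @ev_ex (fun=> 0%N) 0 (fun _ _ => erefl).
apply/eqP; rewrite -leqn0 leqNgt; apply/negP => /gint_gt1_ev; rewrite ltNge => /negP; apply.
apply: le_trans (n_mono (leq0n k0)) _.
by rewrite (nE (J := 0)) ?big_ord0.
Qed.

Lemma gint0 : n 0 = 1.
Proof. by rewrite (nE (J := 0)) ?big_ord0 // => j _; exact: ev0. Qed.

Lemma gint_gt1 k : (0 < k)%N -> 1 < n k.
Proof.
move=> k0; suff [j hj] : exists j, (0 < ev k j)%N by exact: gint_gt1_ev hj.
apply: contrapT => h; move: k0; suff -> : k = 0%N by [].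
apply: ev_inj => j; rewrite ev0; apply/eqP; rewrite -leqn0 leqNgt; apply/negP => hj.
by apply: h; exists j.
Qed.

(** Multiplication acts on indices: different exponent vectors may share a value, so values alone do
    not determine a factorization. *)
Lemma mulx_sig : {mul : nat -> nat -> nat | forall k l j, ev (mul k l) j = (ev k j + ev l j)%N}.
Proof.
apply: cid.
have : forall kl : nat * nat, exists m, forall j, ev m j = (ev kl.1 j + ev kl.2 j)%N.
  move=> [k l]; have [J hJ] := ev_supp k; have [J' hJ'] := ev_supp l.
  apply: (@ev_ex _ (maxn J J')) => j; rewrite geq_max => /andP[/hJ -> /hJ' ->] //.
by move=> /choice[f hf]; exists (fun k l => f (k, l)) => k l j; rewrite hf.
Qed.

Definition mulx := sval mulx_sig.
Lemma ev_mulx k l j : ev (mulx k l) j = (ev k j + ev l j)%N.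
Proof. exact: (svalP mulx_sig). Qed.

Lemma gint_mulx k l : n (mulx k l) = n k * n l.
Proof.
have [J hJ] := ev_supp k; have [J' hJ'] := ev_supp l.
have h1 j : (maxn J J' <= j)%N -> ev k j = 0%N by rewrite geq_max => /andP[/hJ].
have h2 j : (maxn J J' <= j)%N -> ev l j = 0%N by rewrite geq_max => /andP[_ /hJ'].
rewrite (nE h1) (nE h2) (nE (J := maxn J J')); last first.
  by move=> j hj; rewrite ev_mulx h1 // h2.
by rewrite -big_split /=; apply: eq_bigr => j _; rewrite ev_mulx exprD.
Qed.

Definition dvdx d k : bool := `[< forall j, (ev d j <= ev k j)%N >].

Lemma dvdxP d k : reflect (forall j, (ev d j <= ev k j)%N) (dvdx d k).
Proof. exact: asboolP. Qed.

Lemma dvdx_mulx d m : dvdx d (mulx d m).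
Proof. by apply/dvdxP => j; rewrite ev_mulx leq_addr. Qed.

Lemma dvdx_ex d k : dvdx d k -> exists m, k = mulx d m.
Proof.
move=> /dvdxP h; have [J hJ] := ev_supp k.
have [|m hm] := @ev_ex (fun j => ev k j - ev d j)%N J.
  by move=> j /hJ ->.
by exists m; apply: ev_inj => j; rewrite ev_mulx hm subnKC.
Qed.

Lemma dvdx_le d k : dvdx d k -> n d <= n k.
Proof. by move=> /dvdx_ex[m ->]; rewrite gint_mulx ler_peMr ?gint_ge1 // ltW. Qed.

Lemma mulxI d : injective (mulx d).
Proof.
move=> k l e; apply: ev_inj => j; apply/eqP; rewrite -(eqn_add2l (ev d j)).
by rewrite -!ev_mulx e.
Qed.

Lemma sum_multiples (V : nmodType) (f : nat -> V) d Y :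
  \sum_(0 <= k < N Y | dvdx d k) f k = \sum_(0 <= m < N (Y / n d)) f (mulx d m).
Proof.
rewrite -big_filter -(big_map (mulx d) xpredT f); apply: perm_big; apply: uniq_perm.
- by rewrite filter_uniq // iota_uniq.
- by rewrite map_inj_uniq ?iota_uniq //; exact: mulxI.
move=> k; rewrite mem_filter mem_index_iota leq0n /= -NP.
apply/andP/mapP => [[/dvdx_ex[m ->] h]|[m + ->]].
  exists m => //; rewrite mem_index_iota leq0n /= -NP ler_pdivlMr // mulrC -gint_mulx //.
rewrite mem_index_iota leq0n /= -NP ler_pdivlMr // mulrC -gint_mulx => h.
by rewrite dvdx_mulx.
Qed.

Let mobf (m : nat) : R := match m with 0 => 1 | 1 => -1 | _ => 0 end.

Lemma supp_sig : {J : nat -> nat | forall k j, (J k <= j)%N -> ev k j = 0%N}.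
Proof. by apply: cid; have /choice[J hJ] := ev_supp; exists J. Qed.

Definition mob k : R := \prod_(j < sval supp_sig k) mobf (ev k j).

Lemma mobE k J : (forall j, (J <= j)%N -> ev k j = 0%N) -> mob k = \prod_(j < J) mobf (ev k j).
Proof.
rewrite /mob; set J0 := sval _ k; have h0 := svalP supp_sig k; rewrite -/J0 in h0.
have ext I J1 : (I <= J1)%N -> (forall j, (I <= j)%N -> ev k j = 0%N) ->
    \prod_(j < J1) mobf (ev k j) = \prod_(j < I) mobf (ev k j).
  move=> IJ hI; rewrite -!(big_mkord xpredT (fun j => mobf (ev k j))).
  rewrite (big_cat_nat (n := I)) //= [X in _ * X]big_nat_cond [X in _ * X]big1 ?mulr1 //.
  by move=> j /andP[/andP[/hI ->]].
move=> hJ; have [h|/ltnW h] := leqP J0 J; first by rewrite (ext J0).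
by rewrite (ext J).
Qed.

Lemma mob_le1 k : `|mob k| <= 1.
Proof.
rewrite normr_prod.
suff /andP[] : 0 <= \prod_(i < sval supp_sig k) `|mobf (ev k i)| <= 1 by [].
elim/big_ind : _ => [|x y /andP[x0 x1] /andP[y0 y1]|j _]; first by rewrite ler01 lexx.
  by rewrite mulr_ge0 // mulr_ile1.
by rewrite normr_ge0; case: (ev k j) => [|[|m]] /=; rewrite ?normrN ?normr1 ?normr0.
Qed.

Lemma mob0 : mob 0 = 1.
Proof. by rewrite (mobE (J := 0)) ?big_ord0 // => j _; exact: ev0. Qed.

(** A sign-reversing involution of the divisors: [tau] exchanges the exponents 0 and 1 of a prime
    dividing k and fixes larger ones, for which [mob] is 0. Hence the sum equals its opposite. *)
Lemma mob_sum k D : (0 < k)%N -> (forall d, dvdx d k -> (d < D)%N) ->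
  \sum_(0 <= d < D | dvdx d k) mob d = 0.
Proof.
move=> k0 hD.
have [j0 hj0] : exists j, (0 < ev k j)%N.
  apply: contrapT => h; move: k0; suff -> : k = 0%N by [].
  apply: ev_inj => j; rewrite ev0; apply/eqP; rewrite -leqn0 leqNgt; apply/negP => hj.
  by apply: h; exists j.
pose tg (m : nat) := match m with 0 => 1%N | 1 => 0%N | m => m end.
pose v d j := if j == j0 then tg (ev d j0) else ev d j.
have [tau htau] : exists tau : nat -> nat, forall d j, ev (tau d) j = v d j.
  suff /choice[tau htau] : forall d, exists t, forall j, ev t j = v d j by exists tau.
  move=> d; have [J hJ] := ev_supp d; apply: (@ev_ex _ (maxn J j0.+1)) => j.
  rewrite geq_max /v => /andP[/hJ -> h]; case: eqP => // jj; move: h.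
  by rewrite jj ltnn.
have tgK m : tg (tg m) = m by case: m => [|[|]].
have tauK : involutive tau.
  move=> d; apply: ev_inj => j; rewrite htau /v; case: eqP => [->|/eqP jj].
    by rewrite htau /v eqxx tgK.
  by rewrite htau /v (negbTE jj).
have tau_dvd d : dvdx d k -> dvdx (tau d) k.
  move=> /dvdxP h; apply/dvdxP => j; rewrite htau /v; case: eqP => [->|//].
  by have := h j0; rewrite /tg; case: (ev d j0) => [|[|]].
have mobtau d : mob (tau d) = - mob d.
  have [J hJ] := ev_supp d.
  have hJ1 j : (maxn J j0.+1 <= j)%N -> ev d j = 0%N by rewrite geq_max => /andP[/hJ].
  have hJ2 j : (maxn J j0.+1 <= j)%N -> ev (tau d) j = 0%N.
    move=> hj; rewrite htau /v; case: eqP => [jj|_]; last exact: hJ1.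
    by move: hj; rewrite geq_max jj ltnn andbF.
  have j0J : (j0 < maxn J j0.+1)%N by rewrite leq_maxr.
  rewrite (mobE hJ1) (mobE hJ2) (bigD1 (Ordinal j0J)) //= [in RHS](bigD1 (Ordinal j0J)) //=.
  rewrite -mulNr; congr (_ * _).
    rewrite htau /v eqxx; case: (ev d j0) => [|[|m]] /=; by rewrite ?opprK ?oppr0.
  apply: eq_bigr => i ij; rewrite htau /v; case: eqP => // ii.
  by move: ij; rewrite -val_eqE /= ii eqxx.
set S := \sum_(_ <= _ < _ | _) _.
suff : S = - S by move/eqP; rewrite -addr_eq0 -mulr2n mulrn_eq0 /= => /eqP.
pose r := [seq d <- index_iota 0 D | dvdx d k].
rewrite {1}/S -big_filter -/r.
have pr : perm_eq r (map tau r).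
  apply: uniq_perm.
  - by rewrite filter_uniq // iota_uniq.
  - by rewrite map_inj_uniq ?filter_uniq ?iota_uniq //; exact: inv_inj.
  move=> d; apply/idP/mapP => [|[d' + ->]]; rewrite !mem_filter !mem_index_iota !leq0n /=.
    move=> /andP[dk _]; exists (tau d); last by rewrite tauK.
    by rewrite mem_filter mem_index_iota leq0n /= tau_dvd // hD // tau_dvd.
  by move=> /andP[dk _]; rewrite tau_dvd // hD // tau_dvd.
rewrite (perm_big _ pr) big_map (eq_bigr (fun d => - mob d)) => [|d _]; last exact: mobtau.
by rewrite sumrN /r big_filter.
Qed.

(** The Dirichlet coefficient at k of the product of zeta and the mollifier of length X. *)
Definition conv (X : R) k : R := \sum_(0 <= d < N X | dvdx d k) mob d.

Lemma conv_id (X : R) : 1 <= X -> conv X 0 = 1.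
Proof.
move=> X1; have N0 : (0 < N X)%N by rewrite -NP gint0.
rewrite /conv (big_ltn_cond N0) /= ifT; last by apply/dvdxP => j; rewrite ev0.
rewrite mob0 big_nat_cond big1 ?addr0 // => d /andP[/andP[d0 _] /dvdx_le].
by rewrite gint0 leNgt gint_gt1.
Qed.

Lemma conv_eq0 (X : R) k : (0 < k)%N -> n k <= X -> conv X k = 0.
Proof. by move=> k0 kX; apply: mob_sum => // d /dvdx_le dk; rewrite -NP (le_trans dk). Qed.

(** Cutting zeta M_X at Y leaves for each d the partial sum of zeta of length Y / n_d, to which the
    continuation estimate applies. *)
Lemma conv_sum (f : nat -> R[i]) (X Y : R) : X <= Y -> (forall k l, f (mulx k l) = f k * f l) ->
  \sum_(0 <= k < N Y) (conv X k)%:C * f k =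
  \sum_(0 <= d < N X) (mob d)%:C * f d * \sum_(0 <= m < N (Y / n d)) f m.
Proof.
move=> XY fM.
transitivity (\sum_(0 <= k < N Y) \sum_(0 <= d < N X | dvdx d k) (mob d)%:C * f k).
  by apply: eq_bigr => k _; rewrite /conv rmorph_sum mulr_suml.
rewrite (exchange_big_dep_nat xpredT) //=; apply: eq_bigr => d _.
rewrite -mulr_sumr (sum_multiples f) -mulrA; congr (_ * _).
by rewrite mulr_sumr; apply: eq_bigr => m _; rewrite fM.
Qed.

Lemma card_divisors k D J : (forall j, (J <= j)%N -> ev k j = 0%N) ->
  (\sum_(0 <= d < D | dvdx d k) 1 <= \prod_(j < J) (ev k j).+1)%N.
Proof.
move=> hJ; pose r := [seq d <- index_iota 0 D | dvdx d k].
rewrite sum1_count -size_filter -/r.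
pose M := \max_(j < J) ev k j.
pose phi (d : nat) : {ffun 'I_J -> 'I_M.+1} := [ffun j : 'I_J => inord (ev d j)].
have hM d (j : 'I_J) : d \in r -> (ev d j <= ev k j <= M)%N.
  rewrite mem_filter => /andP[/dvdxP h _]; rewrite h /=.
  exact: (leq_bigmax j).
have phi_inj : {in r &, injective phi}.
  move=> d d' dr d'r e; apply: ev_inj => j; have [Jj|jJ] := leqP J j.
    have := dr; have := d'r; rewrite !mem_filter => /andP[/dvdxP h _] /andP[/dvdxP h' _].
    by have := h j; have := h' j; rewrite hJ // !leqn0 => /eqP -> /eqP ->.
  have := congr1 (fun g : {ffun 'I_J -> 'I_M.+1} => val (g (Ordinal jJ))) e.
  rewrite !ffunE /=.
  have := hM d (Ordinal jJ) dr; have := hM d' (Ordinal jJ) d'r => /= /andP[a b] /andP[a' b'].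
  by rewrite !inordK ?ltnS //; [exact: leq_trans a b|exact: leq_trans a' b'].
pose fam := family (fun j : 'I_J => [pred i : 'I_M.+1 | (i <= ev k j)%N]).
have -> : (\prod_(j < J) (ev k j).+1 = #|fam|)%N.
  rewrite card_family foldrE big_map big_enum /=; apply: eq_bigr => j _.
  have evM : (ev k j < M.+1)%N by rewrite ltnS (leq_bigmax j).
  by rewrite -sum1_card -(big_ord_widen _ (fun=> 1%N) evM) sum1_card card_ord.
rewrite -(size_map phi) cardE; apply: uniq_leq_size.
  by rewrite map_inj_in_uniq // filter_uniq // iota_uniq.
move=> _ /mapP[d dr ->]; rewrite mem_enum; apply/familyP => j; rewrite inE ffunE.
by have /andP[a b] := hM d j dr; rewrite inordK ?ltnS // (leq_trans a b).
Qed.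

(** The classical bound for the divisor function, uniform in X because |mob| <= 1: by Bernoulli, m +
    1 <= c_j p_j^(m eps), where c_j = 1 for all but finitely many primes. *)
Lemma divisor_bound (eps : R) : 0 < eps -> exists2 C : R, 0 < C &
  forall X k, `|conv X k| <= C * n k `^ eps.
Proof.
move=> e0; have [J0 hJ0] := p_infty (2 `^ eps^-1).
pose c j := Num.max 1 (p j `^ eps - 1)^-1.
have c1 j : 1 <= c j by rewrite le_max lexx.
have pe j : 1 < p j `^ eps.
  have := @gt0_ltr_powR R eps e0 1 (p j); rewrite !nnegrE powR1; apply => //.
  exact: ltW.
have pm j m : (p j ^+ m) `^ eps = (p j `^ eps) ^+ m.
  by rewrite -(powR_mulrn m (ltW (p_gt0 j))) -(powR_mulrn m (powR_ge0 _ _)) powRAC.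
have key j m : m.+1%:R <= c j * (p j ^+ m) `^ eps.
  have cq : 1 <= c j * (p j `^ eps - 1).
    by rewrite -ler_pdivrMr ?subr_gt0 // mul1r le_max lexx orbT.
  have b := bernoulli m (ltW (pe j)); rewrite pm.
  apply: le_trans (_ : c j * (1 + m%:R * (p j `^ eps - 1)) <= _); last first.
    by rewrite ler_wpM2l // (le_trans ler01).
  rewrite mulrDr mulr1 mulrCA -natr1 addrC lerD // ler_peMr //.
have cJ j : (J0 <= j)%N -> c j = 1.
  move=> /hJ0 hp; apply: max_idPl; rewrite invf_le1 ?subr_gt0 //.
  suff : 2 <= p j `^ eps by lra.
  have E : 2 = (2 `^ eps^-1) `^ eps :> R by rewrite -powRrM mulVf ?powRr1 // lt0r_neq0.
  by rewrite [leLHS]E; apply: ge0_ler_powR; rewrite ?nnegrE ?powR_ge0 ?(ltW e0) ?(ltW (p_gt0 j)).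
exists (\prod_(j < J0) c j).
  by apply: prodr_gt0 => j _; rewrite (lt_le_trans _ (c1 _)).
move=> X k; have [J hJ] := ev_supp k.
have hJm j : (maxn J J0 <= j)%N -> ev k j = 0%N by rewrite geq_max => /andP[/hJ].
apply: (@le_trans _ _ (\sum_(0 <= d < N X | dvdx d k) 1)).
  by rewrite (le_trans (ler_norm_sum _ _ _)) // ler_sum // => d _; exact: mob_le1.
rewrite -(natr_sum _ _ _ (fun=> 1%N)).
apply: (@le_trans _ _ (\prod_(j < maxn J J0) (ev k j).+1)%:R).
  by rewrite ler_nat card_divisors.
rewrite (nE hJm) natr_prod.
have [_ ->] : 0 <= \prod_(j < maxn J J0) p j ^+ ev k j /\
    (\prod_(j < maxn J J0) p j ^+ ev k j) `^ eps = \prod_(j < maxn J J0) (p j ^+ ev k j) `^ eps.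
  elim/big_rec2 : _ => [|j y x _ [x0 <-]]; first by rewrite powR1.
  have q0 : 0 <= p j ^+ ev k j by rewrite exprn_ge0 // ltW.
  by split; [rewrite mulr_ge0|rewrite powRM].
have -> : \prod_(j < J0) c j = \prod_(j < maxn J J0) c j.
  rewrite -!(big_mkord xpredT c) [RHS](big_cat_nat (n := J0)) ?leq_maxr //=.
  rewrite [X in _ * X]big_nat_cond [X in _ * X]big1 ?mulr1 // => j /andP[/andP[+ _] _].
  exact: cJ.
rewrite -big_split /=; apply: ler_prod => j _; rewrite ler0n /=; exact: key.
Qed.

End FreeMonoid.

(** * The zeta function of a Beurling system *)

Section ZetaSeries.
Variables (R : realType) (n : nat -> R) (N : R -> nat) (A theta K : R).
Hypothesis n_ge1 : forall k, 1 <= n k.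
Hypothesis NP : forall k x, (n k <= x) = (k < N x)%N.
Hypothesis theta_lt1 : theta < 1.
Hypothesis A_gt0 : 0 < A.
Hypothesis N_asymp : forall x, 1 <= x -> `|(N x)%:R - A * x| <= K * x `^ theta.
Variable W : R[i] -> R[i].
Hypothesis W_approx : forall s, theta < Re s -> forall x, 1 <= x ->
  cabs (W s - (s - 1) * partial_zeta n (N x) s - A%:C * cpw x (1 - s))
    <= cabs (s - 1) * ((cabs s / (Re s - theta) + 1) * K * x `^ (theta - Re s)).

(** [is_zeta] sums by index, Abel summation by value. Between k and N(n_k) only terms of the same
    value n_k remain, at most N(x) x^(-Re s) <= (A + K) x^(1 - Re s) in total with x = n_k. *)
Lemma partial_zeta_cvg s : 1 < Re s -> forall e : R, 0 < e ->
  exists k0, forall k, (k0 <= k)%N -> cabs (partial_zeta n k s - W s / (s - 1)) <= e.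
Proof.
move=> s1 e e0; have ts : theta < Re s := lt_trans theta_lt1 s1.
have n_gt0 k : 0 < n k := lt_le_trans ltr01 (n_ge1 k).
have n_mono i j : (i <= j)%N -> n i <= n j.
  by move=> ij; rewrite NP (leq_ltn_trans ij) // -NP.
have K0 : 0 <= K.
  by have := le_trans (normr_ge0 _) (N_asymp (lexx 1)); rewrite powR1 mulr1.
have s10 : s - 1 != 0.
  by apply: contraTneq s1 => /eqP; rewrite subr_eq0 => /eqP ->; rewrite ltxx.
have cs0 : 0 < cabs (s - 1) by rewrite cabs_gt0.
pose c := (cabs s / (Re s - theta) + 1) * K.
have c0 : 0 <= c by rewrite mulr_ge0 // addr_ge0 // divr_ge0 ?cabs_ge0 // subr_ge0 ltW.
pose C := A + K + A / cabs (s - 1) + c.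
have C0 : 0 < C.
  by rewrite /C !ltr_wpDr // divr_ge0 // ltW.
have s10' : 0 < Re s - 1 by rewrite subr_gt0.
have [M M1 hM] := powR_small s10' (divr_gt0 e0 C0).
exists (N M) => k hk; set x := n k.
have Mx : M <= x by rewrite leNgt; apply/negP => /ltW; rewrite NP ltnNge hk.
have x1 : 1 <= x := n_ge1 k; have x0 := n_gt0 k; rewrite -/x in x0.
have px := hM _ Mx; rewrite opprB in px; set P := x `^ (1 - Re s) in px.
have P0 : 0 <= P by exact: powR_ge0.
have kN : (k <= N x)%N by rewrite ltnW // -NP.
have tail : cabs (partial_zeta n (N x) s - partial_zeta n k s) <= (A + K) * P.
  rewrite /partial_zeta -!(big_mkord xpredT (fun j => cpw (n j) (- s))).
  rewrite (big_cat_nat (n := k)) //= [X in cabs (X - _)]addrC addrK (le_trans (cabs_sum _ _ _)) //.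
  apply: (@le_trans _ _ (\sum_(k <= j < N x) x `^ (- Re s))).
    rewrite big_nat_cond [leRHS]big_nat_cond ler_sum // => j /andP[/andP[kj _] _].
    rewrite cabs_cpw // ReN powR_le_anti ?n_mono // oppr_le0; lra.
  rewrite sumr_const_nat -mulr_natl.
  apply: (@le_trans _ _ ((N x)%:R * x `^ (- Re s))).
    by rewrite ler_wpM2r ?powR_ge0 // ler_nat leq_subr.
  have h := N_asymp x1; have : (N x)%:R <= (A + K) * x.
    have : x `^ theta <= x by rewrite -[leRHS]powRr1 ?(ltW x0) // ler_powR // ltW.
    move: h; rewrite ler_norml => /andP[_ h] hx.
    have := ler_wpM2l K0 hx; lra.
  move=> hN; apply: le_trans (ler_wpM2r (powR_ge0 _ _) hN) _.
  by rewrite /P powRDp // powRr1 ?(ltW x0) // mulrA.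
have := W_approx ts x1; rewrite -/c => h.
have h2 : cabs (W s / (s - 1) - partial_zeta n (N x) s) <= A / cabs (s - 1) * P + c * P.
  rewrite -(ler_pM2r cs0) -cabsM mulrBl divfK // [partial_zeta _ _ _ * _]mulrC.
  rewrite -(subrK (A%:C * cpw x (1 - s)) (_ - _)).
  apply: le_trans (cabsD _ _) _; rewrite (cabsM A%:C) cabs_cpw // cabs_real gtr0_norm //.
  rewrite ReD ReN /= -/P; rewrite [leRHS](_ : _ = cabs (s - 1) * (c * P) + A * P); last first.
    by field; rewrite gt_eqF.
  rewrite lerD2r (le_trans h) // ler_wpM2l ?cabs_ge0 // ler_wpM2l //.
  by rewrite ler_powR // lerD2r ltW.
apply: le_trans (cabs_tri _ (partial_zeta n (N x) s) _) _.
rewrite (cabs_distC (partial_zeta n k s)) (cabs_distC (partial_zeta n (N x) s) (W s / _)).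
apply: le_trans (lerD tail h2) _.
rewrite [leLHS](_ : _ = C * P); last by rewrite /C; ring.
by rewrite mulrC -ler_pdivlMr.
Qed.

End ZetaSeries.

Section BeurlingZeta.
Variables (R : realType) (S : beurling_system R) (A theta K : R).
Hypothesis A_gt0 : 0 < A.
Hypothesis theta_ge0 : 0 <= theta.
Hypothesis theta_lt1 : theta < 1.
Hypothesis N_asymp : forall x, 1 <= x -> `|(counting_fun S x)%:R - A * x| <= K * x `^ theta.

Local Notation n := (gint S).
Local Notation N := (counting_fun S).

(** [fset_set] sends an infinite set to the empty one, so an infinite set here would make N vanish
    from some point on, against N(z) = A z + O(z^theta). *)
Lemma gint_finite x : finite_set [set k | n k <= x].
Proof.
apply: contrapT => inf; pose y := Num.max 1 x.
have K0 : 0 <= K.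
  by have := le_trans (normr_ge0 _) (N_asymp (lexx 1)); rewrite powR1 mulr1.
have N0 z : y <= z -> N z = 0%N.
  rewrite ge_max => /andP[_ xz]; rewrite /counting_fun /fset_set.
  case: pselect => [fz|_]; last by rewrite cardfs0.
  by case: inf; apply: sub_finite_set fz => k /= /le_trans; apply.
have t1 : 0 < 1 - theta by rewrite subr_gt0.
have K1 : 0 < K + 1 by lra.
have [M M1 hM] := powR_small t1 (divr_gt0 A_gt0 K1).
pose z := Num.max y M.
have z1 : 1 <= z by rewrite le_max le_max lexx.
have z0 := lt_le_trans ltr01 z1.
have := hM z; rewrite le_max lexx orbT => /(_ isT); rewrite opprB => hz.
have := N_asymp z1; rewrite N0; last by rewrite le_max lexx.
rewrite mulr0n sub0r normrN gtr0_norm ?mulr_gt0 //.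
have -> : z `^ theta = z `^ (theta - 1) * z.
  by rewrite -[X in _ * X](powRr1 (ltW z0)) -powRDp // subrK.
rewrite mulrA ler_pM2r //.
have := powR_gt0 (theta - 1) z0; move: hz; rewrite ler_pdivlMr //.
set q := z `^ _ => h1 h2 h3; lra.
Qed.

Lemma gint_leP k x : (n k <= x) = (k < N x)%N.
Proof.
have fin := gint_finite x.
have [m hm] : exists m, ~~ (n m <= x).
  apply: contrapT => h; apply: (@infinite_nat); move: fin; congr finite_set.
  apply/seteqP; split=> // j _ /=; apply: contrapT => hj.
  by apply: h; exists j; apply/negP.
have ex : exists m, ~~ (n m <= x) by exists m.
pose m0 := ex_minn ex.
have E j : (n j <= x) = (j < m0)%N.
  rewrite /m0; case: ex_minnP => i hi imin; apply/idP/idP => h.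
    rewrite ltnNge; apply: contraNN hi => ij; apply: le_trans h.
    exact: gint_nondecreasing.
  by apply: contraTT h => /imin; rewrite -leqNgt.
rewrite E /counting_fun (_ : [set k | n k <= x] = `I_m0); last first.
  by apply/seteqP; split=> j /=; rewrite E.
rewrite fset_set_II card_imfset /=; last exact: val_inj.
by rewrite -cardE card_ord.
Qed.

Lemma fset_iota_sum (f : nat -> R) x :
  \sum_(k \in [set k | n k <= x]) f k = \sum_(0 <= k < N x) f k.
Proof.
rewrite /index_iota subn0 (fsbig_seq _ _ (iota_uniq _ _)) /=; apply: eq_fsbigl.
by apply/seteqP; split=> k /=; rewrite mem_iota add0n gint_leP.
Qed.

(** Trades [fsfun] for plain functions with bounded support, the interface of the free monoid
    section. *)
Lemma exponents_ex : exists ev : nat -> nat -> nat,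
  [/\ forall k, exists J, forall j, (J <= j)%N -> ev k j = 0%N,
      forall (v : nat -> nat) J, (forall j, (J <= j)%N -> v j = 0%N) ->
        exists k, forall j, ev k j = v j,
      forall k l, (forall j, ev k j = ev l j) -> k = l &
      forall k J, (forall j, (J <= j)%N -> ev k j = 0%N) ->
        n k = \prod_(j < J) gprime S j ^+ ev k j].
Proof.
have [e [[e' eK e'K] eE]] := gint_products S.
exists (fun k j => e k j); split.
- move=> k; exists (\max_(j <- finsupp (e k)) j).+1 => j hj.
  apply: fsfun_dflt; apply: contraTN hj => jk; rewrite -ltnNge ltnS.
  by apply: (@leq_bigmax_seq _ _ xpredT id).
- move=> v J hv; exists (e' [fsfun j in [fset i | i in iota 0 J]%fset => v j]) => j.
  rewrite e'K fsfunE; case: ifPn => // hj; rewrite hv // leqNgt; apply: contraNN hj => jJ.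
  by rewrite in_fset /= mem_iota.
- by move=> k l h; apply: (can_inj eK); apply/fsfunP.
- move=> k J hJ; rewrite eE -(big_mkord xpredT (fun j => gprime S j ^+ e k j)).
  rewrite [RHS](bigID (mem (finsupp (e k)))) /= [X in _ = _ * X]big1 ?mulr1; last first.
    by move=> j hj; rewrite fsfun_dflt.
  rewrite -[RHS]big_filter; apply: perm_big; apply: uniq_perm.
  + exact: fset_uniq.
  + by rewrite filter_uniq // iota_uniq.
  move=> j; rewrite mem_filter mem_index_iota leq0n /= ltnNge andb_idr // => jk.
  by apply: contraTN jk => /hJ h; rewrite memNfinsupp h.
Qed.

Lemma gprime_infty M : exists J, forall j, (J <= j)%N -> M <= gprime S j.
Proof.
have /cvgryPge/(_ M)[J _ hJ] := @gprime_cvg _ S.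
by exists J => j /hJ.
Qed.

Let n_ge1 k : 1 <= n k.
Proof.
have [ev [h1 h2 h3 h4]] := exponents_ex.
by apply: (gint_ge1 _ h1 h4); exact: gprime_gt1.
Qed.

Lemma cpowE (x : R) (s : R[i]) : 0 < x -> cpow x s = cpw x s.
Proof.
move=> x0; rewrite /cpow /cpw cexpE ReM ImM /= !mulr0 subr0 add0r /powR gt_eqF //.
by apply: complex_eq; rewrite ?ReM ?ImM /=; ring.
Qed.

Lemma is_zeta_diff (Z : R[i] -> R[i]) s : is_zeta S theta Z -> theta < Re s -> s != 1 -> cdiff Z s.
Proof. by move=> [_ h] ts s1; apply/derivableP1; exact: (nbhs_singleton (h s ts s1)). Qed.

(** Zeros of the difference propagate leftwards from Re > 1 by a chain of discs along a horizontal
    line. Only lines with Im != 0 are followed, which avoids the puncture at 1; real points follow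
    by continuity. *)
Lemma is_zeta_unique (Z1 Z2 : R[i] -> R[i]) s : is_zeta S theta Z1 -> is_zeta S theta Z2 ->
  theta < Re s -> s != 1 -> Z1 s = Z2 s.
Proof.
move=> h1 h2; pose D z := Z1 z - Z2 z.
have dD z : theta < Re z -> z != 1 -> cdiff D z.
  by move=> tz z1; apply: cdiffB; apply: is_zeta_diff.
have D1 z : 1 < Re z -> D z = 0.
  move=> z1; apply/eqP; rewrite subr_eq0; apply/eqP.
  exact: (cvg_unique _ (h1.1 z z1) (h2.1 z z1)).
have Dt z : theta < Re z -> Im z != 0 -> D z = 0.
  (* [d] is so small that the discs stay in Re > theta and off the real axis, hence off 1. *)
  move=> tz t0; pose t := Im z; pose d : R := Num.min `|t| (Re z - theta) / 2.
  have d0 : 0 < d by rewrite divr_gt0 // lt_min normr_gt0 t0 subr_gt0.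
  have dt : d * 2 <= `|t| by rewrite divfK // ge_min lexx.
  have dz : d * 2 <= Re z - theta by rewrite divfK // ge_min lexx orbT.
  suff chain k u : Re z <= u -> 2 - k%:R * (d / 4) <= u -> cnear (u +i* t) (fun w => D w = 0).
    have [k hk] : exists k : nat, 2 - k%:R * (d / 4) <= Re z.
      have d4 : 0 < d / 4 by rewrite divr_gt0.
      exists (Num.bound (`|2 - Re z| / (d / 4))).
      have := archi_boundP (divr_ge0 (normr_ge0 (2 - Re z)) (ltW d4)).
      rewrite ltr_pdivrMr // => h; have := ler_norm (2 - Re z); lra.
    have := cnear_point (chain k (Re z) (lexx _) hk); congr (D _ = 0).
    by apply: complex_eq.
  elim: k u => [|k IHk] u zu.
    rewrite mul0r subr0 => u2; apply: cnearS (@cnear_Re_gt _ (u +i* t) 1 _) => [w|]; first exact: D1.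
    by rewrite /=; lra.
  rewrite -natr1 => hu.
  have near : cnear ((u + d / 4) +i* t) (fun w => D w = 0) by apply: IHk; lra.
  exists (d / 8); first by rewrite divr_gt0.
  move=> w wd; apply: (@zero_propagates _ D w (d / 2) ((u + d / 4) +i* t)) => //.
    move=> v vw; have vu : cabs (v - u +i* t) < d.
      apply: le_lt_trans (cabs_tri _ w _) _; lra.
    have hre := le_lt_trans (Re_le_cabs _) vu; have him := le_lt_trans (Im_le_cabs _) vu.
    move: hre him; rewrite ReD ReN ImD ImN /= !ltr_norml => /andP[r1 r2] him.
    apply: dD; first lra.
    apply: contraTneq him => -> /=; rewrite sub0r; apply/negP => /andP[i1 i2].
    by have := dt; rewrite leNgt; case: ler0P => ? /negP; apply; lra.
  apply: le_lt_trans (cabs_tri _ (u +i* t) _) _.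
  rewrite (_ : (u + d / 4) +i* t - u +i* t = (d / 4)%:C); last first.
    by apply: complex_eq; rewrite !(ReD, ImD, ReN, ImN) /=; ring.
  have wd2 : cabs (u +i* t - w) < d / 8 by rewrite cabs_distC.
  rewrite cabs_real (gtr0_norm (divr_gt0 d0 (ltr0n _ 4))).
  move: wd2; set q := cabs _; lra.
move=> ts s1; apply/eqP; rewrite -subr_eq0 -[_ - _]/(D s).
have [s0|] := eqVneq (Im s) 0; last by move=> /(Dt s ts) ->.
rewrite -cabs_eq0 eq_le cabs_ge0 andbT; apply/ler_addgt0Pr => e e0; rewrite add0r.
have [d d0 hd] := cdiff_cont (dD s ts s1) e0.
have := hd (Re s +i* (d / 2)).
rewrite (Dt (Re s +i* (d / 2))) //=; last by rewrite gt_eqF // divr_gt0.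
rewrite sub0r cabsN (_ : Re s +i* (d / 2) - s = 0 +i* (d / 2)); last first.
  by apply: complex_eq; rewrite !(ReD, ImD, ReN, ImN) /= ?s0; ring.
rewrite /cabs /= expr0n add0r sqrtr_sqr -/(cabs _) gtr0_norm ?divr_gt0 // => h.
by apply/ltW/h; lra.
Qed.

(** [zeta] is picked by [xget] among all continuations; W(s) / (s - 1) is one of them, and
    uniqueness identifies the two. *)
Lemma zeta_contP : exists W : R[i] -> R[i], [/\ forall s, theta < Re s -> cdiff W s,
  forall s, theta < Re s -> s != 1 -> zeta S theta s = W s / (s - 1) &
  forall s, theta < Re s -> forall x, 1 <= x ->
    cabs (W s - (s - 1) * partial_zeta n (N x) s - A%:C * cpw x (1 - s))
    <= cabs (s - 1) * ((cabs s / (Re s - theta) + 1) * K * x `^ (theta - Re s))].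
Proof.
have [W hW] := zeta_cont_ex n_ge1 gint_leP theta_ge0 N_asymp.
have W_approx s ts x x1 := (hW s ts).2 x x1.
exists W; split => // [s /hW[] //|].
have z : is_zeta S theta (fun s => W s / (s - 1)).
  split=> [s s1|s ts s1].
    apply/cvgrPdist_le => e; rewrite ltcE /= => /andP[/eqP ei er].
    have [k0 hk] := partial_zeta_cvg n_ge1 gint_leP theta_lt1 A_gt0 N_asymp W_approx s1 er.
    exists k0 => // k /hk; rewrite normE lecE /= ei eqxx /= cabs_distC.
    rewrite /partial_zeta /series /= big_mkord; congr (cabs (_ - _) <= _).
    by apply: eq_bigr => j _; rewrite cpowE // (lt_le_trans ltr01).
  apply/cnbhsP; apply: cnearS (cnearI (cnear_Re_gt ts) (cnear_neq s1)) => w [tw w1].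
  by apply/derivableP1; apply: cdiff_div_sub1 => //; case: (hW w tw).
move=> s ts s1; exact: (is_zeta_unique (xgetPex _ (ex_intro _ _ z)) z ts s1).
Qed.

End BeurlingZeta.

(** * A discrete mean value theorem *)

Section MeanValue.
Variable R : realType.

(** Schur's test for a kernel that depends only on labels: with B_i the sum of f over label i, B_i
    B_j <= (B_i^2 + B_j^2) / 2 and the row sums bound the form; B_i^2 is then expanded into pairs of
    equal label. *)
Lemma schur_labels (D : nat) (Q : finType) (f : 'I_D -> R) (g : 'I_D -> Q)
    (w : Q -> Q -> R) (rho : Q -> R) :
  (forall k, 0 <= f k) -> (forall i j, 0 <= w i j) -> (forall i j, w i j = w j i) ->
  (forall i, \sum_j w i j <= rho i) ->
  \sum_k \sum_l f k * f l * w (g k) (g l) <= \sum_k \sum_(l | g l == g k) rho (g k) * (f k * f l).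
Proof.
move=> f0 w0 wC hrho; pose B i := \sum_(k | g k == i) f k.
have -> : \sum_k \sum_(l | g l == g k) rho (g k) * (f k * f l) = \sum_i rho i * B i ^+ 2.
  rewrite (partition_big g xpredT) //=; apply: eq_bigr => i _.
  rewrite expr2 [X in _ * (X * _)]/B mulr_suml mulr_sumr; apply: eq_bigr => k /eqP ->.
  by rewrite -mulr_sumr -mulr_sumr.
have -> : \sum_k \sum_l f k * f l * w (g k) (g l) = \sum_i \sum_j B i * B j * w i j.
  rewrite (partition_big g xpredT) //=; apply: eq_bigr => i _.
  transitivity (\sum_(k | g k == i) \sum_j f k * (B j * w i j)).
    apply: eq_bigr => k /eqP gk; rewrite (partition_big g xpredT) //=.
    apply: eq_bigr => j _; rewrite [B j * _]mulr_suml mulr_sumr; apply: eq_bigr => l /eqP gl.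
    by rewrite gk gl mulrA.
  rewrite exchange_big /=; apply: eq_bigr => j _.
  by rewrite -mulr_suml mulrA.
apply: (@le_trans _ _ (\sum_i \sum_j (B i ^+ 2 / 2 + B j ^+ 2 / 2) * w i j)).
  apply: ler_sum => i _; apply: ler_sum => j _; rewrite ler_wpM2r //.
  have := sqr_ge0 (B i - B j); rewrite !expr2; lra.
have -> : \sum_i \sum_j (B i ^+ 2 / 2 + B j ^+ 2 / 2) * w i j = \sum_i B i ^+ 2 * \sum_j w i j.
  transitivity (\sum_i \sum_j B i ^+ 2 / 2 * w i j + \sum_i \sum_j B j ^+ 2 / 2 * w i j).
    rewrite -big_split /=; apply: eq_bigr => i _; rewrite -big_split /=.
    by apply: eq_bigr => j _; rewrite mulrDl.
  rewrite [X in _ + X]exchange_big /= -big_split /=; apply: eq_bigr => i _.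
  rewrite mulr_sumr -big_split /=; apply: eq_bigr => j _.
  by rewrite (wC j i) -mulrDl -splitr.
by apply: ler_sum => i _; rewrite mulrC ler_wpM2r // sqr_ge0.
Qed.

(** The inequality 2 f_k f_l <= f_k^2 + f_l^2 leaves the size of a label class as weight; this size
    becomes the factor chi. *)
Lemma sum_same_label (D : nat) (Q : finType) (f : 'I_D -> R) (g : 'I_D -> Q) (rho : Q -> R) :
  (forall i, 0 <= rho i) ->
  \sum_k \sum_(l | g l == g k) rho (g k) * (f k * f l) <=
  \sum_k rho (g k) * f k ^+ 2 * (\sum_(l | g l == g k) 1)%N%:R.
Proof.
move=> rho0.
apply: (@le_trans _ _ (\sum_k \sum_(l | g l == g k)
    (rho (g k) * f k ^+ 2 / 2 + rho (g l) * f l ^+ 2 / 2))).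
  apply: ler_sum => k _; apply: ler_sum => l /eqP ->; rewrite -!mulrA -mulrDr ler_wpM2l //.
  have := sqr_ge0 (f k - f l); rewrite !expr2; lra.
have -> : \sum_k \sum_(l | g l == g k) (rho (g k) * f k ^+ 2 / 2 + rho (g l) * f l ^+ 2 / 2) =
    \sum_k \sum_(l | g l == g k) rho (g k) * f k ^+ 2 / 2 +
    \sum_k \sum_(l | g l == g k) rho (g l) * f l ^+ 2 / 2.
  by rewrite -big_split /=; apply: eq_bigr => k _; rewrite big_split.
rewrite [X in _ + X](exchange_big_dep xpredT) //= -big_split /=.
apply: ler_sum => k _; rewrite [X in _ + X](eq_bigl (fun l => g l == g k)); last first.
  by move=> l; rewrite eq_sym.
by rewrite -big_split /= (eq_bigr (fun=> rho (g k) * f k ^+ 2)) => [|l _];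
  [rewrite sum1_card sumr_const mulr_natr|rewrite -splitr].
Qed.

(** (1 + |i - j|)^(-2): with truncated subtraction, (i - j) + (j - i) is the distance. *)
Definition fejer (i j : nat) : R := ((1 + (i - j) + (j - i))%N%:R ^+ 2)^-1.

Lemma fejer_ge0 i j : 0 <= fejer i j.
Proof. by rewrite invr_ge0 exprn_ge0. Qed.

Lemma fejerC i j : fejer i j = fejer j i.
Proof. by rewrite /fejer addnAC. Qed.

Lemma fejer_sum (i m : nat) : \sum_(0 <= j < m) fejer i j <= 3.
Proof.
(* Both invariants telescope by (q + 1)^(-2) <= 1 / q - 1 / (q + 1); each side of the diagonal and
   the diagonal itself contribute at most 1. *)
suff [h1 h2] : ((m <= i)%N -> \sum_(0 <= j < m) fejer i j <= (i - m).+1%:R^-1) /\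
    ((i < m)%N -> \sum_(0 <= j < m) fejer i j <= 3 - (m - i)%:R^-1).
  have [mi|im] := leqP m i.
    apply: le_trans (h1 mi) _; apply: (@le_trans _ _ 1); last by rewrite (ler_nat _ 1 3).
    by rewrite invf_le1 // ler1n.
  by apply: le_trans (h2 im) _; rewrite gerBl invr_ge0.
elim: m => [|m [IH1 IH2]].
  by rewrite big_geq //; split => // _; rewrite invr_ge0.
rewrite big_nat_recr //=; split=> [mi|]; last rewrite ltnS leq_eqVlt => /orP[/eqP im|im].
- have {}IH1 := IH1 (ltnW mi).
  have [q q0 iE] : exists2 q, (0 < q)%N & i = (m + q)%N by exists (i - m)%N; lia.
  rewrite iE in IH1 *; rewrite /fejer (_ : (1 + (m + q - m) + (m - (m + q)) = q.+1)%N); last by lia.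
  rewrite (_ : (m + q - m.+1).+1 = q); last by lia.
  rewrite (_ : (m + q - m) = q)%N in IH1; last by lia.
  rewrite -natr1 in IH1 *; have Q0 : 0 < q%:R :> R by rewrite ltr0n.
  apply: le_trans (lerD IH1 (lexx _)) _; rewrite -subr_ge0.
  rewrite [X in 0 <= X](_ : _ = (q%:R * (q%:R + 1) ^+ 2)^-1); last by field; rewrite !gt_eqF //; lra.
  by rewrite invr_ge0 mulr_ge0 ?(ltW Q0) // sqr_ge0.
- rewrite -im in IH1 *; rewrite /fejer subnn addn0 expr1n invr1 subSn // subnn.
  by apply: le_trans (lerD (IH1 (leqnn _)) (lexx _)) _; rewrite subnn; lra.
- have {}IH2 := IH2 im.
  have [q q0 mE] : exists2 q, (0 < q)%N & m = (i + q)%N by exists (m - i)%N; lia.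
  rewrite mE in IH2 *; rewrite /fejer (_ : (1 + (i - (i + q)) + (i + q - i) = q.+1)%N); last by lia.
  rewrite (_ : ((i + q).+1 - i) = q.+1)%N; last by lia.
  rewrite (_ : (i + q - i) = q)%N in IH2; last by lia.
  rewrite -natr1; have Q0 : 0 < q%:R :> R by rewrite ltr0n.
  apply: le_trans (lerD IH2 (lexx _)) _; rewrite -subr_ge0.
  rewrite [X in 0 <= X](_ : _ = (q%:R * (q%:R + 1) ^+ 2)^-1); last by field; rewrite !gt_eqF //; lra.
  by rewrite invr_ge0 mulr_ge0 ?(ltW Q0) // sqr_ge0.
Qed.

Lemma sin_le (x : R) : 0 <= x -> sin x <= x.
Proof.
move=> x0; have cs : {within `[0, x], continuous (@sin R)}.
  by apply: continuous_subspaceT => y; exact: continuous_sin.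
have [c /itvP cx] := MVT_segment x0 (fun y _ => is_derive_sin y) cs.
by rewrite sin0 !subr0 => ->; rewrite ler_piMl // cos_le1.
Qed.

Lemma sin_ge_half (x : R) : 0 <= x <= 1 / 2 -> x / 2 <= sin x.
Proof.
move=> /andP[x0 x2].
have cosge (y : R) : 0 <= y <= 1 / 2 -> 1 / 2 <= cos y.
  move=> /andP[y0 y2]; have cs : {within `[0, y], continuous (@cos R)}.
    by apply: continuous_subspaceT => z; exact: continuous_cos.
  have [c /itvP cy] := MVT_segment y0 (fun z _ => is_derive_cos z) cs.
  rewrite cos0 subr0 => h; have c0 : 0 <= c by rewrite cy.
  have cy' : c <= y by rewrite cy.
  have := sin_le c0; nra.
have cs : {within `[0, x], continuous (@sin R)}.
  by apply: continuous_subspaceT => y; exact: continuous_sin.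
have [c /itvP cx] := MVT_segment x0 (fun y _ => is_derive_sin y) cs.
rewrite sin0 !subr0 => ->; have := cosge c; rewrite cx (le_trans _ x2) ?cx //= => /(_ isT).
nra.
Qed.

Lemma expR_le_line (x : R) : 0 <= x <= 1 -> expR x <= 1 + expR 1 * x.
Proof.
move=> /andP[x0 x1]; have cs : {within `[0, x], continuous (@expR R)}.
  by apply: continuous_subspaceT => y; exact: continuous_expR.
have [c /itvP cx] := MVT_segment x0 (fun y _ => is_derive_expR y) cs.
rewrite expR0 subr0 => h; have : expR c * x <= expR 1 * x.
  by rewrite ler_wpM2r // ler_expR (le_trans _ x1) // cx.
lra.
Qed.

Lemma cexp_sub1_ge (y : R) : `|y| <= 1 / 2 -> `|y| / 2 <= cabs (cexp (0 +i* y) - 1).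
Proof.
move=> y2; apply: le_trans (Im_le_cabs _).
rewrite ImD ImN cexpE /= expR0 mul1r subr0.
have [y0|/ltW y0] := leP 0 y.
  rewrite (ger0_norm y0) in y2 *.
  by apply: le_trans (ler_norm _); rewrite sin_ge_half // y0.
rewrite (ler0_norm y0) in y2 *; rewrite -[X in _ <= X]normrN -sinN.
by apply: le_trans (ler_norm _); rewrite sin_ge_half // oppr_ge0 y0.
Qed.

Lemma geom_cabs (v : R[i]) m : cabs v = 1 -> cabs (\sum_(a < m) v ^+ a) <= m%:R.
Proof.
move=> v1; apply: le_trans (cabs_sum _ _ _) _.
rewrite (eq_bigr (fun=> 1)) => [|a _]; last by rewrite cabsX v1 expr1n.
by rewrite sumr_const card_ord.
Qed.

Lemma geom_cabs2 (v : R[i]) m : cabs v = 1 -> cabs (v - 1) * cabs (\sum_(a < m) v ^+ a) <= 2.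
Proof.
move=> v1; rewrite -cabsM -subrX1; apply: le_trans (cabsB _ _) _.
by rewrite cabsX v1 expr1n cabs1.
Qed.

Section Form.
Variables (D J : nat) (b u : 'I_D -> R[i]).
Hypothesis u1 : forall k, cabs (u k) = 1.

(** Each power m < J is a difference a - c of at least J pairs with a, c < 2 J. Summing over the
    whole square of pairs makes the kernel the squared modulus of a geometric sum, whose quadratic
    decay gives bounded row sums without a logarithm. *)
Lemma mean_square_form : J%:R * \sum_(m < J) cabs (\sum_k b k * u k ^+ m) ^+ 2 <=
  \sum_k \sum_l cabs (b k) * cabs (b l) * cabs (\sum_(a < J + J) (u k * conjc (u l)) ^+ a) ^+ 2.
Proof.
pose G a c := \sum_k b k * (u k ^+ a * conjc (u k) ^+ c).
have uu k : u k * conjc (u k) = 1 by rewrite -cabs_sqrE u1 expr1n.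
have GE m c : G (m + c)%N c = \sum_k b k * u k ^+ m.
  by apply: eq_bigr => k _; rewrite exprD -mulrA -exprMn uu expr1n mulr1.
apply: (@le_trans _ _ (\sum_(c < J + J) \sum_(a < J + J) cabs (G a c) ^+ 2)).
  rewrite -!(big_mkord xpredT (fun c => \sum_(a < J + J) cabs (G a c) ^+ 2)).
  rewrite (big_cat_nat (n := J)) ?leq_addr //=.
  rewrite -[leLHS]addr0 lerD //; last first.
    by apply: sumr_ge0 => c _; apply: sumr_ge0 => a _; rewrite sqr_ge0.
  rewrite mulr_natl -[J in _ *+ J]subn0 -sumr_const_nat.
  rewrite !big_mkord; apply: ler_sum => c _; have cJ := ltn_ord c.
  rewrite -(big_mkord xpredT (fun a => cabs (G a c) ^+ 2)).
  rewrite (big_cat_nat (n := c)) //=; last by lia.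
  rewrite [X in _ + X](big_cat_nat (n := (J + c)%N)) //=; try lia.
  rewrite -[leLHS]add0r lerD //; first by apply: sumr_ge0 => a _; rewrite sqr_ge0.
  rewrite -[leLHS]addr0 lerD //; last by apply: sumr_ge0 => a _; rewrite sqr_ge0.
  rewrite -{1}[val c]add0n big_addn addnK big_mkord ler_sum // => m _.
  by rewrite GE.
pose dd k l := \sum_(a < J + J) (u k * conjc (u l)) ^+ a.
set L := \sum_(_ < _) _.
have LE : L%:C = \sum_k \sum_l b k * conjc (b l) * (dd k l * conjc (dd k l)).
  pose T k l (a c : 'I_(J + J)) := b k * conjc (b l) *
    ((u k * conjc (u l)) ^+ a * conjc ((u k * conjc (u l)) ^+ c)).
  transitivity (\sum_(c < J + J) \sum_(a < J + J) \sum_k \sum_l T k l a c).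
    rewrite /L rmorph_sum; apply: eq_bigr => c _; rewrite rmorph_sum; apply: eq_bigr => a _.
    rewrite /= cabs_sqrE /G rmorph_sum big_distrlr /=; apply: eq_bigr => k _; apply: eq_bigr => l _.
    by rewrite /T !(rmorphM, rmorphXn) /= !conjcK !exprMn; ring.
  transitivity (\sum_k \sum_l \sum_(c < J + J) \sum_(a < J + J) T k l a c).
    rewrite (eq_bigr (fun c => \sum_k \sum_l \sum_(a < J + J) T k l a c)) => [|c _]; last first.
      by rewrite exchange_big; apply: eq_bigr => k _; rewrite exchange_big.
    by rewrite exchange_big; apply: eq_bigr => k _; rewrite exchange_big.
  apply: eq_bigr => k _; apply: eq_bigr => l _.
  rewrite /dd rmorph_sum big_distrlr /= exchange_big mulr_sumr; apply: eq_bigr => c _.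
  by rewrite mulr_sumr.
apply: le_trans (ler_norm _) _; rewrite -cabs_real LE.
have conjabs (z : R[i]) : cabs (conjc z) = cabs z by apply: complexI; rewrite -!normE normcJ.
apply: le_trans (cabs_sum _ _ _) _; apply: ler_sum => k _.
apply: le_trans (cabs_sum _ _ _) _; apply: ler_sum => l _.
by rewrite !cabsM !conjabs expr2.
Qed.

End Form.

(** A large sieve with two Schur tests: between bins of ln n of width 1 / (J h), where the kernel
    decays quadratically, and inside a bin, between unit cells of n. The bound h ln n <= 1 / 2 keeps
    all phase differences below 1 / 2, which prevents aliasing. *)
Lemma discrete_mean_value : exists2 C : R, 0 < C &
  forall (D J : nat) (h : R) (b : 'I_D -> R[i]) (n : 'I_D -> R),
  (0 < J)%N -> 0 < h -> 1 <= J%:R * h -> (forall k, 1 <= n k) ->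
  (forall k, h * ln (n k) <= 1 / 2) ->
  \sum_(m < J) cabs (\sum_k b k * cexp (0 +i* - (h * ln (n k))) ^+ m) ^+ 2 <=
  C * \sum_k (expR 1 * n k / h + 2 * J%:R) * cabs (b k) ^+ 2 *
    \sum_(l | `|n k - n l| <= 1) 1.
Proof.
exists 432; first by rewrite ltr0n.
move=> D J h b n J0 h0 Jh n1 hn; set u := fun k => cexp (0 +i* - (h * ln (n k))).
have u1 k : cabs (u k) = 1 by rewrite cabs_cexp expR0.
have Jp : 0 < J%:R :> R by rewrite ltr0n.
have Jh0 : 0 < J%:R * h by rewrite mulr_gt0.
have l0 k : 0 <= ln (n k) by rewrite ln_ge0.
pose bin k := Num.truncn (J%:R * h * ln (n k)).
have binP k : (bin k)%:R <= J%:R * h * ln (n k) < (bin k).+1%:R.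
  by apply: truncn_itv; rewrite mulr_ge0 // ltW.
have ker k l : cabs (\sum_(a < J + J) (u k * conjc (u l)) ^+ a) ^+ 2 <=
    144 * J%:R ^+ 2 * fejer (bin k) (bin l).
  set v := u k * _; pose yy := h * (ln (n l) - ln (n k)).
  have vE : v = cexp (0 +i* yy).
    rewrite /v /u; apply: complex_eq; rewrite ?ReM ?ImM !cexpE /= expR0 !mul1r !cosN !sinN /yy.
      by rewrite mulrBr cosB; ring.
    by rewrite mulrBr sinB; ring.
  have v1 : cabs v = 1 by rewrite vE cabs_cexp expR0.
  set d := cabs _; have d0 : 0 <= d by exact: cabs_ge0.
  rewrite /fejer; set dl := (_ + _ + _)%N.
  (* The trivial d <= 2 J settles dl <= 2; for dl >= 3 one has dl <= 3 (dl - 2) and d (dl - 2) <= 4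
     J. *)
  suff H : d * dl%:R <= 12 * J%:R.
    have dl0 : 0 < dl%:R :> R by rewrite ltr0n /dl.
    rewrite ler_pdivlMr ?exprn_gt0 // -exprMn (_ : 144 * _ = (12 * J%:R) ^+ 2); last by ring.
    by rewrite ler_pXn2r ?nnegrE ?mulr_ge0 // ltW.
  have h1 : d <= 2 * J%:R.
    by apply: le_trans (geom_cabs _ v1) _; rewrite natrD; lra.
  have [small|big] := leqP dl 2.
    have : dl%:R <= 2 :> R by rewrite (ler_nat _ dl 2).
    move=> h2; apply: le_trans (ler_pM d0 _ h1 h2) _ => //; lra.
  have yb : dl%:R - 2 <= J%:R * `|yy|.
    have /andP[a1 a2] := binP k; have /andP[b1 b2] := binP l.
    have -> : J%:R * `|yy| = `|J%:R * h * ln (n l) - J%:R * h * ln (n k)|.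
      rewrite -{1}(ger0_norm (ltW Jp)) -normrM; congr Num.norm; rewrite /yy; ring.
    rewrite -natr1 in a2; rewrite -natr1 in b2.
    have [bkl|blk] := leqP (bin k) (bin l).
      have : dl%:R = 1 + (bin l)%:R - (bin k)%:R :> R.
        rewrite -addrA -natrB // nat1r; congr _%:R; rewrite /dl; lia.
      move=> ->; apply: le_trans (ler_norm _); lra.
    have : dl%:R = 1 + (bin k)%:R - (bin l)%:R :> R.
      rewrite -addrA -natrB ?(ltnW blk) // nat1r; congr _%:R; rewrite /dl; lia.
    by move=> ->; rewrite distrC; apply: le_trans (ler_norm _); lra.
  have yy2 : `|yy| <= 1 / 2.
    have := hn k; have := hn l => hl hk.
    have := mulr_ge0 (ltW h0) (l0 k); have := mulr_ge0 (ltW h0) (l0 l).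
    by rewrite /yy mulrBr ler_norml; lra.
  have h2 := cexp_sub1_ge yy2; rewrite -vE in h2.
  have h3 := geom_cabs2 (J + J) v1; rewrite -/d in h3.
  have h4 : d * `|yy| <= 4.
    have : d * (`|yy| / 2) <= d * cabs (v - 1) by rewrite ler_wpM2l.
    lra.
  have h5 : d * (dl%:R - 2) <= J%:R * 4.
    apply: le_trans (ler_wpM2l d0 yb) _; rewrite mulrCA ler_wpM2l // ltW //.
  have : dl%:R <= 3 * (dl%:R - 2) :> R.
    have : 3 <= dl%:R :> R by rewrite (ler_nat _ 3 dl).
    lra.
  move=> /(ler_wpM2l d0); lra.
pose f k := cabs (b k).
pose I := (\max_k bin k).+1.
have binI k : (bin k < I)%N by rewrite ltnS (leq_bigmax k).
pose g k : 'I_I := Ordinal (binI k).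
pose cell k := Num.truncn (n k).
have cellP k : (cell k)%:R <= n k < (cell k).+1%:R.
  by apply: truncn_itv; rewrite (le_trans ler01).
pose M := (\max_k cell k).+1.
have cellM k : (cell k < M)%N by rewrite ltnS (leq_bigmax k).
pose g2 k : 'I_I * 'I_M := (g k, Ordinal (cellM k)).
(* Bin i lies in [y i, y i + t i): a step 1 / (J h) <= 1 in ln n multiplies n by at most 1 + e / (J
   h), where e = [expR 1]. *)
pose y (i : nat) := expR (i%:R / (J%:R * h)).
pose t i := expR 1 * y i / (J%:R * h).
pose m0 i := Num.truncn (y i).
(* An interval of length t meets at most floor(t) + 2 unit cells. *)
pose c i := ((Num.truncn (t i)).+2)%N.
have y0 i : 0 < y i by exact: expR_gt0.
have t0 i : 0 <= t i by rewrite divr_ge0 ?mulr_ge0 ?expR_ge0 // ltW.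
have yn k : y (bin k) <= n k < y (bin k) + t (bin k).
  have nk0 : 0 < n k := lt_le_trans ltr01 (n1 k).
  have /andP[a1 a2] := binP k; apply/andP; split.
    rewrite -(lnK (_ : n k \in Num.pos)) ?posrE // ler_expR ler_pdivrMr // mulrC //.
  rewrite -{1}(lnK (_ : n k \in Num.pos)) ?posrE //.
  apply: lt_le_trans (_ : expR ((bin k).+1%:R / (J%:R * h)) <= _).
    by rewrite ltr_expR ltr_pdivlMr // mulrC.
  rewrite -natr1 mulrDl expRD -/(y _) mul1r.
  have x1 : 0 <= (J%:R * h)^-1 <= 1 by rewrite invr_ge0 (ltW Jh0) invf_le1.
  apply: le_trans (ler_wpM2l (ltW (y0 _)) (expR_le_line x1)) _.
  by rewrite /t mulrDr mulr1 lerD2l; rewrite [leRHS](_ : _ = y (bin k) * (expR 1 * (J%:R * h)^-1)) //; ring.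
have m0P i : (m0 i)%:R <= y i < (m0 i).+1%:R by apply: truncn_itv; exact: ltW.
have tP i : (Num.truncn (t i))%:R <= t i < (Num.truncn (t i)).+1%:R by exact: truncn_itv.
have inr k : (m0 (bin k) <= cell k < m0 (bin k) + c (bin k))%N.
  have /andP[a1 a2] := yn k; have /andP[b1 b2] := cellP k.
  have /andP[c1 c2] := m0P (bin k); have /andP[d1 d2] := tP (bin k).
  rewrite -ltnS -(ltr_nat R) (le_lt_trans c1) ?(le_lt_trans a1) //=.
  rewrite -(ltr_nat R) (le_lt_trans b1) // (lt_le_trans a2) // /c -addSnnS natrD.
  by rewrite lerD // ltW.
(* Kernel of the second test: 1 for two cells in the range of the same bin, so a row sums to at most
   c. *)
pose w2 (q q' : 'I_I * 'I_M) : R :=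
  ((q.1 == q'.1) && (m0 q.1 <= q.2 < m0 q.1 + c q.1)%N && (m0 q'.1 <= q'.2 < m0 q'.1 + c q'.1)%N)%:R.
have s1 : \sum_(m < J) cabs (\sum_k b k * u k ^+ m) ^+ 2 <=
    144 * J%:R * \sum_k \sum_l f k * f l * fejer (bin k) (bin l).
  rewrite -(ler_pM2l Jp); apply: le_trans (mean_square_form J b u1) _.
  rewrite mulrA (_ : J%:R * _ = 144 * J%:R ^+ 2); last by ring.
  rewrite mulr_sumr ler_sum // => k _; rewrite mulr_sumr ler_sum // => l _.
  rewrite [leRHS]mulrCA ler_wpM2l ?mulr_ge0 ?cabs_ge0 //.
have s2 : \sum_k \sum_l f k * f l * fejer (bin k) (bin l) <=
    \sum_k \sum_(l | g l == g k) 3 * (f k * f l).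
  apply: (@schur_labels D 'I_I f g (fun i j => fejer i j) (fun=> 3)).
  - by move=> k; exact: cabs_ge0.
  - by move=> i j; exact: fejer_ge0.
  - by move=> i j; exact: fejerC.
  - by move=> i; rewrite -(big_mkord xpredT (fejer i)); exact: fejer_sum.
have s3 : \sum_k \sum_(l | g l == g k) f k * f l <=
    \sum_k \sum_(l | g2 l == g2 k) (c (g2 k).1)%:R * (f k * f l).
  apply: (@le_trans _ _ (\sum_k \sum_l f k * f l * w2 (g2 k) (g2 l))).
    apply: ler_sum => k _; rewrite [leLHS]big_mkcond; apply: ler_sum => l _.
    rewrite /w2 /= !inr !andbT eq_sym; case: ifP => _; rewrite ?mulr1 ?mulr0 //.
  apply: (@schur_labels D _ f g2 w2 (fun q => (c q.1)%:R)).
  - by move=> k; exact: cabs_ge0.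
  - by move=> i j; exact: ler0n.
  - by move=> i j; rewrite /w2 eq_sym andbAC.
  - move=> q; pose F (a : nat) : R := (m0 q.1 <= a < m0 q.1 + c q.1)%N%:R.
    apply: (@le_trans _ _ (\sum_(q' : 'I_I * 'I_M) (if q'.1 == q.1 then F q'.2 else 0))).
      apply: ler_sum => q' _; rewrite /w2 eq_sym; case: eqP => [->|_] /=; last exact: lexx.
      by rewrite ler_nat; case: (m0 q.1 <= q.2 < _)%N.
    rewrite -(pair_bigA _ (fun i a => if i == q.1 then F (val a) else 0)) /= (bigD1 q.1) //= eqxx.
    rewrite [X in _ + X]big1 ?addr0; last first.
      by move=> i /negbTE ->; rewrite big1.
    rewrite -(big_mkord xpredT F) /F -natr_sum ler_nat -big_mkcond /= sum1_count -size_filter.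
    rewrite -[leqRHS](size_iota (m0 q.1)); apply: uniq_leq_size; first by rewrite filter_uniq // iota_uniq.
    by move=> a; rewrite mem_filter mem_iota => /andP[].
have s4 := sum_same_label f g2 (rho := fun q => (c q.1)%:R) (fun q => ler0n _ _).
apply: le_trans s1 _.
apply: le_trans (ler_wpM2l _ s2) _; first by rewrite mulr_ge0 // ltW.
rewrite (eq_bigr (fun k => 3 * \sum_(l | g l == g k) f k * f l)) => [|k _]; last by rewrite mulr_sumr.
rewrite -mulr_sumr mulrA.
apply: le_trans (ler_wpM2l _ (le_trans s3 s4)) _; first by rewrite !mulr_ge0 // ltW.
rewrite (_ : 144 * J%:R * 3 = 432 * J%:R); last by ring.
rewrite -mulrA; apply: (ler_wpM2l (ler0n R 432)); rewrite mulr_sumr; apply: ler_sum => k _.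
rewrite -[(g2 k).1]/(g k) -[nat_of_ord (g k)]/(bin k).
have f2 : 0 <= f k ^+ 2 by exact: sqr_ge0.
rewrite mulrA (mulrA _ _ (f k ^+ 2)) ler_pM ?ler0n //.
  by apply: mulr_ge0.
  rewrite ler_wpM2r //.
  have /andP[d1 _] := tP (bin k); have /andP[a1 _] := yn k.
  apply: le_trans (_ : J%:R * (t (bin k) + 2) <= _).
    by rewrite ler_wpM2l ?(ltW Jp) // /c -addn2 natrD lerD2r.
  rewrite mulrDr [J%:R * 2]mulrC lerD2r /t.
  rewrite [leLHS](_ : _ = expR 1 * y (bin k) / h); last by field; rewrite !gt_eqF.
  by rewrite ler_pM2r ?invr_gt0 // ler_wpM2l // expR_ge0.
(* Equal labels give the same unit cell, hence |n k - n l| <= 1. *)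
rewrite natr_sum big_mkcond [leRHS]big_mkcond; apply: ler_sum => l _.
case: ifP => [/eqP[_ cc]|_]; last by case: ifP.
have /andP[a1 a2] := cellP k; have /andP[b1 b2] := cellP l.
rewrite -natr1 in a2; rewrite -natr1 in b2; rewrite cc in b1 b2.
by rewrite ifT // ler_norml; lra.
Qed.

End MeanValue.

(** * Detecting zeros *)

Section ZeroBlock.
Variable R : realType.
Local Notation tau := (@pi R *+ 2).

Lemma is_derive_sum_ord (J : nat) (f df : 'I_J -> R -> R) (t : R) :
  (forall j, is_derive t 1 (f j) (df j t)) ->
  is_derive t 1 (fun x => \sum_j f j x) (\sum_j df j t).
Proof.
move=> h; have := is_derive_sum (fun j => h j).
by congr (is_derive _ _ _ _); apply/funext => x; rewrite fct_sumE.
Qed.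

(* The disc centred at kappa + i (t0 + j h) carries n_j zeros. Jensen's
   inequality for 1 - (f - 1)^2 bounds n_j by a mean of |P|^2 up to an error
   below 1, which the integrality of n_j absorbs. *)
Lemma zero_block (f P : R[i] -> R[i]) (kappa alpha eta h t0 B e0 : R) (J : nat)
    (zs : seq R[i]) (m jj : R[i] -> nat) :
  let r := kappa - alpha + eta / 2 in let r1 := kappa - alpha + eta in
  0 < eta -> alpha <= kappa ->
  (forall j z, (j < J)%N -> cabs (z - kappa +i* (t0 + j%:R * h)) <= r1 -> cdiff f z) ->
  (forall z, cdiff P z) ->
  (forall j z, (j < J)%N -> cabs (z - kappa +i* (t0 + j%:R * h)) <= r1 -> cabs (f z - 1 - P z) <= e0) ->
  (forall j, (j < J)%N -> cabs (P (kappa +i* (t0 + j%:R * h))) <= 1 / 4) ->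
  e0 <= 1 / 4 -> 16 * e0 ^+ 2 <= r1 / r - 1 ->
  (forall s, alpha - eta <= Re s -> \sum_(j < J) cabs (P (s + 0 +i* (j%:R * h))) ^+ 2 <= B) ->
  uniq zs ->
  (forall rho, rho \in zs -> [/\ alpha <= Re rho <= kappa, (jj rho < J)%N,
     `|Im rho - (t0 + (jj rho)%:R * h)| <= eta / 2 &
     exists2 g, cdiff g rho & cnear rho (fun z => f z = (z - rho) ^+ m rho * g z)]) ->
  (r1 / r - 1) * (\sum_(rho <- zs) m rho)%N%:R <= 8 * B.
Proof.
move=> r r1 eta0 ak df dP fP Pc e04 etau hB uzs hzs; set ta := r1 / r - 1 in etau *.
have r0 : 0 < r by rewrite /r; lra.
have r10 : 0 < r1 by rewrite /r1; lra.
have rr1 : r < r1 by rewrite /r /r1; lra.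
have ta0 : 0 < ta by rewrite subr_gt0 ltr_pdivlMr // mul1r.
have t0' := tau_gt0 R.
pose c (j : nat) : R[i] := kappa +i* (t0 + j%:R * h).
have /choice[psi hpsi] : forall j : 'I_J, exists psi : R -> R, forall phi, 0 <= phi <= tau ->
    is_derive phi 1 psi (cabs (P (circ (c j) r1 phi)) ^+ 2).
  move=> j; have [|psi hpsi] := @circ_bounded R (fun z => P z ^+ 2) (c j) r1 r10.
    by move=> z _; apply: cdiffX.
  by exists psi => phi /hpsi; rewrite cabsX.
pose nj (j : 'I_J) := (\sum_(rho <- zs | jj rho == j) m rho)%N.
have key (j : 'I_J) : ta * (nj j)%:R <= 4 * (cabs (P (c j)) ^+ 2 + (psi j tau - psi j 0) / tau).
  have mu0 : 0 <= (psi j tau - psi j 0) / tau.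
    rewrite divr_ge0 ?(ltW t0') //.
    apply: le_trans (mvt_ineq (ltW t0') (fun t _ => rderiv_cst 0 t) (hpsi j) _).
      exact: cabs_ge0.
    by move=> t _; rewrite cabs0 sqr_ge0.
  have P0 : 0 <= cabs (P (c j)) ^+ 2 by exact: sqr_ge0.
  (* From here nj >= 1, so nj ta >= ta absorbs the error 2 e0^2 <= ta / 8. *)
  have [->|n0] := posnP (nj j); first by rewrite mulr0 mulr_ge0 // addr_ge0.
  pose F z := 1 - (f z - 1) ^+ 2.
  have gb z : cabs (z - c j) <= r1 -> cabs (f z - 1) ^+ 2 <= 2 * e0 ^+ 2 + 2 * cabs (P z) ^+ 2.
    move=> zr; have e1 := fP j z (ltn_ord j) zr.
    have h1 : cabs (f z - 1) <= e0 + cabs (P z).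
      by rewrite -[f z - 1](subrK (P z)) (le_trans (cabsD _ _)) // lerD2r.
    apply: (@le_trans _ _ ((e0 + cabs (P z)) ^+ 2)).
      by rewrite ler_pXn2r ?nnegrE ?cabs_ge0 // (le_trans (cabs_ge0 _) h1).
    have := sqr_ge0 (e0 - cabs (P z)); rewrite !expr2; lra.
  have dF z : cabs (z - c j) <= r1 -> cdiff F z.
    move=> zr; apply: cdiffB; first exact: cdiff_cst.
    apply: cdiffX; apply: cdiffB; last exact: cdiff_cst.
    exact: (df j z (ltn_ord j) zr).
  pose zj := [seq rho <- zs | jj rho == j].
  have dpsi phi : 0 <= phi <= tau -> is_derive phi 1
      (fun t => (1 + 2 * e0 ^+ 2) * t + 2 * psi j t)
      ((1 + 2 * e0 ^+ 2) + 2 * cabs (P (circ (c j) r1 phi)) ^+ 2).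
    move=> hphi; apply: is_deriveD.
      by have := is_deriveZ (1 + 2 * e0 ^+ 2) (is_derive_id phi 1); rewrite /GRing.scale /= mulr1.
    exact: (is_deriveZ 2 (hpsi j phi hphi)).
  have := @jensen R F (c j) r1 r zj m _ _ r0 rr1 dF (filter_uniq _ uzs) _ dpsi _.
  have -> : (\sum_(rho <- zj) m rho = nj j)%N by rewrite /zj big_filter.
  have cc : cabs (c j - c j) <= r1 by rewrite subrr cabs0 ltW.
  have q4 : cabs (f (c j) - 1) <= 1 / 2.
    have := fP j _ (ltn_ord j) cc; have := Pc j (ltn_ord j) => h1 h2.
    rewrite -[f _ - 1](subrK (P (c j))) (le_trans (cabsD _ _)) //; lra.
  set q := cabs (f (c j) - 1) in q4.
  have q0 : 0 <= q by exact: cabs_ge0.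
  have Fc : 1 - q ^+ 2 <= cabs (F (c j)).
    by have := cabs_sub_ge 1 ((f (c j) - 1) ^+ 2); rewrite cabs1 cabsX.
  have bern := bernoulli (nj j) (_ : 1 <= r1 / r).
  rewrite -/ta in bern.
  have {}bern := bern (ltW _); rewrite ltr_pdivlMr // mul1r in bern; have {}bern := bern rr1.
  move=> jen; have {jen} jen : cabs (F (c j)) * (r1 / r) ^+ nj j * tau <=
      (1 + 2 * e0 ^+ 2) * tau + 2 * (psi j tau - psi j 0).
    rewrite (le_trans (jen _ _)) //.
    - move=> rho; rewrite mem_filter => /andP[/eqP jr /hzs[/andP[a1 a2] _ im [g dg hg]]].
      split.
        apply: le_trans (cabs_le_ReIm _) _; rewrite ReD ReN ImD ImN /= -jr /r.
        have : `|Re rho - kappa| <= kappa - alpha by rewrite ler_norml; lra.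
        lra.
      (* 1 - (f - 1)^2 = f (2 - f), so a power of z - rho dividing f divides F. *)
      exists (fun z => g z * (2 - f z)).
        have dfr : cdiff f rho.
          apply: cdiff_ext (_ : cdiff (fun z => (z - rho) ^+ m rho * g z) rho).
            by apply: cnearS hg => z ->.
          apply: cdiffM => //; apply: cdiffX.
          by apply: cdiffB; [exact: cdiff_id|exact: cdiff_cst].
        by apply: cdiffM => //; apply: cdiffB => //; exact: cdiff_cst.
      by apply: cnearS hg => z hz; rewrite mulrA -hz /F; ring.
    - move=> phi hphi; have zr : cabs (circ (c j) r1 phi - c j) <= r1 by rewrite cabs_circ.
      have := cabsB 1 ((f (circ (c j) r1 phi) - 1) ^+ 2); rewrite cabs1 cabsX -/(F _).
      have := gb _ zr; lra.
    - by rewrite mulr0; lra.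
  have jen2 : (1 - q ^+ 2) * (1 + (nj j)%:R * ta) <=
      1 + 2 * e0 ^+ 2 + 2 * ((psi j tau - psi j 0) / tau).
    rewrite -(ler_pM2r t0') (le_trans _ (le_trans jen _)) //; last first.
      by rewrite [leRHS]mulrDl -(mulrA 2) divfK ?gt_eqF.
    rewrite ler_wpM2r ?(ltW t0') // ler_pM //.
      have := mulr_ge0 q0 (_ : 0 <= 1 - q); rewrite expr2; nra.
    by rewrite addr_ge0 // mulr_ge0 // ltW.
  have gc := gb _ cc; rewrite -/q in gc.
  have n1 : ta <= (nj j)%:R * ta by rewrite ler_peMl ?(ltW ta0) // ler1n.
  have qq : q ^+ 2 <= 1 / 4 by rewrite expr2; nra.
  have : q ^+ 2 * ((nj j)%:R * ta) <= 1 / 4 * ((nj j)%:R * ta).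
    by rewrite ler_wpM2r // mulr_ge0 // ltW.
  move: jen2 gc n1 mu0 P0 etau.
  set Q := q ^+ 2; set E := e0 ^+ 2; set mu := _ / tau; set p2 := cabs (P _) ^+ 2.
  rewrite [ta * _]mulrC; set nt := _ * ta; lra.
have -> : (\sum_(rho <- zs) m rho = \sum_(j < J) nj j)%N.
  rewrite /nj (exchange_big_dep xpredT) //= big_seq [RHS]big_seq; apply: eq_bigr => rho /hzs[_ jJ _ _].
  rewrite (big_pred1 (Ordinal jJ)) // => j; rewrite /= -val_eqE /= eq_sym //.
rewrite natr_sum mulr_sumr; apply: le_trans (ler_sum _ (fun j _ => key j)) _.
rewrite -mulr_sumr big_split /=.
have cE j : c j = kappa +i* t0 + 0 +i* (j%:R * h).
  by apply: complex_eq; rewrite !(ReD, ImD) /= ?addr0.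
have s1 : \sum_(j < J) cabs (P (c j)) ^+ 2 <= B.
  have := hB (kappa +i* t0); rewrite /= => /(_ _); rewrite (eq_bigr (fun j : 'I_J => cabs (P (c j)) ^+ 2)).
    by apply; lra.
  by move=> j _; rewrite cE.
(* At a fixed angle the points of the J circles are s + i j h for a single s with Re s >= alpha -
   eta; the bound B holds angle by angle and is then averaged. *)
have s2 : \sum_(j < J) (psi j tau - psi j 0) / tau <= B.
  rewrite -mulr_suml ler_pdivrMr // sumrB.
  rewrite -subr_ge0 [X in 0 <= X](_ : _ = (B * tau - \sum_(j < J) psi j tau) -
    (B * 0 - \sum_(j < J) psi j 0)); last by ring.
  apply: le_trans (mvt_ineq (ltW t0') (fun t _ => rderiv_cst 0 t)
    (psi := fun t => B * t - \sum_(j < J) psi j t)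
    (dpsi := fun t => B - \sum_(j < J) cabs (P (circ (c j) r1 t)) ^+ 2) _ _).
  - exact: cabs_ge0.
  - move=> t ht; apply: is_deriveB.
      by have := is_deriveZ B (is_derive_id t 1); rewrite /GRing.scale /= mulr1.
    exact: (@is_derive_sum_ord J psi (fun j t => cabs (P (circ (c j) r1 t)) ^+ 2)) (fun j => hpsi j t ht).
  - move=> t ht; rewrite cabs0 subr_ge0.
    rewrite (eq_bigr (fun j : 'I_J => cabs (P (circ (kappa +i* t0) r1 t + 0 +i* (j%:R * h))) ^+ 2)).
      apply: hB; have := cabs_circ (kappa +i* t0) t r10 => cc.
      have := Re_le_cabs (circ (kappa +i* t0) r1 t - kappa +i* t0).
      rewrite cc ReD ReN /= ler_norml => /andP[+ _]; rewrite /r1; lra.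
    by move=> j _; rewrite /circ cE; congr (cabs (P _) ^+ 2); ring.
lra.
Qed.

End ZeroBlock.

(** * Exponents of the mollifier lengths *)

Section Exponents.
Variables (R : realType) (theta alpha : R).
Hypothesis theta_ge0 : 0 <= theta.
Hypothesis theta_lt1 : theta < 1.
Hypothesis alpha_ge : (theta + 2) / 3 <= alpha.
Hypothesis alpha_le1 : alpha <= 1.

Definition density_den := 2 * alpha ^+ 2 - 3 * alpha + 2 - theta.
Definition density_exp := (1 - alpha) / density_den * (4 * alpha - 2 * theta).
Definition xexp := (3 * alpha - 2 - theta) / density_den.
Definition yexp := (2 * alpha - theta) / density_den.

Let box : [/\ 0 <= theta, theta < 1, (theta + 2) / 3 <= alpha & alpha <= 1].
Proof. by []. Qed.

(** Source of uniformity in [alpha]: it caps [xexp] and [yexp], so that one small [e] serves every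
    admissible [alpha]. *)
Lemma density_den_ge : (1 - theta) / 2 <= density_den.
Proof.
case: box => t0 t1 a0 a1.
rewrite /density_den expr2.
have h : 0 <= alpha - (theta + 2) / 3 by rewrite subr_ge0.
have := mulr_ge0 h h; have := mulr_ge0 h theta_ge0; have := sqr_ge0 (theta - 1/4).
have := mulr_ge0 theta_ge0 (_ : 0 <= 1 - theta).
rewrite !expr2 subr_ge0 (ltW theta_lt1) => /(_ isT).
nra.
Qed.

Let den_gt0 : 0 < density_den.
Proof.
case: box => t0 t1 a0 a1.
by apply: lt_le_trans density_den_ge; rewrite divr_gt0 // subr_gt0. Qed.

Lemma xexp_ge0 : 0 <= xexp.
Proof.
case: box => t0 t1 a0 a1.
rewrite divr_ge0 ?(ltW den_gt0) //; lra. Qed.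

Lemma xexp_le : xexp <= 2.
Proof.
case: box => t0 t1 a0 a1.
by rewrite ler_pdivrMr //; have := density_den_ge; lra. Qed.

Lemma yexp_ge0 : 0 <= yexp.
Proof.
case: box => t0 t1 a0 a1.
rewrite divr_ge0 ?(ltW den_gt0) //; lra. Qed.

Lemma yexp_le : (1 - theta) * yexp <= 4.
Proof.
case: box => t0 t1 a0 a1.
rewrite mulrA ler_pdivrMr //; have := density_den_ge => h.
have : (1 - theta) * (2 * alpha - theta) <= (1 - theta) * 2 by rewrite ler_wpM2l; lra.
lra.
Qed.

Lemma xyexp_le : xexp <= yexp.
Proof.
case: box => t0 t1 a0 a1.
by rewrite ler_pM2r ?invr_gt0 //; lra. Qed.

Lemma density_expE : density_exp = 2 * (1 - alpha) * yexp.
Proof.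
case: box => t0 t1 a0 a1.
by rewrite /density_exp /yexp; field; rewrite gt_eqF. Qed.

(** Together with [density_expE]: the two terms Y^(2 - 2 alpha) and U X^(1 - 2 alpha) of the mean
    square have the same exponent. *)
Lemma density_expE2 : density_exp = 1 + xexp * (1 - 2 * alpha).
Proof.
case: box => t0 t1 a0 a1.
have d0 : density_den != 0 by rewrite gt_eqF.
by rewrite /density_exp /xexp; move: d0; rewrite /density_den => d0; field.
Qed.

(** Without the surplus [lam] the truncation error U Y^(theta - alpha) X^(1 - theta) has exponent
    exactly 0. *)
Lemma xyexpE : (alpha - theta) * yexp = (1 - theta) * xexp + 1.
Proof.
case: box => t0 t1 a0 a1.
have d0 : density_den != 0 by rewrite gt_eqF.
by rewrite /yexp /xexp; move: d0; rewrite /density_den => d0; field.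
Qed.

Lemma density_exp_ge0 : 0 <= density_exp.
Proof.
case: box => t0 t1 a0 a1.
rewrite density_expE; apply: mulr_ge0; last exact: yexp_ge0.
by apply: mulr_ge0 => //; rewrite subr_ge0. Qed.

Lemma density_exp_le1 : density_exp <= 1.
Proof.
case: box => t0 t1 a0 a1.
rewrite density_expE2; have := mulr_ge0 xexp_ge0 (_ : 0 <= 2 * alpha - 1).
have -> : 0 <= 2 * alpha - 1 by lra.
by move=> /(_ isT); lra.
Qed.

(* [e] is small enough for every loss of a factor U^e or U^(e y) to stay below U^(lam b). *)
Variables (lam e : R).
Hypothesis lam_gt0 : 0 < lam.
Hypothesis lam_le : lam <= 1 / 4.
Hypothesis eE : e = lam * (1 - theta) ^+ 2 / 100.
Local Notation b := (1 - theta).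
Local Notation x := xexp.
Local Notation y := yexp.

Let e_gt0 : 0 < e.
Proof.
have t0 := theta_ge0; have t1 := theta_lt1.
have l0 := lam_gt0; have l1 := lam_le.
by rewrite eE divr_gt0 // mulr_gt0 // exprn_gt0 // subr_gt0. Qed.

Let ex : e * x <= lam * b / 50.
Proof.
case: box => t0 t1 a0 a1.
have l0 := lam_gt0; have l1 := lam_le.
have b2 : lam * b ^+ 2 <= lam * b by rewrite ler_wpM2l ?(ltW lam_gt0) // expr2; nra.
have := ler_wpM2l (ltW e_gt0) xexp_le; rewrite eE; nra.
Qed.

Let ey : e * y <= lam * b / 25.
Proof.
case: box => t0 t1 a0 a1.
have l0 := lam_gt0; have l1 := lam_le.
rewrite eE (_ : lam * b ^+ 2 / 100 * y = lam * b * (b * y) / 100); last by ring.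
have lb : 0 <= lam * b by rewrite mulr_ge0 ?(ltW lam_gt0) // subr_ge0 ltW.
have := ler_wpM2l lb yexp_le; lra.
Qed.

Let el : e * lam <= lam * b / 400.
Proof.
case: box => t0 t1 a0 a1.
have l0 := lam_gt0; have l1 := lam_le.
have lb : 0 <= lam * b by rewrite mulr_ge0 ?(ltW lam_gt0) // subr_ge0 ltW.
rewrite eE (_ : lam * b ^+ 2 / 100 * lam = lam * b * (b * lam) / 100); last by ring.
have h : b * lam <= 1 / 4 by have := theta_ge0; nra.
have := ler_wpM2l lb h; lra.
Qed.

Let e_le : e <= lam * b / 100.
Proof.
have t0 := theta_ge0; have t1 := theta_lt1.
have l0 := lam_gt0; have l1 := lam_le.
rewrite eE expr2; have lb : 0 <= lam * b by rewrite mulr_ge0 ?(ltW lam_gt0) // subr_ge0 ltW.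
have := ler_piMr lb (_ : b <= 1); rewrite -mulrA; have := theta_ge0 => h.
have -> : b <= 1 by lra.
by move=> /(_ isT); lra.
Qed.

Let lb_le : lam * b <= lam.
Proof.
have t0 := theta_ge0; have t1 := theta_lt1.
have l0 := lam_gt0; have l1 := lam_le.
by rewrite ler_piMr ?(ltW lam_gt0) //; have := theta_ge0; lra. Qed.

Let lb_gt0 : 0 < lam * b.
Proof.
have t0 := theta_ge0; have t1 := theta_lt1.
have l0 := lam_gt0; have l1 := lam_le.
by rewrite mulr_gt0 // subr_gt0. Qed.

(** Exponent of Y^(2 - 2 sigma + 4 e) / h with sigma = alpha - e and h = U^(-e). [poly_exp2] treats
    J X^(1 - 2 sigma + 4 e), where J is of order U^(1 + e). *)
Lemma poly_exp1 : (y + lam) * (2 - 2 * (alpha - e) + 4 * e) + e <= density_exp + 2 * lam.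
Proof.
case: box => t0 t1 a0 a1.
have l0 := lam_gt0; have l1 := lam_le.
rewrite density_expE.
have : lam * (1 - alpha) <= lam * (1 / 3) by rewrite ler_wpM2l ?(ltW lam_gt0) //; lra.
have := ex; have := ey; have := el; have := e_le; have := lb_le; lra.
Qed.

Lemma poly_exp2 : 1 + e + x * (1 - 2 * (alpha - e) + 4 * e) <= density_exp + 2 * lam.
Proof.
case: box => t0 t1 a0 a1.
have l0 := lam_gt0; have l1 := lam_le.
rewrite density_expE2; have := ex; have := e_le; have := lb_le; lra. Qed.

(** The contribution Y^(1 - sigma) X^e / U of the pole: [density_exp] <= 1 means (1 - alpha) [yexp]
    <= 1 / 2, well below 1. *)
Lemma err_exp1 : (y + lam) * (1 - (alpha - e)) - 1 + x * e <= - (lam * b / 3).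
Proof.
case: box => t0 t1 a0 a1.
have l0 := lam_gt0; have l1 := lam_le.
have : lam * (1 - alpha) <= lam * (1 / 3) by rewrite ler_wpM2l ?(ltW lam_gt0) //; lra.
have := density_exp_le1; rewrite density_expE.
have := ex; have := ey; have := el; have := e_le; have := lb_le; lra.
Qed.

(** The truncation error. The saving comes from [lam] alone: alpha - theta >= 2 (1 - theta) / 3, of
    which half is kept after the losses in [e]. *)
Lemma err_exp2 : 1 + (y + lam) * (theta - (alpha - e)) + x * (b + e) <= - (lam * b / 3).
Proof.
case: box => t0 t1 a0 a1.
have l0 := lam_gt0; have l1 := lam_le.
have : lam * (2 / 3 * b) <= lam * (alpha - theta) by rewrite ler_wpM2l ?(ltW lam_gt0) //; lra.
have := xyexpE; have := ex; have := ey; have := el; have := e_le; have := lb_gt0; lra.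
Qed.

Lemma e_small : e <= 1 / 400 /\ e <= b / 400.
Proof.
have t0 := theta_ge0; have t1 := theta_lt1.
have l0 := lam_gt0; have l1 := lam_le.
have := e_le; have := lb_le => h1 h2; split; first lra.
have : lam * b <= 1 / 4 * b by rewrite ler_wpM2r // subr_ge0 ltW.
lra.
Qed.

End Exponents.

(** * The mollified zeta function *)

Section Mollifier.
Variables (R : realType) (n : nat -> R) (N : R -> nat) (A theta K : R).
Hypothesis n_ge1 : forall k, 1 <= n k.
Hypothesis NP : forall k x, (n k <= x) = (k < N x)%N.
Hypothesis n_gt1 : forall k, (0 < k)%N -> 1 < n k.
Hypothesis n0 : n 0 = 1.
Hypothesis theta_ge0 : 0 <= theta.
Hypothesis theta_lt1 : theta < 1.
Hypothesis A_gt0 : 0 < A.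
Hypothesis K_ge0 : 0 <= K.
Variable W : R[i] -> R[i].
Hypothesis W_approx : forall s, theta < Re s -> forall x, 1 <= x ->
  cabs (W s - (s - 1) * partial_zeta n (N x) s - A%:C * cpw x (1 - s))
    <= cabs (s - 1) * ((cabs s / (Re s - theta) + 1) * K * x `^ (theta - Re s)).
Hypothesis W_diff : forall s, theta < Re s -> cdiff W s.
Variables (mob : nat -> R) (conv : R -> nat -> R) (chi : nat -> R).
Hypothesis mob_le1 : forall k, `|mob k| <= 1.
Hypothesis conv_id : forall X, 1 <= X -> conv X 0 = 1.
Hypothesis conv_eq0 : forall X k, (0 < k)%N -> n k <= X -> conv X k = 0.
Hypothesis conv_bound : forall eps : R, 0 < eps -> exists2 C : R, 0 < C &
  forall X k, `|conv X k| <= C * n k `^ eps.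
Hypothesis conv_sum : forall X Y s, X <= Y ->
  \sum_(0 <= k < N Y) (conv X k)%:C * cpw (n k) (- s) =
  \sum_(0 <= d < N X) (mob d)%:C * cpw (n d) (- s) *
    \sum_(0 <= m < N (Y / n d)) cpw (n m) (- s).
Hypothesis chi_sum : forall eps : R, 0 < eps -> exists C, forall x, 1 <= x ->
  \sum_(0 <= k < N x) chi k <= C * x `^ (1 + eps).
Hypothesis chi_ge : forall D k, \sum_(l < D | `|n k - n l| <= 1) 1 <= chi k.

Let n_gt0 k : 0 < n k. Proof. exact: lt_le_trans (n_ge1 k). Qed.

Let n_mono i j : (i <= j)%N -> n i <= n j.
Proof. by move=> ij; rewrite NP (leq_ltn_trans ij) // -NP. Qed.

Let chi_ge1 k : 1 <= chi k.
Proof.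
apply: le_trans (chi_ge k.+1 k); rewrite (bigD1 ord_max) ?subrr ?normr0 //=.
by rewrite lerDl sumr_ge0.
Qed.

(** Dyadic summation: values in [2^i, 2^(i+1)) contribute at most a constant times 2^(-i (1 + eps))
    2^(i (1 + eps / 2)), a geometric series of ratio [q]. *)
Lemma chi_series (eps : R) : 0 < eps -> exists2 C : R, 0 < C &
  forall D, \sum_(0 <= k < D) chi k * n k `^ (- (1 + eps)) <= C.
Proof.
move=> e0; have e2 : 0 < eps / 2 by rewrite divr_gt0.
have [C0 hC0] := chi_sum e2.
pose C := Num.max C0 1.
have C1 : 0 < C by rewrite lt_max ltr01 orbT.
pose q : R := 2 `^ (- (eps / 2)).
have q0 : 0 < q by rewrite powR_gt0.
have q1 : q < 1.
  rewrite /q powRN invf_lt1 ?powR_gt0 //.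
  by have := @gt0_ltr_powR R (eps / 2) e2 1 2; rewrite !nnegrE powR1; apply; lra.
exists (C * 2 `^ (1 + eps / 2) / (1 - q)).
  by rewrite divr_gt0 ?subr_gt0 // mulr_gt0 // powR_gt0.
move=> D; pose I := Num.bound (n D).
have nI k : (k < D)%N -> n k < 2 ^+ I.
  move=> kD; apply: le_lt_trans (n_mono (ltnW kD)) _.
  apply: lt_trans (archi_boundP (ltW (n_gt0 D))) _.
  by rewrite -natrX ltr_nat ltn_expl.
pose c (i : nat) : R := (2 ^+ i) `^ (- (1 + eps)).
have c0 i : 0 <= c i by exact: powR_ge0.
pose G k : R := \sum_(i < I) (n k <= 2 ^+ i.+1)%R%:R * c i.
apply: (@le_trans _ _ (\sum_(0 <= k < D) chi k * G k)).
  rewrite big_nat_cond [leRHS]big_nat_cond ler_sum // => k /andP[/andP[_ kD] _].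
  rewrite ler_wpM2l ?(le_trans ler01) //.
  have ex : exists i, n k < 2 ^+ i by exists I; exact: nI.
  have [i hi imin] := ex_minnP ex.
  have iI : (i <= I)%N by apply: imin; exact: nI.
  case: i hi imin iI => [|i] hi imin iI; first by move: hi; rewrite expr0 ltNge n_ge1.
  rewrite /G (bigD1 (Ordinal iI)) //= (ltW hi) mul1r.
  rewrite -[leLHS]addr0 lerD //; last by apply: sumr_ge0 => j _; rewrite mulr_ge0.
  rewrite /c powR_le_anti ?exprn_gt0 // ?leNgt; last by lra.
  by apply/negP => /imin; rewrite ltnn.
rewrite (eq_bigr (fun k => \sum_(i < I) c i * ((n k <= 2 ^+ i.+1)%R%:R * chi k))); last first.
  by move=> k _; rewrite mulr_sumr; apply: eq_bigr => i _; ring.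
rewrite exchange_big /=.
apply: (@le_trans _ _ (\sum_(i < I) C * 2 `^ (1 + eps / 2) * q ^+ i)).
  apply: ler_sum => i _; rewrite -mulr_sumr.
  have two i' : 1 <= 2 ^+ i' :> R by rewrite exprn_ege1 // ler1n.
  have p2 (j : nat) (a : R) : (2 ^+ j) `^ a = 2 `^ (j%:R * a) :> R.
    by rewrite -powR_mulrn // powRrM.
  apply: (@le_trans _ _ (c i * (C * (2 ^+ i.+1) `^ (1 + eps / 2)))).
    rewrite ler_wpM2l //.
    apply: (@le_trans _ _ (\sum_(0 <= k < N (2 ^+ i.+1)) chi k)); last first.
      by apply: le_trans (hC0 _ (two _)) _; rewrite ler_wpM2r ?powR_ge0 // le_max lexx.
    rewrite (eq_bigr (fun k => if (k < N (2 ^+ i.+1))%N then chi k else 0)); last first.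
      by move=> k _; rewrite NP; case: ifP; rewrite ?mul1r ?mul0r.
    rewrite -big_mkcond /=.
    rewrite [leLHS](_ : _ = \sum_(0 <= k < minn D (N (2 ^+ i.+1))) chi k); last first.
      rewrite -[LHS]big_filter; apply: perm_big; apply: uniq_perm.
      + by rewrite filter_uniq // iota_uniq.
      + by rewrite iota_uniq.
      by move=> k; rewrite mem_filter !mem_index_iota /= leq_min andbC.
    rewrite [leRHS](big_cat_nat (n := minn D (N (2 ^+ i.+1)))) ?geq_minr //=.
    by rewrite lerDl sumr_ge0 // => k _; rewrite (le_trans ler01).
  rewrite /c !p2 mulrCA -mulrA ler_wpM2l ?(ltW C1) // -powRDp //.
  rewrite /q -powR_mulrn ?powR_ge0 // -powRrM -powRDp // le_eqVlt; apply/orP; left; apply/eqP.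
  by congr (_ `^ _); rewrite -natr1; field.
rewrite -mulr_sumr ler_pdivlMr ?subr_gt0 // -[leLHS]mulrA ler_piMr //.
  by rewrite mulr_ge0 ?powR_ge0 // ltW.
have := subrX1 q I; rewrite -[X in _ = X]opprK -mulNr opprB => h.
have -> : (\sum_(i < I) q ^+ i) * (1 - q) = 1 - q ^+ I by rewrite mulrC -[RHS]opprB h opprK.
by rewrite gerBl exprn_ge0 // ltW.
Qed.

Lemma gint_series (eps : R) : 0 < eps -> exists2 C : R, 0 < C &
  forall D, \sum_(0 <= k < D) n k `^ (- (1 + eps)) <= C.
Proof.
move=> /chi_series[C C0 h]; exists C => // D; apply: le_trans (h D).
by apply: ler_sum => k _; rewrite ler_peMl ?powR_ge0.
Qed.

Definition mollifier (X : R) (s : R[i]) : R[i] :=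
  \sum_(0 <= d < N X) (mob d)%:C * cpw (n d) (- s).

(** Index 0, the constant term 1, is left out; coefficients with n_k <= X vanish by [conv_eq0]. *)
Definition dpoly (X Y : R) (s : R[i]) : R[i] :=
  \sum_(1 <= k < N Y) (conv X k)%:C * cpw (n k) (- s).

Lemma cdiff_mollifier X s : cdiff (mollifier X) s.
Proof.
apply: cdiff_sum => d _; apply: cdiffM; first exact: cdiff_cst.
by apply: (@cdiff_comp _ (cpw (n d))); [apply: cdiffN; exact: cdiff_id|exact: cdiff_cpw].
Qed.

Lemma cdiff_dpoly X Y s : cdiff (dpoly X Y) s.
Proof.
apply: cdiff_sum => d _; apply: cdiffM; first exact: cdiff_cst.
by apply: (@cdiff_comp _ (cpw (n d))); [apply: cdiffN; exact: cdiff_id|exact: cdiff_cpw].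
Qed.

(** The continuation estimate at x = Y / n_d for each d. Against n_d^(-Re s), the powers of Y / n_d
    leave 1 / n_d in the pole term and n_d^(-theta) in the error. *)
Lemma mollified_approx X Y s : theta < Re s -> s != 1 -> 1 <= X -> X <= Y ->
  cabs (W s / (s - 1) * mollifier X s - 1 - dpoly X Y s) <=
  A * Y `^ (1 - Re s) / cabs (s - 1) * (\sum_(0 <= d < N X) (n d)^-1) +
  (cabs s / (Re s - theta) + 1) * K * Y `^ (theta - Re s) * (\sum_(0 <= d < N X) n d `^ (- theta)).
Proof.
move=> ts s1 X1 XY; have Y1 := le_trans X1 XY; have Y0 := lt_le_trans ltr01 Y1.
have s10 : s - 1 != 0 by rewrite subr_eq0.
have cs0 : 0 < cabs (s - 1) by rewrite cabs_gt0.
have NY : (0 < N Y)%N by rewrite -NP n0.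
have := conv_sum s XY; rewrite big_ltn // conv_id // n0 cpw1l mulr1 -/(dpoly X Y s) => cs.
have -> : W s / (s - 1) * mollifier X s - 1 - dpoly X Y s =
    \sum_(0 <= d < N X) (mob d)%:C * cpw (n d) (- s) *
      (W s / (s - 1) - \sum_(0 <= m < N (Y / n d)) cpw (n m) (- s)).
  rewrite -addrA -opprD cs /mollifier mulr_sumr -sumrB; apply: eq_bigr => d _; ring.
apply: le_trans (cabs_sum _ _ _) _.
rewrite !mulr_sumr -big_split /= big_nat_cond [leRHS]big_nat_cond ler_sum // => d /andP[/andP[_ dX] _].
have dY : n d <= Y by apply: le_trans XY; rewrite NP.
have x1 : 1 <= Y / n d by rewrite ler_pdivlMr // mul1r.
have x0 := lt_le_trans ltr01 x1.
have := W_approx ts x1; rewrite /partial_zeta -(big_mkord xpredT (fun m => cpw (n m) (- s))).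
set S := \sum_(_ <= _ < _) _; set c := _ * K => h.
have h2 : cabs (W s / (s - 1) - S) <= A * (Y / n d) `^ (1 - Re s) / cabs (s - 1) +
    c * (Y / n d) `^ (theta - Re s).
  rewrite -(ler_pM2r cs0) -cabsM mulrBl divfK // [S * _]mulrC.
  rewrite -(subrK (A%:C * cpw (Y / n d) (1 - s)) (_ - _)).
  apply: le_trans (cabsD _ _) _; rewrite (cabsM A%:C) cabs_cpw // cabs_real gtr0_norm //.
  rewrite ReD ReN /= [leRHS]mulrDl divfK ?gt_eqF // addrC lerD2l (le_trans h) //.
  by rewrite mulrC.
rewrite (cabsM _ (_ - _)) (cabsM _ (cpw _ _)) cabs_cpw // cabs_real ReN.
apply: le_trans (_ : n d `^ (- Re s) * (A * (Y / n d) `^ (1 - Re s) / cabs (s - 1) +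
    c * (Y / n d) `^ (theta - Re s)) <= _).
  by rewrite ler_pM ?mulr_ge0 ?cabs_ge0 ?powR_ge0 // ler_piMl ?powR_ge0.
have nV (a : R) : (Y / n d) `^ a = Y `^ a * n d `^ (- a).
  by rewrite powRM ?invr_ge0 ?(ltW Y0) ?(ltW (n_gt0 d)) // powRN -(powR_inv1 (ltW (n_gt0 d))) -powRrM mulN1r powRN.
have e1 : n d `^ (- Re s) * n d `^ (- (1 - Re s)) = (n d)^-1.
  by rewrite -powRDp // -(powR_inv1 (ltW (n_gt0 d))); congr (_ `^ _); ring.
have e2 : n d `^ (- Re s) * n d `^ (- (theta - Re s)) = n d `^ (- theta).
  by rewrite -powRDp //; congr (_ `^ _); ring.
by rewrite !nV -e1 -e2 le_eqVlt; apply/orP; left; apply/eqP; ring.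
Qed.

(** Rankin's trick: for n_d <= X, n_d^a <= n_d^(-(1 + eps)) X^(1 + a + eps). *)
Lemma inv_sums (eps : R) : 0 < eps -> exists2 C : R, 0 < C & forall X, 1 <= X ->
  \sum_(0 <= d < N X) (n d)^-1 <= C * X `^ eps /\
  \sum_(0 <= d < N X) n d `^ (- theta) <= C * X `^ (1 - theta + eps).
Proof.
move=> e0; have [C C0 hC] := gint_series e0; exists C => // X X1.
have key (a : R) : - a <= 1 + eps -> \sum_(0 <= d < N X) n d `^ a <= C * X `^ (1 + a + eps).
  move=> ha; apply: (@le_trans _ _ (\sum_(0 <= d < N X) n d `^ (- (1 + eps)) * X `^ (1 + a + eps))).
    rewrite big_nat_cond [leRHS]big_nat_cond ler_sum // => d /andP[/andP[_ dX] _].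
    rewrite -NP in dX.
    rewrite [leLHS](_ : _ = n d `^ (- (1 + eps)) * n d `^ (1 + a + eps)); last first.
      by rewrite -powRDp //; congr (_ `^ _); ring.
    rewrite ler_wpM2l ?powR_ge0 // ge0_ler_powR ?nnegrE ?(ltW (n_gt0 d)) //; first lra.
    exact: le_trans (ltW (n_gt0 d)) dX.
  by rewrite -mulr_suml ler_wpM2r ?powR_ge0.
split.
  rewrite (eq_bigr (fun d => n d `^ (- 1))) => [|d _]; last by rewrite powR_inv1 // ltW.
  have := key (- 1); rewrite opprK => /(_ _); rewrite subrr add0r; apply; lra.
have h : - - theta <= 1 + eps by rewrite opprK (le_trans (ltW theta_lt1)) // lerDl ltW.
exact: key h.
Qed.

(** No Euler product: were W s = 0, the mollified approximation would read -1 = P + o(1) as Y grows,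
    while a large X makes |P| <= 1 / 4 for every Y. *)
Lemma W_neq0 s : 1 < Re s -> W s != 0.
Proof.
move=> s1; have ts := lt_trans theta_lt1 s1.
have sn1 : s != 1 by apply: contraTneq s1 => ->; rewrite ltxx.
have q4 : 0 < 1 / 4 :> R by lra.
pose eps := (Re s - 1) / 4; have e0 : 0 < eps by rewrite divr_gt0 // subr_gt0.
have [Cd Cd0 hCd] := conv_bound e0; have [C C0 hC] := gint_series e0.
have CC : 0 < Cd * C by rewrite mulr_gt0.
have e2 : 0 < eps * 2 by lra.
have [X X1 hX] := powR_small e2 (divr_gt0 q4 CC).
apply/eqP => W0.
have Pb Y : cabs (dpoly X Y s) <= 1 / 4.
  apply: le_trans (cabs_sum _ _ _) _.
  apply: (@le_trans _ _ (\sum_(1 <= k < N Y) Cd * X `^ (- (eps * 2)) * n k `^ (- (1 + eps)))).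
    rewrite big_nat_cond [leRHS]big_nat_cond ler_sum // => k /andP[/andP[k0 _] _].
    rewrite cabsM cabs_real cabs_cpw // ReN.
    have [kX|Xk] := leP (n k) X.
      by rewrite conv_eq0 // normr0 mul0r !mulr_ge0 ?powR_ge0 // ltW.
    apply: le_trans (ler_wpM2r (powR_ge0 _ _) (hCd X k)) _.
    rewrite -[leLHS]mulrA -[leRHS]mulrA ler_wpM2l ?(ltW Cd0) //.
    rewrite -powRDp // (_ : eps + - Re s = - (eps * 2) + - (1 + eps)); last first.
      by rewrite /eps; field.
    rewrite powRDp // ler_wpM2r ?powR_ge0 // powR_le_anti ?(lt_le_trans ltr01) ?(ltW Xk) //; lra.
  rewrite -mulr_sumr.
  have hs : \sum_(1 <= k < N Y) n k `^ (- (1 + eps)) <= C.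
    apply: le_trans (hC (N Y)); have [->|NY] := posnP (N Y); first by rewrite !big_geq.
    by rewrite [leRHS]big_ltn // lerDr powR_ge0.
  have h1 := hX X (lexx _); rewrite ler_pdivlMr // in h1.
  apply: le_trans (ler_wpM2l _ hs) _; first by rewrite mulr_ge0 ?powR_ge0 // ltW.
  by rewrite mulrAC mulrC.
pose S1 := \sum_(0 <= d < N X) (n d)^-1; pose S2 := \sum_(0 <= d < N X) n d `^ (- theta).
have S10 : 0 <= S1 by apply: sumr_ge0 => d _; rewrite invr_ge0 ltW.
have S20 : 0 <= S2 by apply: sumr_ge0 => d _; exact: powR_ge0.
have cs0 : 0 < cabs (s - 1) by rewrite cabs_gt0 subr_eq0.
pose c1 := A / cabs (s - 1) * S1 + 1; pose c2 := (cabs s / (Re s - theta) + 1) * K * S2 + 1.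
have c10 : 0 < c1 by rewrite ltr_wpDl // mulr_ge0 // divr_ge0 // ltW.
have st0 : 0 < Re s - theta by rewrite subr_gt0.
have c20 : 0 < c2.
  by rewrite ltr_wpDl // !mulr_ge0 // addr_ge0 // divr_ge0 ?cabs_ge0 // ltW.
have s10 : 0 < Re s - 1 by rewrite subr_gt0.
have [M1 M11 hM1] := powR_small s10 (divr_gt0 q4 c10).
have [M2 M21 hM2] := powR_small st0 (divr_gt0 q4 c20).
pose Y := Num.max X (Num.max M1 M2).
have XY : X <= Y by rewrite le_max lexx.
have := hM1 Y; rewrite !le_max lexx orbT => /(_ isT); rewrite opprB ler_pdivlMr // => h1.
have := hM2 Y; rewrite !le_max lexx !orbT => /(_ isT); rewrite opprB ler_pdivlMr // => h2.
have := mollified_approx ts sn1 X1 XY; rewrite W0 !mul0r sub0r => h3.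
have := Pb Y => h4.
have : 1 <= cabs (-1 - dpoly X Y s) + cabs (dpoly X Y s).
  rewrite -[X in X <= _](cabs1 R) -cabsN -[- 1 in X in X <= _](subrK (dpoly X Y s)).
  exact: cabsD.
have p1 := powR_ge0 Y (1 - Re s); have p2 := powR_ge0 Y (theta - Re s).
have q1 : A * Y `^ (1 - Re s) / cabs (s - 1) * S1 <= 1 / 4.
  by apply: le_trans h1; rewrite /c1; set y := Y `^ _ in p1 *; rewrite mulrDr mulr1 [leLHS](_ : _ = y * (A / cabs (s - 1) * S1)); [rewrite lerDl|ring].
have q2 : (cabs s / (Re s - theta) + 1) * K * Y `^ (theta - Re s) * S2 <= 1 / 4.
  by apply: le_trans h2; rewrite /c2; set y := Y `^ _ in p2 *; rewrite mulrDr mulr1 [leLHS](_ : _ = y * ((cabs s / (Re s - theta) + 1) * K * S2)); [rewrite lerDl|ring].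
rewrite -/S1 -/S2 in h3; lra.
Qed.

Let cexp_imX (y : R) j : cexp (0 +i* y) ^+ j = cexp (0 +i* (j%:R * y)).
Proof.
elim: j => [|j IH]; first by rewrite expr0 mul0r -(cexp0 R).
rewrite exprS IH -cexpD; congr cexp.
by apply: complex_eq; rewrite ?(ReD, ImD) /= -?natr1; ring.
Qed.

(** The coefficients squared are O(n^(2 eps - 2 sigma)). Splitting off chi n^(-(1 + 2 eps)), which
    is summable, leaves n^(2 - 2 sigma + 4 eps) / h, increasing and bounded at Y, and J n^(1 - 2
    sigma + 4 eps), decreasing and bounded at X. *)
Lemma dpoly_mean_square (eps : R) : 0 < eps -> exists2 C : R, 0 < C &
  forall (X Y h sigma : R) (J : nat) s, 1 <= X -> X <= Y -> 0 < h -> (0 < J)%N -> 1 <= J%:R * h ->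
  h * ln Y <= 1 / 2 -> 1 - 2 * sigma + 4 * eps <= 0 -> 0 <= 2 - 2 * sigma + 4 * eps ->
  sigma <= Re s ->
  \sum_(j < J) cabs (dpoly X Y (s + 0 +i* (j%:R * h))) ^+ 2 <=
  C * (Y `^ (2 - 2 * sigma + 4 * eps) / h + J%:R * X `^ (1 - 2 * sigma + 4 * eps)).
Proof.
move=> e0; have [Cd Cd0 hCd] := conv_bound e0.
have e2 : 0 < 2 * eps by lra.
have [C C0 hC] := chi_series e2.
have [Cm Cm0 hCm] := discrete_mean_value R.
pose E : R := expR 1 + 2; have E0 : 0 < E by rewrite addr_gt0 ?expR_gt0.
exists (Cm * E * Cd ^+ 2 * C); first by rewrite !mulr_gt0 ?exprn_gt0.
move=> X Y h sigma J s X1 XY h0 J0 Jh hY x1 x2 ss.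
have Y1 := le_trans X1 XY; have Y0 := lt_le_trans ltr01 Y1; have X0 := lt_le_trans ltr01 X1.
pose D := N Y.
(* The zero coefficient at k = 0 turns the sum from 1 into one over a full ordinal. *)
pose b (k : 'I_D) : R[i] := if (k == 0 :> nat) then 0 else (conv X k)%:C * cpw (n k) (- s).
have dE j : dpoly X Y (s + 0 +i* (j%:R * h)) =
    \sum_(k < D) b k * cexp (0 +i* - (h * ln (n k))) ^+ j.
  rewrite /dpoly; have NY : (0 < N Y)%N by rewrite -NP n0.
  transitivity (\sum_(0 <= k < N Y) (if (k == 0)%N then 0 else (conv X k)%:C * cpw (n k) (- s)) *
     cexp (0 +i* - (h * ln (n k))) ^+ j); last by rewrite big_mkord.
  rewrite [RHS]big_ltn //= mul0r add0r big_nat_cond [RHS]big_nat_cond; apply: eq_bigr => k /andP[/andP[k0 _] _].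
  rewrite gtn_eqF // -mulrA; congr (_ * _); rewrite opprD cpwD; congr (_ * _).
  rewrite /cpw cexp_imX; congr cexp.
  by apply: complex_eq; rewrite !(ReM, ImM, ReN, ImN) /=; ring.
rewrite (eq_bigr (fun j : 'I_J => cabs (\sum_(k < D) b k * cexp (0 +i* - (h * ln (n k))) ^+ j) ^+ 2)); last first.
  by move=> j _; rewrite dE.
apply: le_trans (hCm D J h b (fun k => n k) J0 h0 Jh (fun k => n_ge1 k) _) _.
  move=> k; apply: le_trans hY; rewrite ler_wpM2l ?(ltW h0) // ler_ln ?posrE //.
  by rewrite NP.
set Q := Y `^ _ / h + _.
have Q0 : 0 <= Q by rewrite addr_ge0 ?mulr_ge0 ?powR_ge0 ?invr_ge0 // ltW.
rewrite [leRHS](_ : _ = Cm * (E * Cd ^+ 2 * Q * C)); last by ring.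
rewrite ler_wpM2l ?(ltW Cm0) //.
have Z0 : 0 <= E * Cd ^+ 2 * Q by rewrite !mulr_ge0 ?sqr_ge0 // ltW.
apply: (@le_trans _ _ (\sum_(k < D) E * Cd ^+ 2 * Q * (chi k * n k `^ (- (1 + 2 * eps))))); last first.
  rewrite -mulr_sumr -(big_mkord xpredT (fun k => chi k * n k `^ (- (1 + 2 * eps)))).
  by rewrite ler_wpM2l.
apply: ler_sum => k _.
have chk := chi_ge D k; set ch := \sum_(_ < _ | _) _ in chk *.
have c0 : 0 <= ch by rewrite sumr_ge0.
have kY : n k <= Y by rewrite NP.
have nk := n_gt0 k.
have r0 : 0 <= E * Cd ^+ 2 * Q * (chi k * n k `^ (- (1 + 2 * eps))).
  by rewrite mulr_ge0 // mulr_ge0 ?powR_ge0 // (le_trans c0).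
have [k0|k0] := posnP k.
  suff -> : b k = 0 by rewrite cabs0 expr0n mulr0 mul0r.
  by rewrite /b k0.
have [kX|Xk] := leP (n k) X.
  by rewrite /b gtn_eqF // conv_eq0 // mul0r cabs0 expr0n mulr0 mul0r.
have pw (a c : R) : n k `^ a = n k `^ c * n k `^ (a - c).
  by rewrite -powRDp //; congr (_ `^ _); ring.
have bk : cabs (b k) ^+ 2 <= Cd ^+ 2 * n k `^ (2 * eps - 2 * sigma).
  rewrite (_ : 2 * eps - 2 * sigma = (eps - sigma) + (eps - sigma)); last by ring.
  rewrite powRDp // -expr2 -exprMn ler_pXn2r ?nnegrE ?cabs_ge0 ?mulr_ge0 ?powR_ge0 ?(ltW Cd0) //.
  rewrite /b gtn_eqF // cabsM cabs_real cabs_cpw // ReN powRDp // mulrA.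
  by rewrite ler_pM ?powR_ge0 // ler_powR // lerN2.
apply: (@le_trans _ _ ((E * (n k / h + J%:R)) * (Cd ^+ 2 * n k `^ (2 * eps - 2 * sigma)) * chi k)).
  have nh : 0 <= n k / h by rewrite divr_ge0 ?ltW.
  have e1 := expR_gt0 (1 : R).
  have w0 : 0 <= expR 1 * n k / h + 2 * J%:R.
    by rewrite -mulrA; apply: addr_ge0; apply: mulr_ge0 => //; exact: ltW.
  have b0 : 0 <= cabs (b k) ^+ 2 by exact: sqr_ge0.
  apply: ler_pM => //; first exact: mulr_ge0.
  apply: ler_pM => //.
  have := mulr_ge0 (ltW e1) (ler0n R J); rewrite /E -mulrA; nra.
rewrite [leLHS](_ : _ = E * Cd ^+ 2 * ((n k / h + J%:R) * n k `^ (2 * eps - 2 * sigma)) * chi k); last by ring.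
rewrite [leRHS](_ : _ = E * Cd ^+ 2 * (Q * n k `^ (- (1 + 2 * eps))) * chi k); last by ring.
have ECd : 0 <= E * Cd ^+ 2 := mulr_ge0 (ltW E0) (sqr_ge0 Cd).
rewrite ler_wpM2r ?(le_trans c0) // ler_wpM2l //.
rewrite /Q (mulrDl (n k / h)) (mulrDl (_ / h)) lerD //.
  rewrite mulrAC [leRHS]mulrAC ler_pM2r ?invr_gt0 //.
  rewrite -{1}(powRr1 (ltW nk)) -powRDp // (pw _ (2 - 2 * sigma + 4 * eps)).
  rewrite ler_pM ?powR_ge0 //.
    by rewrite ge0_ler_powR ?nnegrE ?(ltW nk) ?(ltW Y0).
  by rewrite ler_powR //; lra.
rewrite -mulrA ler_wpM2l // (pw _ (1 - 2 * sigma + 4 * eps)) ler_pM ?powR_ge0 //.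
  by rewrite powR_le_anti // ltW.
by rewrite ler_powR //; lra.
Qed.

(** n_k^(-m) <= n_1^(-m) for k >= 1, and n_1 > 1: a power m chosen from the constants alone makes
    the sum small, so [kappa] is independent of X and Y. *)
Lemma dpoly_small (eps : R) : 0 < eps -> eps <= 1 -> exists2 kappa : R, 3 <= kappa &
  forall X Y s, Re s = kappa -> cabs (dpoly X Y s) <= 1 / 4.
Proof.
move=> e0 e1; have [Cd Cd0 hCd] := conv_bound e0.
have [C C0 hC] := gint_series (ltr01 : 0 < (1 : R)).
have q1 := n_gt1 (ltnSn 0).
have q4 : 0 < 1 / 4 :> R by lra.
have [m hm] := pow_unbounded (Cd * C) q1 q4.
exists (3 + m%:R); first by rewrite lerDl.
move=> X Y s sk; apply: le_trans (cabs_sum _ _ _) _.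
have qm : 0 < n 1 ^+ m by rewrite exprn_gt0.
apply: (@le_trans _ _ (\sum_(1 <= k < N Y) Cd / n 1 ^+ m * n k `^ (- (1 + 1)))).
  rewrite big_nat_cond [leRHS]big_nat_cond ler_sum // => k /andP[/andP[k0 _] _].
  rewrite cabsM cabs_real cabs_cpw // ReN sk.
  apply: le_trans (ler_wpM2r (powR_ge0 _ _) (hCd X k)) _.
  rewrite -!mulrA ler_wpM2l ?(ltW Cd0) // -powRDp //.
  rewrite (_ : eps + - (3 + m%:R) = - m%:R + - (1 + 1) + (eps - 1)); last by ring.
  rewrite (powRDp (- m%:R + - (1 + 1)) (eps - 1) (n_gt0 k)) (powRDp (- m%:R) _ (n_gt0 k)).
  apply: le_trans (_ : n k `^ (- m%:R) * n k `^ (- (1 + 1)) * 1 <= _).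
    by rewrite ler_wpM2l ?mulr_ge0 ?powR_ge0 // -[leRHS](powRr0 (n k)) ler_powR // subr_le0.
  rewrite mulr1 ler_wpM2r ?powR_ge0 // powRN powR_mulrn ?(ltW (n_gt0 k)) //.
  by rewrite lef_pV2 ?posrE ?exprn_gt0 // lerXn2r ?nnegrE ?(ltW (n_gt0 _)) // n_mono.
rewrite -mulr_sumr.
have hs : \sum_(1 <= k < N Y) n k `^ (- (1 + 1)) <= C.
  apply: le_trans (hC (N Y)); have [->|NY] := posnP (N Y); first by rewrite !big_geq.
  by rewrite [leRHS]big_ltn // lerDr powR_ge0.
apply: le_trans (ler_wpM2l _ hs) _; first by rewrite divr_ge0 ?ltW.
by rewrite mulrAC ler_pdivrMr // ltW.
Qed.

(** The radius is below [kappa] <= U / 2, so a disc centred at height between U and 2 U in modulus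
    stays at height at least U / 2, away from the pole. *)
Lemma block_disc (kappa alpha e U t0 a : R) z : 3 <= kappa -> 2 / 3 <= alpha -> alpha <= 1 ->
  0 < e -> e <= 1 / 400 -> 2 * kappa <= U -> t0 = U \/ t0 = - (2 * U) -> 0 <= a <= U ->
  cabs (z - kappa +i* (t0 + a)) <= kappa - alpha + e ->
  [/\ alpha - e <= Re z, U / 2 <= `|Im z| & cabs z <= 4 * U].
Proof.
move=> k3 a23 a1 e0 e1 kU ht0 /andP[j0 j1] hz.
have := le_trans (Re_le_cabs _) hz; have := le_trans (Im_le_cabs _) hz.
rewrite ReD ImD ReN ImN /= !ler_norml => /andP[i1 i2] /andP[r1 r2].
have hI : U - kappa <= `|Im z| /\ `|Im z| <= 2 * U + kappa.
  rewrite ler_norml ler_normr; case: ht0 i1 i2 => -> i1 i2; split.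
  + apply/orP; left; lra.
  + apply/andP; split; lra.
  + apply/orP; right; lra.
  + apply/andP; split; lra.
split; [lra|lra|].
apply: le_trans (cabs_le_ReIm z) _.
have : `|Re z| <= 2 * kappa by rewrite ler_norml; apply/andP; split; lra.
lra.
Qed.

(** * Zeros at heights between U and 2 U *)

Section Blocks.
Variables lam e : R.
Hypothesis lam_gt0 : 0 < lam.
Hypothesis lam_le : lam <= 1 / 4.
Hypothesis eE : e = lam * (1 - theta) ^+ 2 / 100.
Let X (alpha U : R) := U `^ xexp theta alpha.
Let Y (alpha U : R) := U `^ (yexp theta alpha + lam).

Let e_gt0 : 0 < e.
Proof.
by rewrite eE; apply: divr_gt0 => //; apply: mulr_gt0 => //; rewrite exprn_gt0 // subr_gt0.
Qed.

Let e_le : e <= 1 / 400 /\ e <= (1 - theta) / 400.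
Proof. exact: (e_small theta_ge0 theta_lt1 lam_gt0 lam_le eE). Qed.

Let alpha_ge23 alpha : (theta + 2) / 3 <= alpha -> 2 / 3 <= alpha.
Proof. by have := theta_ge0; lra. Qed.

Let X_ge1 alpha U : 1 <= U -> (theta + 2) / 3 <= alpha -> alpha <= 1 -> 1 <= X alpha U.
Proof. by move=> U1 a0 a1; rewrite powR_ge1 // xexp_ge0. Qed.

Let XY alpha U : 1 <= U -> (theta + 2) / 3 <= alpha -> alpha <= 1 -> X alpha U <= Y alpha U.
Proof.
move=> U1 a0 a1; rewrite ler_powR //; have := xyexp_le theta_ge0 theta_lt1 a0 a1.
have := lam_gt0; lra.
Qed.

Lemma mollified_small : exists2 C : R, 0 < C & forall alpha U s, 1 <= U ->
  (theta + 2) / 3 <= alpha -> alpha <= 1 -> alpha - e <= Re s -> U / 2 <= `|Im s| -> cabs s <= 4 * U ->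
  cabs (W s / (s - 1) * mollifier (X alpha U) s - 1 - dpoly (X alpha U) (Y alpha U) s) <=
  C * U `^ (- (lam * (1 - theta) / 3)).
Proof.
have [C C0 hC] := inv_sums e_gt0.
have b0 : 0 < 1 - theta by rewrite subr_gt0.
(* From |s| <= 4 U and Re s - theta >= (1 - theta) / 3. *)
pose c := 12 / (1 - theta) + 1.
have c0 : 0 < c by rewrite addr_gt0 // divr_gt0.
exists (2 * A * C + c * K * C).
  apply: ltr_pwDl; last by apply: mulr_ge0; [apply: mulr_ge0 => //|]; exact: ltW.
  by apply: mulr_gt0 => //; apply: mulr_gt0.
move=> alpha U s U1 a0 a1 sa sU s4.
have U0 := lt_le_trans ltr01 U1.
have [e1 e2] := e_le; have t0 := theta_ge0; have t1 := theta_lt1.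
have st : (1 - theta) / 3 <= Re s - theta by lra.
have ts : theta < Re s by rewrite -subr_gt0; apply: lt_le_trans st; rewrite divr_gt0.
have s1 : U / 2 <= cabs (s - 1).
  by apply: le_trans sU _; have := Im_le_cabs (s - 1); rewrite ImD ImN /= oppr0 addr0.
have U20 : 0 < U / 2 by rewrite divr_gt0.
have cs0 := lt_le_trans U20 s1.
have sn1 : s != 1 by rewrite -subr_eq0 -cabs_gt0.
have X1 := X_ge1 U1 a0 a1; have XYl := XY U1 a0 a1; have Y1 := le_trans X1 XYl.
have [S1 S2] := hC _ X1.
apply: le_trans (mollified_approx ts sn1 X1 XYl) _.
rewrite [leRHS]mulrDl; apply: lerD.
  apply: (@le_trans _ _ (A * Y alpha U `^ (1 - (alpha - e)) / (U / 2) * (C * X alpha U `^ e))).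
    apply: ler_pM => //.
    - by apply: divr_ge0; [apply: mulr_ge0; [exact: ltW|exact: powR_ge0]|exact: ltW].
    - by apply: sumr_ge0 => d _; rewrite invr_ge0 ltW.
    apply: ler_pM; [|by rewrite invr_ge0 ltW| |by rewrite lef_pV2].
    - by apply: mulr_ge0; [exact: ltW|exact: powR_ge0].
    by apply: ler_wpM2l; [exact: ltW|apply: ler_powR => //; lra].
  rewrite /X /Y -!powRrM.
  rewrite [leLHS](_ : _ = 2 * A * C * (U `^ ((yexp theta alpha + lam) * (1 - (alpha - e))) * U `^ (xexp theta alpha * e) / U)); last first.
    by field; rewrite gt_eqF.
  apply: ler_wpM2l; first by apply: mulr_ge0; [apply: mulr_ge0|]; exact: ltW.
  rewrite -(powRDp _ _ U0) -(powR_inv1 (ltW U0)) -(powRDp _ _ U0); apply: ler_powR => //.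
  by have := err_exp1 theta_ge0 theta_lt1 a0 a1 lam_gt0 lam_le eE; lra.
apply: (@le_trans _ _ (c * U * K * Y alpha U `^ (theta - (alpha - e)) * (C * X alpha U `^ (1 - theta + e)))).
  have cs : 0 <= cabs s / (Re s - theta) + 1.
    by apply: addr_ge0 => //; apply: divr_ge0; [exact: cabs_ge0|lra].
  apply: ler_pM; [| |idtac|exact: S2].
  - by apply: mulr_ge0; [apply: mulr_ge0|exact: powR_ge0].
  - by apply: sumr_ge0 => d _; exact: powR_ge0.
  apply: ler_pM; [exact: mulr_ge0|exact: powR_ge0| |apply: ler_powR => //; lra].
  apply: ler_wpM2r => //.
  rewrite [leRHS]mulrDl mul1r; apply: lerD => //.
  rewrite [leRHS](_ : _ = 4 * U / ((1 - theta) / 3)); last by field; rewrite gt_eqF.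
  apply: ler_pM => //; [exact: cabs_ge0|rewrite invr_ge0; lra|].
  by rewrite lef_pV2 ?posrE ?divr_gt0 // subr_gt0.
rewrite /X /Y -!powRrM.
rewrite [leLHS](_ : _ = c * K * C * (U * (U `^ ((yexp theta alpha + lam) * (theta - (alpha - e))) * U `^ (xexp theta alpha * (1 - theta + e))))); last first.
  by ring.
apply: ler_wpM2l; first by apply: mulr_ge0; [apply: mulr_ge0 => //|]; exact: ltW.
rewrite -(powRDp _ _ U0) -{1}(powRr1 (ltW U0)) -(powRDp _ _ U0); apply: ler_powR => //.
by have := err_exp2 theta_ge0 theta_lt1 a0 a1 lam_gt0 lam_le eE; lra.
Qed.

Lemma dpoly_block : exists C U0 : R, [/\ 0 < C, 1 <= U0 & forall alpha U s, U0 <= U ->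
  (theta + 2) / 3 <= alpha -> alpha <= 1 -> alpha - e <= Re s ->
  \sum_(j < (Num.truncn (U / U `^ (- e))).+1)
     cabs (dpoly (X alpha U) (Y alpha U) (s + 0 +i* (j%:R * U `^ (- e)))) ^+ 2 <=
  C * U `^ (density_exp theta alpha + 2 * lam)].
Proof.
have [C C0 hC] := dpoly_mean_square e_gt0.
have b0 : 0 < 1 - theta by rewrite subr_gt0.
have e0 := e_gt0; have e20 : 0 < e / 2 by rewrite divr_gt0.
have sg alpha : (theta + 2) / 3 <= alpha -> alpha <= 1 ->
  1 - 2 * (alpha - e) + 4 * e <= 0 /\ 0 <= 2 - 2 * (alpha - e) + 4 * e.
  by move=> /alpha_ge23 h1 h2; have [e1 _] := e_le; split; lra.
(* ln Y = ([yexp] + [lam]) ln U <= c U^(e / 2), so h ln Y <= c U^(- e / 2), which is at most 1 / 2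
   once U >= M. *)
pose c := (4 / (1 - theta) + 1) * (2 / e).
have c0 : 0 < c by apply: mulr_gt0; [apply: addr_gt0 => //|]; exact: divr_gt0.
have q0 : 0 < 1 / 2 / c by apply: divr_gt0 => //; apply: divr_gt0.
have [M M1 hM] := powR_small e20 q0.
exists (3 * C), M; split => //; first exact: mulr_gt0.
move=> alpha U s MU a0 a1 sa.
have U1 := le_trans M1 MU; have U0 := lt_le_trans ltr01 U1.
have [e1 e2] := e_le; have t0 := theta_ge0; have t1 := theta_lt1; have a23 := alpha_ge23 a0.
have l0 := lam_gt0; have l1 := lam_le.
set h := U `^ (- e).
have h0 : 0 < h by rewrite powR_gt0.
have h1 : h <= 1 by rewrite -[leRHS](powRr0 U) ler_powR //; lra.
have Uh : U / h = U `^ (1 + e) by rewrite /h powRN invrK powRDp // powRr1 // ltW.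
have Uh1 : 1 <= U / h by rewrite Uh powR_ge1 //; lra.
have /andP[tr1 tr2] : (Num.truncn (U / h))%:R <= U / h < (Num.truncn (U / h)).+1%:R.
  by rewrite truncn_itv // (le_trans ler01).
set J := (Num.truncn (U / h)).+1 in tr2 *.
have JU : J%:R <= 2 * (U / h) by rewrite /J -natr1; lra.
have Jh : 1 <= J%:R * h.
  by apply: le_trans U1 _; rewrite -ler_pdivrMr // ltW.
have y0 := yexp_ge0 theta_ge0 theta_lt1 a0 a1.
have hY : h * ln (Y alpha U) <= 1 / 2.
  have hb : yexp theta alpha + lam <= 4 / (1 - theta) + 1.
    apply: lerD; last lra.
    by rewrite ler_pdivlMr // mulrC yexp_le.
  have hl : ln U <= 2 / e * U `^ (e / 2).
    have : ln (U `^ (e / 2)) <= U `^ (e / 2) by apply: ltW; rewrite ln_sublinear // powR_gt0.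
    rewrite ln_powR => hl; rewrite [leRHS]mulrAC ler_pdivlMr //; lra.
  have := hM _ MU; rewrite ler_pdivlMr // => hm.
  apply: le_trans hm; rewrite /Y ln_powR.
  apply: (@le_trans _ _ (h * ((4 / (1 - theta) + 1) * (2 / e * U `^ (e / 2))))).
    apply: ler_wpM2l; first exact: ltW.
    apply: ler_pM => //; [lra|exact: ln_ge0].
  rewrite [leLHS](_ : _ = h * U `^ (e / 2) * c); last by rewrite /c; ring.
  apply: ler_wpM2r; first exact: ltW.
  by rewrite /h -powRDp //; apply: ler_powR => //; lra.
have X1 := X_ge1 U1 a0 a1; have XYl := XY U1 a0 a1.
have := hC (X alpha U) (Y alpha U) h (alpha - e) J s X1 XYl h0 (ltn0Sn _) Jh hY.
have [sg1 sg2] := sg _ a0 a1; move=> /(_ sg1 sg2 sa) hh; apply: le_trans hh _.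
rewrite [leRHS](_ : _ = C * (U `^ (density_exp theta alpha + 2 * lam) + 2 * U `^ (density_exp theta alpha + 2 * lam))); last by ring.
apply: ler_wpM2l; first exact: ltW.
apply: lerD.
  rewrite /h powRN invrK /Y -powRrM -powRDp //; apply: ler_powR => //.
  exact: (poly_exp1 theta_ge0 theta_lt1 a0 a1 lam_gt0 lam_le eE).
apply: le_trans (ler_wpM2r (powR_ge0 _ _) JU) _.
rewrite -[leLHS]mulrA; apply: ler_wpM2l => //.
rewrite Uh /X -powRrM -powRDp //; apply: ler_powR => //.
exact: (poly_exp2 theta_ge0 theta_lt1 a0 a1 lam_gt0 lam_le eE).
Qed.

Lemma zero_block_bound : exists C U0 : R, [/\ 0 < C, 1 <= U0 &
  forall alpha U t0 (zs : seq R[i]) (m : R[i] -> nat), U0 <= U ->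
  (theta + 2) / 3 <= alpha -> alpha <= 1 -> t0 = U \/ t0 = - (2 * U) -> uniq zs ->
  (forall rho, rho \in zs -> [/\ alpha <= Re rho <= 1, t0 <= Im rho <= t0 + U &
     exists2 g, cdiff g rho & cnear rho (fun z => W z / (z - 1) = (z - rho) ^+ m rho * g z)]) ->
  (\sum_(rho <- zs) m rho)%N%:R <= C * U `^ (density_exp theta alpha + 2 * lam)].
Proof.
have [Ca Ca0 hCa] := mollified_small.
have [Cb [Ub [Cb0 Ub1 hCb]]] := dpoly_block.
have [e1 e2] := e_le; have e0 := e_gt0.
have ele1 : e <= 1 by lra.
have [kappa k3 hk] := dpoly_small e0 ele1.
have k0 : 0 < kappa by lra.
(* A lower bound, uniform in [alpha], for the radius ratio minus 1, that is (e / 2) / ([kappa] -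
   [alpha] + e / 2). *)
pose ta := e / (2 * kappa); have ta0 : 0 < ta by apply: divr_gt0 => //; apply: mulr_gt0.
(* Then 16 e3^2 <= 16 (1 / 4) (ta / 4) = ta. *)
pose e3 := Num.min (1 / 4) (ta / 4).
have e30 : 0 < e3 by rewrite lt_min; apply/andP; split; lra.
have lb : 0 < lam * (1 - theta) / 3 by apply: divr_gt0 => //; apply: mulr_gt0 => //; rewrite subr_gt0.
have [M1 M11 hM1] := powR_small lb (divr_gt0 e30 Ca0).
have e20 : 0 < e / 2 by rewrite divr_gt0.
have [M2 M21 hM2] := powR_small e0 e20.
pose U0 := Num.max Ub (Num.max (2 * kappa) (Num.max M1 M2)).
exists (8 * Cb / ta), U0; split.
- by apply: divr_gt0 => //; apply: mulr_gt0.
- by rewrite le_max Ub1.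
move=> alpha U t0 zs m; rewrite !ge_max => /and4P[UbU kU M1U M2U] a0 a1 ht0 uzs hzs.
have U1 := le_trans Ub1 UbU; have Up := lt_le_trans ltr01 U1.
have a23 := alpha_ge23 a0; have th0 := theta_ge0; have th1 := theta_lt1.
set h := U `^ (- e); have h0 : 0 < h by rewrite powR_gt0.
have hle : h <= e / 2 by exact: hM2.
have Uh0 : 0 <= U / h by apply: divr_ge0; exact: ltW.
have /andP[tr1 tr2] := truncn_itv Uh0.
set J := (Num.truncn (U / h)).+1 in tr2 *.
have jU j : (j < J)%N -> 0 <= j%:R * h <= U.
  move=> jJ; rewrite mulr_ge0 ?(ltW h0) //= -ler_pdivlMr //; apply: le_trans tr1.
  by rewrite ler_nat.
pose f z := W z / (z - 1) * mollifier (X alpha U) z.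
have disc j z : (j < J)%N -> cabs (z - kappa +i* (t0 + j%:R * h)) <= kappa - alpha + e ->
    [/\ alpha - e <= Re z, U / 2 <= `|Im z| & cabs z <= 4 * U].
  by move=> /jU ja; exact: block_disc.
have zn1 z : U / 2 <= `|Im z| -> z != 1.
  move=> hz; apply: contraTneq hz => ->; rewrite /= normr0 -ltNge; lra.
have zt z : alpha - e <= Re z -> theta < Re z by lra.
have step : (\sum_(rho <- zs) m rho)%N%:R * ta <= 8 * (Cb * U `^ (density_exp theta alpha + 2 * lam)).
  have rk : 0 < kappa - alpha + e / 2 by lra.
  have tar : ta <= (kappa - alpha + e) / (kappa - alpha + e / 2) - 1.
    rewrite (_ : _ - 1 = e / 2 / (kappa - alpha + e / 2)); last first.
      by rewrite -[X in _ - X](divff (lt0r_neq0 rk)) -mulrBl; congr (_ / _); lra.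
    rewrite (_ : ta = e / 2 / kappa); last by rewrite /ta; field; rewrite gt_eqF.
    by apply: ler_wpM2l; [exact: ltW|rewrite lef_pV2 ?posrE //; lra].
  have tak : (alpha <= kappa)%R by lra.
  rewrite mulrC; apply: le_trans (ler_wpM2r (ler0n _ _) tar) _.
  (* A zero is assigned to the grid point just below it in height, at distance at most h <= e /
     2. *)
  apply: (@zero_block R f (dpoly (X alpha U) (Y alpha U)) kappa alpha e h t0 _ e3 J zs m
    (fun rho => Num.truncn ((Im rho - t0) / h))) => //.
  - move=> j z jJ /(disc j z jJ)[z1 z2 _]; apply: cdiffM; last exact: cdiff_mollifier.
    by apply: cdiff_div_sub1; [exact: zn1|apply: W_diff; exact: zt].
  - by move=> z; exact: cdiff_dpoly.
  - move=> j z jJ /(disc j z jJ)[z1 z2 z3].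
    apply: le_trans (hCa _ _ _ U1 a0 a1 z1 z2 z3) _.
    by rewrite mulrC -ler_pdivlMr //; exact: hM1.
  - by move=> j jJ; apply: hk.
  - by rewrite ge_min lexx.
  - apply: le_trans tar; rewrite expr2.
    have h1 : e3 <= 1 / 4 by rewrite ge_min lexx.
    have h2 : e3 <= ta / 4 by rewrite ge_min lexx orbT.
    have := ler_pM (ltW e30) (ltW e30) h1 h2; lra.
  - by move=> s hs; exact: hCb.
  move=> rho /hzs[/andP[r1 r2] /andP[i1 i2] [g dg hg]].
  have d0 : 0 <= (Im rho - t0) / h by apply: divr_ge0; [rewrite subr_ge0|exact: ltW].
  have /andP[q1 q2] := truncn_itv d0.
  split.
  - by rewrite r1 (le_trans r2) //; lra.
  - rewrite ltnS; apply: le_truncn; apply: ler_wpM2r; first by rewrite invr_ge0 ltW.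
    by rewrite lerBlDl.
  - move: q1 q2; rewrite ler_pdivlMr // ltr_pdivrMr // -natr1 [X in _ < X]mulrDl mul1r => q1 q2.
    rewrite ler_norml; apply/andP; split; lra.
  exists (fun z => g z * mollifier (X alpha U) z).
    by apply: cdiffM => //; exact: cdiff_mollifier.
  by apply: cnearS hg => z hz; rewrite /f hz mulrA.
by rewrite [leRHS]mulrAC ler_pdivlMr // -mulrA.
Qed.

End Blocks.

End Mollifier.

(** * Counting zeros *)

Section ZeroCount.
Variables (R : realType) (theta : R) (W : R[i] -> R[i]).
Hypothesis theta_ge0 : 0 <= theta.
Hypothesis theta_lt1 : theta < 1.
Hypothesis W_diff : forall s, theta < Re s -> cdiff W s.
Hypothesis W_neq0 : forall s, 1 < Re s -> W s != 0.

(** Only a lower bound on the order of vanishing, so that the counts apply before the order is known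
    to be finite. *)
Definition divides_germ (f : R[i] -> R[i]) (m : nat) (rho : R[i]) :=
  exists2 g, cdiff g rho & cnear rho (fun z => f z = (z - rho) ^+ m * g z).

Local Notation tau := (@pi R *+ 2).
Local Notation zet := (fun z => W z / (z - 1)).

Lemma divides_germ_W m rho : rho != 1 -> divides_germ zet m rho -> divides_germ W m rho.
Proof.
move=> r1 [g dg hg]; exists (fun z => g z * (z - 1)).
  by apply: cdiffM => //; apply: cdiffB; [exact: cdiff_id|exact: cdiff_cst].
apply: cnearS (cnearI hg (cnear_neq r1)) => z [hz z1].
by rewrite mulrA -hz divfK // subr_eq0.
Qed.

(* One disc, centred far to the right on the real axis, covers the zeros of bounded height. *)
Lemma low_zeros_bound (U0 : R) : exists n0 : nat, forall (zs : seq R[i]) (m : R[i] -> nat), uniq zs ->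
  (forall rho, rho \in zs -> [/\ rho != 1, (theta + 2) / 3 <= Re rho <= 1, `|Im rho| <= U0 &
     divides_germ zet (m rho) rho]) ->
  (\sum_(rho <- zs) m rho <= n0)%N.
Proof.
pose a := (theta + 2) / 3; pose d := (1 - theta) / 6.
have th0 := theta_ge0; have th1 := theta_lt1.
have d0 : 0 < d by rewrite /d; lra.
(* U0^2 <= 2 d k puts the zeros within k + d of a + k, while the disc of radius k + 2 d stays right
   of a - 2 d = (2 theta + 1) / 3 > theta. The 2 places the centre in Re > 1, where W does not
   vanish. *)
pose k := U0 ^+ 2 / (2 * d) + 2.
have k2 : 2 <= k by rewrite lerDr; apply: divr_ge0; [exact: sqr_ge0|lra].
have kU : U0 ^+ 2 <= 2 * d * k.
  rewrite /k mulrDr [2 * d * _]mulrC divfK; last by rewrite gt_eqF //; lra.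
  by rewrite lerDl; lra.
pose c : R[i] := (a + k)%:C.
pose r' := k + d; pose r := k + 2 * d.
have r'0 : 0 < r' by rewrite /r'; lra.
have r'r : r' < r by rewrite /r' /r; lra.
have hf z : cabs (z - c) <= r -> cdiff W z.
  move=> /(le_trans (Re_le_cabs _)); rewrite ReD ReN /= ler_norml => /andP[h _]; apply: W_diff.
  by move: h; rewrite /r /a /d; lra.
have [psi hpsi] := circ_bounded (lt_trans r'0 r'r) hf.
have Wc : 0 < cabs (W c) by rewrite cabs_gt0 W_neq0 //= /a; lra.
have q1 : 1 < r / r' by rewrite ltr_pdivlMr // mul1r.
have [n0 hn0] := pow_unbounded (psi tau - psi 0) q1 (mulr_gt0 Wc (tau_gt0 R)).
exists n0 => zs m uzs hzs.
have := @jensen R W c r r' zs m psi _ r'0 r'r hf uzs _ hpsi (fun phi _ => lexx _).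
have hz : forall rho, rho \in zs -> cabs (rho - c) <= r' /\
     exists2 g, cdiff g rho & cnear rho (fun z => W z = (z - rho) ^+ m rho * g z).
  move=> rho /hzs[r1 /andP[ra rb] iU hd]; split; last exact: divides_germ_W hd.
  rewrite -(ler_pXn2r (n := 2)) ?nnegrE ?cabs_ge0 ?(ltW r'0) // sqr_cabs.
  rewrite ReD ImD ReN ImN /= oppr0 addr0.
  have i2 : Im rho ^+ 2 <= U0 ^+ 2.
    rewrite -(real_normK (num_real (Im rho))) ler_pXn2r ?nnegrE ?normr_ge0 //.
    exact: le_trans (normr_ge0 _) iU.
  have r2 : (Re rho - (a + k)) ^+ 2 <= k ^+ 2.
    rewrite -sqrrN ler_pXn2r ?nnegrE //; first last.
    - lra.
    - rewrite /a; lra.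
    by rewrite /a; lra.
  have := sqr_ge0 d; move: kU i2 r2; rewrite /r' !expr2; nra.
move=> /(_ hz) hj; rewrite leqNgt; apply/negP => lt.
move: hn0; rewrite ltNge => /negP; apply; apply: le_trans hj.
rewrite [leRHS]mulrAC; apply: ler_wpM2l.
  by apply: mulr_ge0; [exact: cabs_ge0|exact: ltW (tau_gt0 R)].
by rewrite ler_eXn2l // ltnW.
Qed.

Hypothesis block_bound : forall eps : R, 0 < eps -> exists C U0 : R, [/\ 0 < C, 1 <= U0 &
  forall alpha U t0 (zs : seq R[i]) (m : R[i] -> nat), U0 <= U ->
  (theta + 2) / 3 <= alpha -> alpha <= 1 -> t0 = U \/ t0 = - (2 * U) -> uniq zs ->
  (forall rho, rho \in zs -> [/\ alpha <= Re rho <= 1, t0 <= Im rho <= t0 + U &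
     divides_germ zet (m rho) rho]) ->
  (\sum_(rho <- zs) m rho)%N%:R <= C * U `^ (density_exp theta alpha + eps)].

(** Halving T leaves one block above and one below the real axis. Even when [density_exp] is 0, the
    exponent exceeds 0 by eps, which gives the factor [q] < 1 that closes the induction with the
    same constant. *)
Lemma zeros_bound (eps : R) : 0 < eps -> exists2 C : R, 0 < C &
  forall alpha T (zs : seq R[i]) (m : R[i] -> nat), 1 <= T ->
  (theta + 2) / 3 <= alpha -> alpha <= 1 -> uniq zs ->
  (forall rho, rho \in zs -> [/\ rho != 1, alpha <= Re rho <= 1, `|Im rho| <= T &
     divides_germ zet (m rho) rho]) ->
  (\sum_(rho <- zs) m rho)%N%:R <= C * T `^ (density_exp theta alpha + eps).
Proof.
move=> e0; have [C1 [U0 [C10 U01 hB]]] := block_bound e0.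
have [n0 hn0] := low_zeros_bound (2 * U0).
pose q : R := 2 `^ (- eps).
have q0 : 0 < q by rewrite powR_gt0.
have q1 : q < 1.
  rewrite /q powRN invf_lt1 ?powR_gt0 //.
  by have := @gt0_ltr_powR R eps e0 1 2; rewrite !nnegrE powR1; apply; lra.
have q10 : 0 < 1 - q by rewrite subr_gt0.
(* The first entry covers the zeros of bounded height; the second ensures (C + 2 C1) q <= C. *)
pose C := Num.max (n0%:R + 1) (2 * C1 / (1 - q)).
have C0 : 0 < C by rewrite lt_max ltr_wpDl.
have Cn : n0%:R <= C by rewrite le_max lerDl ler01.
have Cq : (C + 2 * C1) * q <= C.
  have : 2 * C1 / (1 - q) <= C by rewrite le_max lexx orbT.
  rewrite ler_pdivrMr // => h; have : C1 * q <= C1 by rewrite ler_piMr // ltW.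
  lra.
exists C => // alpha T zs m T1 a0 a1.
set E := density_exp theta alpha + eps.
have Ee : eps <= E by rewrite lerDr density_exp_ge0.
have low T' zs' : 1 <= T' -> T' <= 2 * U0 -> uniq zs' -> (forall rho, rho \in zs' -> [/\ rho != 1,
    alpha <= Re rho <= 1, `|Im rho| <= T' & divides_germ zet (m rho) rho]) ->
    (\sum_(rho <- zs') m rho)%N%:R <= C * T' `^ E.
  move=> T'1 TU uzs hzs; have : (\sum_(rho <- zs') m rho <= n0)%N.
    apply: hn0 => // rho /hzs[r1 /andP[r2 r3] i1 d1]; split => //; last exact: le_trans i1 TU.
    by rewrite r3 (le_trans a0 r2).
  rewrite -(ler_nat R) => h; apply: le_trans h _; apply: le_trans Cn _.
  by apply: ler_peMr; [exact: ltW|apply: powR_ge1 => //; apply: le_trans Ee; exact: ltW].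
have [k] : exists k : nat, T <= 2 ^+ k * (2 * U0).
  exists (Num.bound T); apply: le_trans (_ : 2 ^+ Num.bound T <= _); last first.
    by apply: ler_peMr; [exact: exprn_ge0|lra].
  apply/ltW/(lt_trans (archi_boundP (le_trans ler01 T1))).
  by rewrite -natrX ltr_nat ltn_expl.
elim: k T zs T1 => [|k IH] T zs T1 Tk uzs hzs.
  by apply: low => //; rewrite expr0 mul1r in Tk.
have [TU|UT] := leP T (2 * U0).
  exact: low.
pose U := T / 2.
have UU : U0 <= U by rewrite /U; lra.
have U1 := le_trans U01 UU.
have TE : T = 2 * U by rewrite /U; lra.
clearbody U.
have P2 : U `^ E <= q * T `^ E.
  rewrite TE powRM ?(le_trans ler01 U1) // [leRHS]mulrA ler_peMl ?powR_ge0 //.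
  by rewrite /q -powRDp // powR_ge1 //; lra.
rewrite (bigID (fun rho => `|Im rho| <= U)) /= [X in (_ + X)%N](bigID (fun rho => 0 <= Im rho)) /=.
rewrite !natrD -big_filter -2!(big_filter _ (fun rho => ~~ (`|Im rho| <= U) && _)).
have b1 : (\sum_(i <- [seq rho <- zs | (`|Im rho| <= U)%R]) m i)%N%:R <= C * U `^ E.
  apply: IH => //; first 1 last.
  - by rewrite filter_uniq.
  - by move=> rho; rewrite mem_filter => /andP[iU /hzs[]].
  by move: Tk; rewrite TE exprS -mulrA ler_pM2l.
have b2 : (\sum_(i <- [seq rho <- zs | ~~ (`|Im rho| <= U)%R & (0 <= Im rho)%R]) m i)%N%:R <= C1 * U `^ E.
  apply: (hB _ _ U) => //; [by left|by rewrite filter_uniq|].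
  move=> rho; rewrite mem_filter -ltNge => /andP[/andP[iU i0] /hzs[_ r1 i2 d2]]; split => //.
  move: iU i2; rewrite ger0_norm // => iU i2; rewrite ltW //=; lra.
have b3 : (\sum_(i <- [seq rho <- zs | ~~ (`|Im rho| <= U)%R & ~~ (0 <= Im rho)%R]) m i)%N%:R <= C1 * U `^ E.
  apply: (hB _ _ (- (2 * U))) => //; [by right|by rewrite filter_uniq|].
  move=> rho; rewrite mem_filter -!ltNge => /andP[/andP[iU i0] /hzs[_ r1 i2 d2]]; split => //.
  by move: iU i2; rewrite ltr0_norm // => iU i2; apply/andP; split; lra.
apply: le_trans (lerD b1 (lerD b2 b3)) _.
rewrite [leLHS](_ : _ = (C + 2 * C1) * U `^ E); last by ring.
apply: le_trans (ler_wpM2l _ P2) _; first by apply: addr_ge0; [exact: ltW|lra].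
by rewrite mulrA ler_wpM2r ?powR_ge0.
Qed.

End ZeroCount.

(** * Zeros of the Beurling zeta function *)

Section FinalCount.
Variables (R : realType) (S : beurling_system R) (A theta p K : R).
Hypothesis A_gt0 : 0 < A.
Hypothesis theta_ge0 : 0 <= theta.
Hypothesis theta_lt1 : theta < 1.
Hypothesis N_asymp : forall x : R, 1 <= x ->
  `|(counting_fun S x)%:R - A * x| <= K * x `^ theta.
Hypothesis p_gt1 : 1 < p.
Hypothesis average_ramanujan : forall eps : R, 0 < eps ->
  exists K : R, forall x : R, 1 <= x ->
    \sum_(k \in [set k | gint S k <= x]) (chi S (gint S k) 1)%:R `^ p <= K * x `^ (1 + eps).

Let near1 k := [set l | `|gint S k - gint S l| <= 1].

Let near1_finite k : finite_set (near1 k).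
Proof.
apply: sub_finite_set (gint_finite A_gt0 theta_lt1 N_asymp (gint S k + 1)) => l /=.
by rewrite /near1 /= ler_norml => /andP[h _]; lra.
Qed.

Lemma chi_card D k : \sum_(l < D | `|gint S k - gint S l| <= 1) 1 <= (chi S (gint S k) 1)%:R :> R.
Proof.
have -> : \sum_(l < D | `|gint S k - gint S l| <= 1) 1 =
    (\sum_(l < D | (`|gint S k - gint S l| <= 1)%R) 1)%N%:R :> R by rewrite natr_sum.
rewrite ler_nat -(big_mkord (fun l => (`|gint S k - gint S l| <= 1)%R) (fun=> 1%N)) sum1_count -size_filter.
rewrite /chi; apply: uniq_leq_size; first by rewrite filter_uniq // iota_uniq.
by move=> l; rewrite mem_filter => /andP[hl _]; rewrite in_fset_set ?inE //; exact: near1_finite.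
Qed.

Lemma chi_ge1 k : 1 <= (chi S (gint S k) 1)%:R :> R.
Proof.
apply: le_trans (chi_card k.+1 k); rewrite (bigD1 ord_max) ?subrr ?normr0 //=.
by rewrite lerDl sumr_ge0.
Qed.

Lemma chi_average (eps : R) : 0 < eps -> exists C, forall x : R, 1 <= x ->
  \sum_(0 <= k < counting_fun S x) (chi S (gint S k) 1)%:R <= C * x `^ (1 + eps).
Proof.
move=> /average_ramanujan[C hC]; exists C => x /hC; apply: le_trans.
rewrite (fset_iota_sum A_gt0 theta_lt1 N_asymp); apply: ler_sum => k _.
by rewrite -[leLHS]powRr1 // ler_powR ?chi_ge1 // ltW.
Qed.

Lemma zeta_zeros_bound : exists W : R[i] -> R[i],
  [/\ forall s, theta < Re s -> cdiff W s,
      forall s, theta < Re s -> s != 1 -> zeta S theta s = W s / (s - 1),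
      forall s, 1 < Re s -> W s != 0 &
      forall eps : R, 0 < eps -> exists2 C : R, 0 < C &
        forall alpha T (zs : seq R[i]) (m : R[i] -> nat), 1 <= T ->
        (theta + 2) / 3 <= alpha -> alpha <= 1 -> uniq zs ->
        (forall rho, rho \in zs -> [/\ rho != 1, alpha <= Re rho <= 1, `|Im rho| <= T &
           divides_germ (fun z => W z / (z - 1)) (m rho) rho]) ->
        (\sum_(rho <- zs) m rho)%N%:R <= C * T `^ (density_exp theta alpha + eps)].
Proof.
have [W [Wd Wz Wa]] := zeta_contP A_gt0 theta_ge0 theta_lt1 N_asymp.
have K0 : 0 <= K.
  by have := le_trans (normr_ge0 _) (N_asymp (lexx 1)); rewrite powR1 mulr1.
have [ev [e1 e2 e3 e4]] := exponents_ex S.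
have p1 := @gprime_gt1 _ S; have pinf := gprime_infty S.
have NP := gint_leP A_gt0 theta_lt1 N_asymp.
have n1 := gint_ge1 p1 e1 e4.
have n_gt0 k : 0 < gint S k := lt_le_trans ltr01 (n1 k).
have n_gt1 k (k0 : (0 < k)%N) := gint_gt1 p1 NP e1 e2 e3 e4 k0.
have n00 := gint0 p1 NP e1 e2 e4.
pose mb := mob R e1; pose cv := conv (counting_fun S) e1.
have cv_sum X Y s : X <= Y ->
    \sum_(0 <= k < counting_fun S Y) (cv X k)%:C * cpw (gint S k) (- s) =
    \sum_(0 <= d < counting_fun S X) (mb d)%:C * cpw (gint S d) (- s) *
      \sum_(0 <= m < counting_fun S (Y / gint S d)) cpw (gint S m) (- s).
  move=> XY; apply: (@conv_sum R _ (gint S) (counting_fun S) ev p1 NP e1 e2 e3 e4) => // k l.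
  by rewrite (gint_mulx e1 e2 e4) cpwM.
have cv_id X (X1 : 1 <= X) : cv X 0 = 1 by exact: (conv_id p1 NP e1 e2 e3 e4).
have cv0 X k (k0 : (0 < k)%N) (kX : gint S k <= X) : cv X k = 0.
  exact: (conv_eq0 p1 NP e1 e2 e3 e4).
have cvb := divisor_bound (counting_fun S) p1 pinf e1 e3 e4.
have ml := mob_le1 R e1.
have Wn0 := W_neq0 n1 NP n00 theta_lt1 A_gt0 K0 Wa ml cv_id cv0 cvb cv_sum chi_average chi_card.
exists W; split => // eps e0; apply: zeros_bound => // eps' e'0.
(* The block bound loses 2 lam <= eps' in the exponent. *)
pose lam := Num.min (eps' / 2) (1 / 4).
have l0 : 0 < lam by rewrite lt_min divr_gt0 //=; lra.
have l1 : lam <= 1 / 4 by rewrite ge_min lexx orbT.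
have [C [U0 [C0 U01 hC]]] := zero_block_bound n1 NP n_gt1 n00 theta_ge0 theta_lt1 A_gt0 K0 Wa Wd ml
  cv_id cv0 cvb cv_sum chi_average chi_card l0 l1 erefl.
exists C, U0; split => // alpha U t0 zs m U0U a0 a1 ht uzs hzs.
apply: le_trans (hC _ _ _ _ _ U0U a0 a1 ht uzs hzs) _.
apply: ler_wpM2l; first exact: ltW.
apply: ler_powR; first exact: le_trans U01 U0U.
by rewrite lerD2l -ler_pdivlMl // mulrC ge_min lexx.
Qed.

End FinalCount.

(** * Multiplicity of zeros *)

Section Multiplicity.
Variables (R : realType) (f : R[i]^o -> R[i]^o) (h : R[i] -> R[i]) (rho : R[i]).
Hypothesis f_holo : holomorphic_at f rho.
Hypothesis fh : cnear rho (fun z => f z = h z).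

(** With the admissible m bounded, the supremum in [zero_order] is a maximum; m = 0 is admissible
    because f is holomorphic. *)
Lemma zero_order_nat (M : nat) : (forall m, divides_germ h m rho -> (m <= M)%N) ->
  exists2 m : nat, zero_order f rho = m%:R%:E & divides_germ h m rho.
Proof.
move=> hM.
pose P m := `[< exists2 g : R[i]^o -> R[i]^o, holomorphic_at g rho &
  \forall s \near (rho : R[i]^o), f s = (s - rho) ^+ m * g s >].
have PD m : P m -> divides_germ h m rho.
  move=> /asboolP[g hg fg]; exists g.
    by apply/derivableP1; exact: (nbhs_singleton hg).
  have fg' : cnear rho (fun s => f s = (s - rho) ^+ m * g s) by apply/cnbhsP.
  by apply: cnearS (cnearI fh fg') => z [<- ->].
have exP : exists m, P m.
  exists 0%N; apply/asboolP; exists f => //; apply/cnbhsP; apply: cnearT => z.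
  by rewrite expr0 mul1r.
have ubP m : P m -> (m <= M)%N by move=> /PD /hM.
case: (ex_maxnP exP ubP) => m Pm mmax; exists m; last exact: PD.
apply/eqP; rewrite eq_le; apply/andP; split.
  apply: ge_ereal_sup => _ [k /= hk <-]; rewrite lee_fin ler_nat; apply: mmax.
  exact/asboolP.
by apply: ereal_sup_ubound; exists m => //; exact/asboolP.
Qed.

End Multiplicity.

Theorem theorem3p4 (R : realType) (S : beurling_system R) (A theta p : R)
  (A_gt0 : 0 < A) (theta_ge0 : 0 <= theta) (theta_lt1 : theta < 1)
  (N_asymp : exists K : R, forall x : R, 1 <= x ->
     `|(counting_fun S x)%:R - A * x| <= K * x `^ theta)
  (p_gt1 : 1 < p)
  (average_ramanujan : forall eps : R, 0 < eps ->
     exists K : R, forall x : R, 1 <= x ->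
       \sum_(k \in [set k | gint S k <= x]) (chi S (gint S k) 1)%:R `^ p
         <= K * x `^ (1 + eps)) :
  forall eps : R, 0 < eps -> exists C : R, forall delta : R, 0 < delta ->
    exists T0 : R, forall T alpha : R, T0 <= T -> (theta + 2) / 3 + delta <= alpha ->
      (zeta_zero_count S theta alpha T <=
        (C * T `^ ((1 - alpha) / (2 * alpha ^+ 2 - 3 * alpha + 2 - theta)
                     * (4 * alpha - 2 * theta) + eps))%:E)%E.
Proof.
have [K hK] := N_asymp.
have [W [Wd Wz Wn0 hW]] := zeta_zeros_bound A_gt0 theta_ge0 theta_lt1 hK p_gt1 average_ramanujan.
move=> eps /hW[C C0 hC]; exists C => delta d0; exists 1 => T alpha T1 da.
have a0 : (theta + 2) / 3 <= alpha by lra.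
have at0 : theta < alpha by lra.
rewrite -[X in X + eps]/(density_exp theta alpha).
have B0 : 0 <= C * T `^ (density_exp theta alpha + eps).
  by apply: mulr_ge0; [exact: ltW|exact: powR_ge0].
have zn1 rho : zeta_zeros S theta alpha T rho -> Re rho <= 1.
  move=> [r1 z0 ra _]; rewrite leNgt; apply/negP => /Wn0 W0.
  have ts := lt_le_trans at0 ra.
  by move: z0; rewrite (Wz _ ts r1) => /eqP; rewrite mulf_eq0 (negPf W0) invr_eq0 subr_eq0 (negPf r1).
(* For alpha > 1 there are no zeros to count, W being nonzero there. *)
have [a1|a1] := ltP 1 alpha.
  rewrite /zeta_zero_count (_ : zeta_zeros _ _ _ _ = set0) ?esum_set0 ?lee_fin //.
  apply/seteqP; split=> // rho zr; have := zn1 _ zr; case: zr => _ _ ra _ r1.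
  by move: a1; rewrite ltNge (le_trans ra r1).
have eqz rho : theta < Re rho -> rho != 1 -> cnear rho (fun z => zeta S theta z = W z / (z - 1)).
  move=> ts r1; apply: cnearS (cnearI (cnear_Re_gt ts) (cnear_neq r1)) => z [].
  exact: Wz.
have holo rho : theta < Re rho -> rho != 1 -> holomorphic_at (zeta S theta) rho.
  move=> ts r1; apply/cnbhsP; apply: cnearS (cnearI (cnear_Re_gt ts) (cnear_neq r1)) => z [tz z1].
  apply/derivableP1; apply: (@cdiff_ext _ (fun z => W z / (z - 1))).
    by apply: cnearS (eqz z tz z1) => w ->.
  by apply: cdiff_div_sub1 => //; exact: Wd.
pose M := Num.truncn (C * T `^ (density_exp theta alpha + eps)).
have /choice[m hm] : forall rho : R[i], exists m : nat, zeta_zeros S theta alpha T rho ->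
    zero_order (zeta S theta) rho = m%:R%:E /\ divides_germ (fun z => W z / (z - 1)) m rho.
  move=> rho; have [zr|] := pselect (zeta_zeros S theta alpha T rho); last by exists 0%N.
  have r1' := zn1 _ zr; case: (zr) => r1 z0 ra rT.
  have ts := lt_le_trans at0 ra.
  (* The count applied to rho alone, with any admissible k as its multiplicity, bounds k by M; so
     the order is finite. *)
  have [k hk|k e1 e2] := zero_order_nat (holo _ ts r1) (eqz _ ts r1) (M := M); last by exists k.
  rewrite truncn_ge_nat //.
  have := hC alpha T [:: rho] (fun=> k) T1 a0 a1 isT.
  rewrite big_cons big_nil addn0; apply => z; rewrite inE => /eqP ->; split => //.
  by rewrite ra.
(* The sum over all zeros is a supremum over finite sets of zeros, and the count bounds each of
   them. *)
apply: ge_ereal_sup => _ [F [finF FZ] <-].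
rewrite fsbig_finite //= (eq_big_seq (fun rho => (m rho)%:R%:E)); last first.
  by move=> rho; rewrite in_fset_set // inE => /FZ /hm[].
rewrite sumEFin lee_fin -natr_sum; apply: hC => //; first exact: fset_uniq.
move=> rho; rewrite in_fset_set // inE => Fr; have zr := FZ _ Fr.
by have r1' := zn1 _ zr; have [_ dm] := hm _ zr; case: zr => r1 z0 ra rT; split; rewrite ?ra.
Qed.
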